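(* Let $p\in[1,+\infty)$, $\theta\in[0,2p-1)$, $\delta\ge0$, and let $\mathcal O$ and $\mathcal A$ satisfy the domain hypothesis and the kernel hypothesis of the context. Assume that there are positive constants $M,\alpha$ such that for every $t>0$, $$\|S(t)\|_{L(\mathcal L^p_\delta,\mathcal L^p_\delta)}\le Me^{-\alpha t}.$$ Then there exists $C>0$ such that for every $t>0$, $$\|S(t)\|_{L(L^p_{\theta,\delta},L^p_{\theta,\delta})}\le Ce^{-\alpha t}.$$
   Context: Notation. $\mathcal O\subset\mathbb R^d$, $\mathcal O\ne\mathbb R^d$, is an open connected set; $\rho(z)=\mathrm{dist}(z,\partial\mathcal O)$; $m_t(z)=\min\{1,\rho(z)/\sqrt t\}$; $g_t(z)=(2\pi t)^{-d/2}e^{-|z|^2/(2t)}$. $L^p_{\theta,\delta}=L^p(\mathcal O,w_{\theta,\delta}(x)\,\mathrm{d}x)$ with $w_{\theta,\delta}(x)=\min\{\rho(x)^\theta,(1+|x|^2)^{-\delta}\}$, and $\mathcal L^p_\delta=L^p(\mathcal O,(1+|x|^2)^{-\delta}\,\mathrm{d}x)$. $L(E,V)$ is the space of bounded linear operators from a Banach space $E$ to a Banach space $V$ with the operator norm. Domain hypothesis. $\mathcal O$ is a $C^{1,\beta}$-domain for some $\beta\in(0,1)$ and satisfies the connected line condition: there is a constant $\chi\ge1$ such that any $x,y\in\mathcal O$ can be joined by a rectifiable curve contained in $\mathcal O$ of length at most $\chi|x-y|$. Kernel hypothesis. $\mathcal A\phi(x)=\sum_{i,j=1}^d\frac{\partial}{\partial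 x_i}\big(a_{ij}(x)\frac{\partial\phi}{\partial x_j}(x)\big)+\sum_{i=1}^d\mu^i(x)\frac{\partial\phi}{\partial x_i}(x)$. The homogeneous Dirichlet problem $\partial_tu=\mathcal Au$ in $\mathcal O$ for $t>0$, $u=0$ on $\partial\mathcal O$, $u(0)=f$, generates a $C_0$-semigroup $(S(t))$ on $L^2(\mathcal O,\mathrm{d}x)$, represented by a Green kernel $G$: $S(t)\psi(x)=\int_{\mathcal O}G(t,x,y)\psi(y)\,\mathrm{d}y$. There is $\lambda>0$ with $\lambda|h|^2\le\langle a(x)a^T(x)h,h\rangle\le\lambda^{-1}|h|^2$ for all $x,h\in\mathbb R^d$, and there are constants $C,c>0$ such that for all $t\in(0,1]$, $x,y\in\mathcal O$, $$G(t,x,y)\le C\,m_t(y)\,g_{ct}(x-y),\qquad |\nabla_xG(t,x,y)|\le C\,\frac{m_t(y)}{\sqrt t}\,g_{ct}(x-y).$$ On the weighted spaces $L^p_{\theta,\delta}$ and $\mathcal L^p_\delta$, $S(t)$ denotes the operator given by the same kernel formula. *)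

(* Defs.v *)
From HB Require Import structures.
From mathcomp Require Import all_boot all_order all_algebra.
From mathcomp Require Import all_classical all_reals all_analysis.

Set Implicit Arguments.
Unset Strict Implicit.
Unset Printing Implicit Defensive.

Import Order.TTheory GRing.Theory Num.Def Num.Theory.
Import numFieldNormedType.Exports.

Local Open Scope classical_set_scope.
Local Open Scope ring_scope.

Definition rV_display : measure_display.
Proof. exact: default_measure_display. Qed.

(* The sigma-algebra of 'rV[R]_n generated by the coordinates, i.e. the Borel
   sigma-algebra. *)
Section rV_measurable.
Variables (R : realType) (n : nat).

Let coors (i : 'I_n) (x : 'rV[R]_n) : R := x ord0 i.

Let rV_set0 : g_sigma_preimage coors set0.
Proof. exact: sigma_algebra0. Qed.

Let rV_setC A : g_sigma_preimage coors A -> g_sigma_preimage coors (~` A).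
Proof. exact: sigma_algebraC. Qed.

Let rV_bigcup (F : _^nat) : (forall i, g_sigma_preimage coors (F i)) ->
  g_sigma_preimage coors (\bigcup_i (F i)).
Proof. exact: sigma_algebra_bigcup. Qed.

HB.instance Definition _ := @isMeasurable.Build rV_display
  'rV[R]_n (g_sigma_preimage coors) rV_set0 rV_setC rV_bigcup.

End rV_measurable.

Section lebesgue_rV_step.
Variables (R : realType) (n : nat).
Variable mu : {sigma_finite_measure set 'rV[R]_n -> \bar R}.

Definition rV_cons (p : R * 'rV[R]_n) : 'rV[R]_n.+1 :=
  row_mx (p.1%:M : 'M[R]_1) p.2.

Lemma rV_cons0 p : rV_cons p ord0 ord0 = p.1.
Proof.
have -> : (ord0 : 'I_n.+1) = lshift n (ord0 : 'I_1) by apply: val_inj.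
apply: (etrans (row_mxEl (p.1%:M : 'M[R]_1) p.2 ord0 ord0)).
by rewrite mxE eqxx mulr1n.
Qed.

Lemma rV_consS p (i : 'I_n) : rV_cons p ord0 (lift ord0 i) = p.2 ord0 i.
Proof.
have -> : lift ord0 i = rshift 1 i by apply: val_inj.
exact: (row_mxEr (p.1%:M : 'M[R]_1) p.2 ord0 i).
Qed.

Lemma measurable_rV_coord m (i : 'I_m) :
  measurable_fun [set: 'rV[R]_m] (fun x : 'rV[R]_m => x ord0 i).
Proof.
move=> _ Y mY; rewrite setTI; apply: sub_sigma_algebra => /=.
rewrite -bigcup_seq/=; exists i => /=; first by rewrite mem_index_enum.
by exists Y => //; rewrite setTI.
Qed.

Lemma measurable_fun_rVP d (T : measurableType d) m (f : T -> 'rV[R]_m) :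
  (forall i, measurable_fun [set: T] (fun x => f x ord0 i)) ->
  measurable_fun [set: T] f.
Proof.
move=> mf _ A mA; rewrite setTI.
suff : g_sigma_preimage (fun i (x : 'rV[R]_m) => x ord0 i) `<=`
       [set B | measurable (f @^-1` B)] by move/(_ A mA).
apply: smallest_sub.
  split => /=.
  - by rewrite preimage_set0; exact: measurable0.
  - move=> B mB; rewrite setTD -preimage_setC; exact: measurableC.
  - by move=> F mF; rewrite preimage_bigcup; exact: bigcup_measurable.
rewrite -bigcup_seq; apply: bigcup_sub => i _ _ [B mB <-] /=.
rewrite setTI; have := mf i measurableT B mB; rewrite setTI; exact.
Qed.

Lemma measurable_rV_cons : measurable_fun [set: R * 'rV[R]_n] rV_cons.
Proof.
apply: measurable_fun_rVP => i.
have [j ->|->] := unliftP ord0 i.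
  under eq_fun do rewrite rV_consS.
  apply: (measurableT_comp (f := fun x : 'rV[R]_n => x ord0 j)) => //.
  exact: measurable_rV_coord.
under eq_fun do rewrite rV_cons0.
exact: measurable_fst.
Qed.

Definition rV_behead (x : 'rV[R]_n.+1) : 'rV[R]_n :=
  \row_j x ord0 (lift ord0 j).

Lemma measurable_rV_behead : measurable_fun [set: 'rV[R]_n.+1] rV_behead.
Proof.
apply: measurable_fun_rVP => i.
by under eq_fun do rewrite mxE; exact: measurable_rV_coord.
Qed.

Lemma rV_consK p : rV_behead (rV_cons p) = p.2.
Proof. by apply/rowP => j; rewrite mxE rV_consS. Qed.

Definition lebesgue_rV_step : set 'rV[R]_n.+1 -> \bar R :=
  pushforward (lebesgue_measure \x mu)%E rV_cons.

Let step0 : lebesgue_rV_step set0 = 0%E.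
Proof. by rewrite /lebesgue_rV_step /pushforward preimage_set0 measure0. Qed.

Let step_ge0 A : (0 <= lebesgue_rV_step A)%E.
Proof. exact: integral_ge0. Qed.

Let mpre A : measurable A -> measurable (rV_cons @^-1` A).
Proof. by move=> mA; rewrite -[X in measurable X]setTI; exact: measurable_rV_cons. Qed.

Let step_sigma_additive : semi_sigma_additive lebesgue_rV_step.
Proof.
move=> F mF tF mUF; rewrite /lebesgue_rV_step /pushforward preimage_bigcup.
apply: measure_semi_sigma_additive.
- by move=> k; exact: mpre.
- apply/trivIsetP => /= i j _ _ ij; rewrite -preimage_setI.
  by move/trivIsetP : tF => /(_ _ _ _ _ ij) ->//; rewrite preimage_set0.
- by rewrite -preimage_bigcup; exact: mpre.
Qed.

HB.instance Definition _ := isMeasure.Build _ _ _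
  lebesgue_rV_step step0 step_ge0 step_sigma_additive.

Let step_sigma_finite : sigma_finite setT lebesgue_rV_step.
Proof.
have /sigma_finiteP[F [TF ndF Foo]] :=
  sigma_finiteT (@lebesgue_measure R : {sigma_finite_measure set _ -> \bar R}).
have /sigma_finiteP[G [TG ndG Goo]] := sigma_finiteT mu.
exists (fun k => (fun x : 'rV[R]_n.+1 => (x ord0 ord0 : R)) @^-1` F k `&` rV_behead @^-1` G k).
  apply/esym; rewrite -subTset => x _.
  have [k _ Fk] : (\bigcup_i F i) (x ord0 ord0) by rewrite -TF.
  have [l _ Gl] : (\bigcup_i G i) (rV_behead x) by rewrite -TG.
  exists (maxn k l) => //; split => /=.
    by move: Fk; apply/subsetPset/ndF; rewrite leq_maxl.
  by move: Gl; apply/subsetPset/ndG; rewrite leq_maxr.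
move=> k; split.
  apply: measurableI; rewrite -[X in measurable X]setTI.
    by apply: measurable_rV_coord => //; exact: (Foo k).1.
  by apply: measurable_rV_behead => //; exact: (Goo k).1.
rewrite /lebesgue_rV_step /pushforward.
rewrite (_ : _ @^-1` _ = F k `*` G k); last first.
  by apply/seteqP; split=> -[r y] /=; rewrite rV_cons0 rV_consK.
rewrite product_measure1E ?lte_mul_pinfty//.
- by rewrite ge0_fin_numE//; exact: (Foo k).2.
- exact: (Goo k).2.
- exact: (Foo k).1.
- exact: (Goo k).1.
Qed.

HB.instance Definition _ := Measure_isSigmaFinite.Build _ _ _
  lebesgue_rV_step step_sigma_finite.

End lebesgue_rV_step.

(* Lebesgue measure on R^n, as the n-fold product of the one-dimensional one. *)
Fixpoint lebesgue_rV (R : realType) (n : nat) :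
    {sigma_finite_measure set 'rV[R]_n -> \bar R} :=
  match n with
  | 0 => \d_(0 : 'rV[R]_0)
  | n'.+1 => lebesgue_rV_step (lebesgue_rV R n')
  end.

Lemma lebesgue_rV_box (R : realType) (n : nat) (A : 'I_n -> set R) :
  (forall i, measurable (A i)) ->
  lebesgue_rV R n [set x | forall i, A i (x ord0 i)] =
  (\prod_(i < n) lebesgue_measure (A i))%E.
Proof.
elim: n => [|n IHn] in A *.
  move=> _; rewrite big_ord0 /= diracE mem_set//=.
  by case.
move=> mA; rewrite big_ord_recl.
rewrite -[LHS]/((lebesgue_measure \x lebesgue_rV R n)%E
  (@rV_cons R n @^-1` [set x | forall i, A i (x ord0 i)])).
have -> : @rV_cons R n @^-1` [set x | forall i, A i (x ord0 i)] =
    A ord0 `*` [set y : 'rV[R]_n | forall i : 'I_n, A (lift ord0 i) (y ord0 i)].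
  apply/seteqP; split=> -[r y] /=.
    move=> H; split => [|i]; first by have := H ord0; rewrite rV_cons0.
    by have := H (lift ord0 i); rewrite rV_consS.
  move=> [H0 HS] i; have [j ->|->] := unliftP ord0 i.
    by rewrite rV_consS.
  by rewrite rV_cons0.
have mB : measurable
    [set y : 'rV[R]_n | forall i : 'I_n, A (lift ord0 i) (y ord0 i)].
  rewrite (_ : mkset _ = \bigcap_(i in [set: 'I_n])
      ((fun y : 'rV[R]_n => y ord0 i) @^-1` A (lift ord0 i))); last first.
    by apply/seteqP; split => [y H i _|y H i]; [exact: H|exact: (H i)].
  apply: fin_bigcap_measurable => // i _; rewrite -[X in measurable X]setTI.
  exact: measurable_rV_coord.
rewrite product_measure1E//; last exact: mA.
by congr (_ * _)%E; apply: (IHn (fun i => A (lift ord0 i))).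
Qed.

Section euclidean.
Variables (R : realType) (d : nat).
Implicit Types (x z : 'rV[R]_d) (O : set 'rV[R]_d) (f : 'rV[R]_d -> R).

(* The library norm of 'rV[R]_d is the sup norm, whence a separate notion. *)
Definition enorm x : R := Num.sqrt (\sum_(i < d) x ord0 i ^+ 2).

Definition partial (i : 'I_d) f x : R := 'D_(delta_mx ord0 i) f x.

Definition grad f x : 'rV[R]_d := \row_i partial i f x.

Definition frontier O : set 'rV[R]_d := closure O `\` O°.

Definition rho O z : R := inf [set enorm (z - y) | y in frontier O].

Definition mt O (t : R) z : R := minr 1 (rho O z / Num.sqrt t).

Definition gauss (t : R) z : R :=
  (2 * pi * t) `^ (- (d%:R / 2)) * expR (- (enorm z ^+ 2 / (2 * t))).

Definition curve_length (gam : R -> 'rV[R]_d) : \bar R :=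
  ereal_sup [set (\sum_(0 <= k < size s)
    enorm (gam (nth 1 (0 :: s) k.+1) - gam (nth 1 (0 :: s) k)))%:E
    | s in itv_partition 0 1].

Definition connected_line_condition O : Prop :=
  exists2 chi : R, 1 <= chi & forall x y, O x -> O y ->
    exists gam : R -> 'rV[R]_d,
      [/\ {within `[0, 1], continuous gam}, gam 0 = x, gam 1 = y,
          forall s, s \in `[0, 1] -> O (gam s) &
          (curve_length gam <= (chi * enorm (x - y))%:E)%E].

Fixpoint is_Ck (k : nat) f : Prop :=
  match k with
  | 0 => continuous f
  | k'.+1 => (forall x, differentiable f x) /\
             (forall i, is_Ck k' (partial i f))
  end.

Definition test_function O f : Prop :=
  (forall k, is_Ck k f) /\
  exists K, [/\ compact K, K `<=` O & forall x, ~ K x -> f x = 0].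

End euclidean.

(* Near each boundary point z, in orthonormal coordinates y = (x - z) Q centred
   at z and tangent to the boundary, O is the region above the graph of a
   C^{1,beta} function phi.  The radius r0 and the constant L do not depend
   on z, which is what distinguishes this from a local condition when the
   boundary is unbounded. *)
Definition C1beta_domain (R : realType) (n : nat) (beta : R)
    (O : set 'rV[R]_n.+1) : Prop :=
  exists r0 L : R, 0 < r0 /\ forall z, frontier O z ->
    exists (Q : 'M[R]_n.+1) (phi : 'rV[R]_n -> R),
      [/\ Q *m Q^T = 1%:M,
          phi 0 = 0 /\ grad phi 0 = 0,
          (forall x, differentiable phi x) /\
            (forall x, enorm (grad phi x) <= L),
          forall x y, enorm (grad phi x - grad phi y) <=
            L * enorm (x - y) `^ beta &
          forall x, enorm (x - z) < r0 ->
            let y := (x - z) *m Q in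
            O x <-> phi (col' ord_max y) < y ord0 ord_max].

Section weighted_Lp.
Variables (R : realType) (d : nat) (O : set 'rV[R]_d).
Implicit Types (w f g : 'rV[R]_d -> R) (p : R).

Local Notation leb := (lebesgue_rV R d).

Definition Lp_norm w p f : \bar R :=
  ((\int[leb]_(x in O) (`|f x| `^ p * w x)%:E) `^ p^-1)%E.

Definition in_Lp w p f : Prop :=
  measurable_fun O f /\ (Lp_norm w p f < +oo)%E.

Definition op_norm w p (T : ('rV[R]_d -> R) -> 'rV[R]_d -> R) : \bar R :=
  ereal_sup [set Lp_norm w p (T f) | f in
    [set f | in_Lp w p f /\ (Lp_norm w p f <= 1)%E]].

(* Elements of L^p are functions, identified up to equality a.e. in O;
   compatibility of T with this identification follows from linearity and
   finiteness of the norm. *)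
Definition bounded_linear_op w p (T : ('rV[R]_d -> R) -> 'rV[R]_d -> R) :=
  [/\ forall f, in_Lp w p f -> in_Lp w p (T f),
      forall (k : R) f g, in_Lp w p f -> in_Lp w p g ->
        {ae leb, forall x, O x ->
          T (fun y => k * f y + g y) x = k * T f x + T g x} &
      (op_norm w p T < +oo)%E].

Definition kernel_defined_at (K : 'rV[R]_d -> 'rV[R]_d -> R) f x : Prop :=
  leb.-integrable O (fun y => (K x y * f y)%:E).

Definition kernel_op (K : 'rV[R]_d -> 'rV[R]_d -> R) f x : R :=
  \int[leb]_(y in O) (K x y * f y).

(* K defines an element of L(E, E), E = L^p(O, w dx), of norm at most B. *)
Definition kernel_op_norm_le w p (K : 'rV[R]_d -> 'rV[R]_d -> R) (B : R) :=
  [/\ forall f, in_Lp w p f ->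
        {ae leb, forall x, O x -> kernel_defined_at K f x},
      bounded_linear_op w p (kernel_op K) &
      (op_norm w p (kernel_op K) <= B%:E)%E].

Definition wdelta (delta : R) (x : 'rV[R]_d) : R :=
  (1 + enorm x ^+ 2) `^ (- delta).

Definition wtheta_delta (theta delta : R) (x : 'rV[R]_d) : R :=
  minr (rho O x `^ theta) (wdelta delta x).

End weighted_Lp.

Section dirichlet.
Variables (R : realType) (d : nat) (O : set 'rV[R]_d).

Local Notation E := ('rV[R]_d).
Local Notation leb := (lebesgue_rV R d).
Local Notation L2_norm := (Lp_norm O (fun=> 1) 2).
Local Notation in_L2 := (in_Lp O (fun=> 1) 2).

Record C0_semigroup_L2 (S : R -> (E -> R) -> E -> R) : Prop := {
  C0_bounded : forall t : R, 0 <= t -> bounded_linear_op O (fun=> 1) 2 (S t) ;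
  C0_zero : forall f, in_L2 f -> {ae leb, forall x, O x -> S 0 f x = f x} ;
  C0_add : forall (s t : R) f, 0 <= s -> 0 <= t -> in_L2 f ->
    {ae leb, forall x, O x -> S (s + t) f x = S s (S t f) x} ;
  C0_cont : forall f, in_L2 f ->
    L2_norm (fun x => S t f x - f x) @[t --> 0^'+] --> 0%E
}.

(* u belongs to H^1_0(O), the closure of the test functions in H^1(O), and v is
   its weak gradient. *)
Definition H10 (u : E -> R) (v : E -> E) : Prop :=
  [/\ in_L2 u,
      forall i, in_L2 (fun x => v x ord0 i) &
      exists phi_ : nat -> E -> R,
        [/\ forall k, test_function O (phi_ k),
            L2_norm (fun x => phi_ k x - u x) @[k --> \oo] --> 0%E &
            forall i, L2_norm (fun x => partial i (phi_ k) x - v x ord0 i)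
              @[k --> \oo] --> 0%E]].

(* Weak solution u of
     du/dt = sum_ij D_i (a_ij D_j u) + sum_i mu_i D_i u  in O, t > 0,
     u = 0 on the boundary (u(t) in H^1_0), u(0) = f. *)
Definition dirichlet_solution (a : E -> 'M[R]_d) (mu : E -> E) (f : E -> R)
    (u : R -> E -> R) : Prop :=
  {ae leb, forall x, O x -> u 0 x = f x} /\
  forall t : R, 0 < t -> exists2 v : E -> E, H10 (u t) v &
    forall phi, test_function O phi ->
      let flux x := \sum_(i < d) \sum_(j < d)
        a x i j * v x ord0 j * partial i phi x in
      let drift x := \sum_(i < d) mu x ord0 i * v x ord0 i * phi x in
      [/\ leb.-integrable O (fun x => (flux x)%:E),
          leb.-integrable O (fun x => (drift x)%:E) &
          is_derive t 1 (fun s : R => \int[leb]_(x in O) (u s x * phi x))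
            (- (\int[leb]_(x in O) flux x) + \int[leb]_(x in O) drift x)].

Definition green_kernel (S : R -> (E -> R) -> E -> R) (G : R -> E -> E -> R) :=
  forall t : R, 0 < t ->
    measurable_fun (O `*` O) (fun z : E * E => G t z.1 z.2) /\
    forall f, in_L2 f ->
      {ae leb, forall x, O x -> kernel_defined_at O (G t) f x /\
                                S t f x = kernel_op O (G t) f x}.

Record kernel_hypothesis (a : E -> 'M[R]_d) (mu : E -> E)
    (S : R -> (E -> R) -> E -> R) (G : R -> E -> E -> R) : Prop := {
  kh_semigroup : C0_semigroup_L2 S ;
  kh_dirichlet : forall f, in_L2 f ->
    dirichlet_solution a mu f (fun t => S t f) ;
  kh_green : green_kernel S G ;
  kh_elliptic : exists2 lam : R, 0 < lam &
    forall x (h : 'cV[R]_d),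
      lam * enorm h^T ^+ 2 <= (h^T *m (a x *m (a x)^T *m h)) ord0 ord0 /\
      (h^T *m (a x *m (a x)^T *m h)) ord0 ord0 <= lam^-1 * enorm h^T ^+ 2 ;
  kh_bounds : exists C c : R, [/\ 0 < C, 0 < c &
    forall (t : R) x y, 0 < t -> t <= 1 -> O x -> O y ->
      [/\ G t x y <= C * mt O t y * gauss (c * t) (x - y),
          differentiable (G t ^~ y) x &
          enorm (grad (G t ^~ y) x) <=
            C * (mt O t y / Num.sqrt t) * gauss (c * t) (x - y)]]
}.

End dirichlet.

(* Main.v *)
(* Write g_s for the Gaussian of variance s, m_t for min(1, rho / sqrt t) and w
   for the weight.

   The kernel is bounded by hypothesis only from above.  The opposite bound holds
   almost everywhere: S(t)f has zero boundary values, so it cannot stay below a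
   negative constant along a segment that leaves O, while along a half-line
   issued from x and moving away from y the gradient bound allows G(t, ., y) to
   increase by at most a multiple of m_t(y) g_{ct}(x - y).  Testing against
   f = 1_W g_1, for W in a countable ring of sets, turns this into
   |G(t,x,y)| <= C m_t(y) g_{ct}(x - y) for almost all x and y, 0 < t <= 1.

   For t <= 1 a Schur test concludes.  Since theta < 2p - 1 there is gam in [0, 1)
   with theta <= p + gam (p - 1).  The integral of g_{ct}(x - y) m_t(y)^(-gam) dy
   is bounded because the points of O at distance less than eps from the boundary
   form a layer of volume O(eps); Jensen's inequality for this density leaves
   a kernel g_{ct}(x - y) m_t(y)^(p + gam (p - 1)), and
   w(x) g_{ct}(x - y) m_t(y)^theta <= C w(y) g_{2ct}(x - y).  At t = 1 the left
   weight may be replaced by (1 + |x|^2)^(-delta), so that S(1) is bounded from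
   L^p_{theta,delta} to the space without the boundary weight.

   For t > 1, S(t) = S(t - 1) S(1) reduces the claim to the assumed decay, the
   boundary-weighted norm being the smaller one.  On functions outside L^2 the
   semigroup law is obtained from the identity
   G(s + 1, x, y) = \int G(s, x, z) G(1, z, y) dz for almost all x and y. *)

Require Import Defs.
From mathcomp Require Import all_boot all_order all_algebra.
From mathcomp Require Import all_classical all_reals all_analysis.
From mathcomp Require Import ring lra measurable_realfun.

Set Implicit Arguments.
Unset Strict Implicit.
Unset Printing Implicit Defensive.

Import Order.TTheory GRing.Theory Num.Def Num.Theory.
Import numFieldNormedType.Exports.

Local Open Scope classical_set_scope.
Local Open Scope ring_scope.

(** * Topology and Lebesgue measure of R^n *)

#[global] Arguments lebesgue_rV : simpl never.

(** Two obstacles shape the lower bound. A statement about S(t)f holds off a null set of x that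
    depends on f, so only countably many f can be tested; yet they must determine a function of y up
    to null sets, which a countable ring generating the Borel sets does by a monotone class
    argument. And H^1_0 gives no pointwise boundary values: what survives is that u^2 integrates to
    O(h^2) over the points that leave O within time h in a fixed direction. If u <= -kappa on a set
    of finite measure that is carried into itself as long as the motion stays in O, its part leaving
    within time B is covered by N pieces, each of which translates into the part leaving within B/N;
    the total measure is O(1/N), hence zero.

    The range of theta comes from the splitting m = m^(-gam) m^(1+gam). The first factor has bounded
    Gaussian averages for gam < 1; Jensen turns the product into the power -gam + p (1 + gam) = p +
    gam (p - 1), which tends to 2p - 1 as gam tends to 1. S(1) gains the boundary weight because
    m_1(y)^theta <= rho(y)^theta. *)

Section rV_topology.
Variables (R : realType) (n : nat).
Implicit Types (x y : 'rV[R]_n) (A : set 'rV[R]_n).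

Definition box x (r : R) : set 'rV[R]_n :=
  [set y | forall i, `|x ord0 i - y ord0 i| < r].

Lemma measurable_box x r : measurable (box x r).
Proof.
rewrite (_ : box x r = \bigcap_(i in [set: 'I_n])
    ((fun y : 'rV[R]_n => y ord0 i) @^-1` [set s | `|x ord0 i - s| < r])); last first.
  by apply/seteqP; split => [y H i _|y H i]; [exact: H|exact: (H i)].
apply: fin_bigcap_measurable => // i _; rewrite -[X in measurable X]setTI.
apply: measurable_rV_coord => //.
rewrite (_ : mkset _ = `](x ord0 i - r), (x ord0 i + r)[%classic).
  exact: measurable_itv.
by apply/seteqP; split => s /=; rewrite in_itv/= ltr_distl => /andP[h1 h2];
  apply/andP; split; lra.
Qed.

Lemma nbhs_box A x : nbhs x A -> exists2 r : R, 0 < r & box x r `<=` A.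
Proof.
move=> /nbhs_ballP[r /= r0 H]; exists r => // y Hy; apply: H; split => // i j.
by rewrite (ord1 i); exact: Hy.
Qed.

Lemma box_nbhs x (r : R) : 0 < r -> nbhs x (box x r).
Proof.
move=> r0; apply/nbhs_ballP; exists r => //= y [_ H] i; exact: H.
Qed.

(** The sigma-algebra is generated by the coordinates, so an open set has to be exhibited as a
    countable union of boxes: rational centres, radii [1 / (k + 1)], keeping those contained in
    [A]. *)
Lemma open_measurable_rV A : open A -> measurable A.
Proof.
move=> oA.
pose c (q : 'rV[rat]_n) : 'rV[R]_n := \row_i ratr (q ord0 i).
pose F (p : 'rV[rat]_n * nat) : set 'rV[R]_n :=
  [set x | box (c p.1) (p.2.+1%:R^-1) x /\ box (c p.1) (p.2.+1%:R^-1) `<=` A].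
have -> : A = \bigcup_p F p.
  apply/seteqP; split => [x Ax|x [p _ [H HA]]]; last exact: HA.
  have [r r0 rA] := nbhs_box (oA _ Ax).
  (* Radius below [r / 2]: a box of this size that contains [x] lies in the box of radius [r] around
     [x]. *)
  pose k := Num.truncn (2 / r).
  have kr : k.+1%:R^-1 < r / 2.
    rewrite -[ltRHS]invrK ltf_pV2 ?posrE ?ltr0n ?invr_gt0 ?divr_gt0//.
    by rewrite invf_div; exact: truncnS_gt.
  have /choice[q qP] : forall i, exists q : rat, `|ratr q - x ord0 i| < k.+1%:R^-1.
    move=> i; have [|q] := @rat_in_itvoo R (x ord0 i - k.+1%:R^-1) (x ord0 i + k.+1%:R^-1).
      by rewrite ltrD2l gtrN// invr_gt0 ltr0n.
    by rewrite in_itv/= => qi; exists q; rewrite ltr_distl.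
  exists (\row_i q i, k) => //; split => [i|y Hy]; first by rewrite !mxE; exact: qP.
  apply: rA => i; rewrite (splitr r).
  have := Hy i; rewrite /= !mxE => Hyi.
  rewrite (_ : _ - _ = (x ord0 i - ratr (q i)) + (ratr (q i) - y ord0 i)); last first.
    by rewrite addrA subrK.
  apply: le_lt_trans (ler_normD _ _) _; apply: ltrD; last exact: lt_trans Hyi kr.
  by rewrite distrC; exact: lt_trans (qP i) kr.
apply: countable_bigcupT_measurable; first exact: countableP.
move=> p; have [h|h] := pselect (box (c p.1) (p.2.+1%:R^-1) `<=` A).
  rewrite (_ : F p = box (c p.1) (p.2.+1%:R^-1)); first exact: measurable_box.
  by apply/seteqP; split => // x [].
by rewrite (_ : F p = set0)// -subset0 => x [].
Qed.

Lemma continuous_measurable_rV (f : 'rV[R]_n -> R) :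
  continuous f -> measurable_fun setT f.
Proof.
move=> /continuousP cf; apply: (measurability _ (RGenOpens.measurableE R)).
move=> _ [_ [a [b ->] <-]]; rewrite setTI; apply: open_measurable_rV.
exact/cf/interval_open.
Qed.

Lemma enorm_ge0 x : 0 <= enorm x.
Proof. exact: sqrtr_ge0. Qed.

Lemma enorm_sqr x : enorm x ^+ 2 = \sum_i x ord0 i ^+ 2.
Proof. by rewrite sqr_sqrtr// sumr_ge0// => i _; rewrite sqr_ge0. Qed.

Lemma ge_enorm x i : `|x ord0 i| <= enorm x.
Proof.
rewrite -[leLHS]sqrtr_sqr; apply: ler_wsqrtr; rewrite (bigD1 i)//= lerDl.
by rewrite sumr_ge0// => j _; rewrite sqr_ge0.
Qed.

Lemma enorm0 : enorm (0 : 'rV[R]_n) = 0.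
Proof. by rewrite /enorm big1 ?sqrtr0// => i _; rewrite mxE expr0n. Qed.

Lemma enormZ (k : R) x : enorm (k *: x) = `|k| * enorm x.
Proof.
rewrite /enorm; under eq_bigr do rewrite mxE exprMn.
by rewrite -mulr_sumr sqrtrM ?sqr_ge0// sqrtr_sqr.
Qed.

Lemma enormN x : enorm (- x) = enorm x.
Proof. by rewrite -scaleN1r enormZ normrN normr1 mul1r. Qed.

Lemma enormB x y : enorm (x - y) = enorm (y - x).
Proof. by rewrite -enormN opprB. Qed.

Lemma enorm_eq0 x : enorm x = 0 -> x = 0.
Proof.
move=> x0; apply/rowP => i; rewrite mxE; apply/eqP; rewrite -normr_le0.
by rewrite -x0; exact: ge_enorm.
Qed.

Lemma cauchy_schwarz x y :
  \sum_i x ord0 i * y ord0 i <= enorm x * enorm y.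
Proof.
have [/enorm_eq0 ->|x0] := eqVneq (enorm x) 0.
  by rewrite enorm0 mul0r big1// => i _; rewrite mxE mul0r.
have [/enorm_eq0 ->|y0] := eqVneq (enorm y) 0.
  by rewrite enorm0 mulr0 big1// => i _; rewrite mxE mulr0.
have xp : 0 < enorm x by rewrite lt_def x0 enorm_ge0.
have yp : 0 < enorm y by rewrite lt_def y0 enorm_ge0.
(* The weights [|y| / |x|] and [|x| / |y|] make these Young inequalities add up to exactly
   [|x| |y|]. *)
have H i : x ord0 i * y ord0 i <=
    (enorm y / enorm x * x ord0 i ^+ 2 + enorm x / enorm y * y ord0 i ^+ 2) / 2.
  rewrite -subr_ge0; rewrite (_ : _ - _ =
    (enorm y * x ord0 i - enorm x * y ord0 i) ^+ 2 / (2 * enorm x * enorm y)).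
    by rewrite divr_ge0 ?sqr_ge0// !mulr_ge0// ltW.
  by field; rewrite x0 y0.
apply: le_trans (ler_sum _ (fun i _ => H i)) _.
rewrite -mulr_suml big_split/= -!mulr_sumr -!enorm_sqr le_eqVlt; apply/orP; left.
by apply/eqP; field; rewrite x0 y0.
Qed.

Lemma ler_enormD x y : enorm (x + y) <= enorm x + enorm y.
Proof.
rewrite -(@ler_pXn2r _ 2)// ?nnegrE ?addr_ge0 ?enorm_ge0//.
rewrite enorm_sqr; under eq_bigr do rewrite mxE sqrrD.
rewrite big_split big_split/= -!enorm_sqr sqrrD lerD2r lerD2l.
by rewrite sumrMnl lerMn2r/=; exact: cauchy_schwarz.
Qed.

Lemma ler_enorm_trans z x y : enorm (x - y) <= enorm (x - z) + enorm (z - y).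
Proof. by rewrite (_ : x - y = (x - z) + (z - y)) ?ler_enormD// addrA subrK. Qed.

Lemma enorm_le_box x (r : R) : 0 <= r -> (forall i, `|x ord0 i| <= r) ->
  enorm x <= Num.sqrt n%:R * r.
Proof.
move=> r0 H; rewrite -(@ler_pXn2r _ 2)// ?nnegrE ?mulr_ge0 ?sqrtr_ge0 ?enorm_ge0//.
rewrite enorm_sqr exprMn sqr_sqrtr ?ler0n//.
rewrite mulr_natl -[X in _ *+ X]card_ord -sumr_const.
apply: ler_sum => i _; rewrite -[leLHS]real_normK ?num_real//.
by rewrite ler_pXn2r ?nnegrE.
Qed.

(** The topology is that of the sup norm, which accounts for the factor [sqrt n] in [K]; the [+ 1]
    keeps [K] positive. *)
Lemma enorm_lipschitz_continuous (f : 'rV[R]_n -> R) (L : R) :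
  (forall x y, `|f x - f y| <= L * enorm (x - y)) -> continuous f.
Proof.
move=> fL x; apply/(@cvgrPdist_lt _ R^o _ (nbhs x) _ f (f x)) => e e0.
pose K := `|L| * Num.sqrt n%:R + 1.
have K0 : 0 < K by rewrite ltr_wpDl// mulr_ge0// sqrtr_ge0.
apply/nbhs_ballP; exists (e / K) => [|y [_ xy]]; first exact: divr_gt0.
apply: le_lt_trans (fL _ _) _.
have H : enorm (x - y) <= Num.sqrt n%:R * (e / K).
  apply: enorm_le_box => [|i]; first by rewrite ltW// divr_gt0.
  by rewrite !mxE ltW//; exact: xy.
apply: (@le_lt_trans _ _ (`|L| * (Num.sqrt n%:R * (e / K)))).
  apply: le_trans (_ : `|L| * enorm (x - y) <= _).
    by rewrite ler_wpM2r ?enorm_ge0// ler_norm.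
  by rewrite ler_wpM2l.
rewrite [X in X < _](_ : _ = (`|L| * Num.sqrt n%:R) * e / K); last by rewrite !mulrA.
by rewrite ltr_pdivrMr// mulrC ltr_pM2l// /K ltrDl.
Qed.

Lemma continuous_enorm : continuous (@enorm R n).
Proof.
apply: (@enorm_lipschitz_continuous _ 1) => x y; rewrite mul1r ler_norml.
have h1 := ler_enormD (x - y) y; have h2 := ler_enormD (y - x) x.
rewrite !subrK enormB in h1 h2; rewrite enormB.
by apply/andP; split; lra.
Qed.

Lemma measurable_enorm : measurable_fun setT (@enorm R n).
Proof. exact: (continuous_measurable_rV continuous_enorm). Qed.

End rV_topology.

(** * Integration on R^n: Tonelli, translations along the first axis, mass of the Gaussian *)

Section lebesgue_rV_theory.
Variable R : realType.

Lemma ge0_integral_lebesgue_rVS n (f : 'rV[R]_n.+1 -> \bar R) :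
  measurable_fun setT f -> (forall x, 0 <= f x)%E ->
  (\int[lebesgue_rV R n.+1]_x f x =
   \int[lebesgue_measure]_s \int[lebesgue_rV R n]_y f (rV_cons (s, y)))%E.
Proof.
move=> mf f0.
have mc : measurable_fun [set: measurableTypeR R * 'rV[R]_n] (@rV_cons R n).
  exact: measurable_rV_cons.
have h := ge0_integral_pushforward mc
   (lebesgue_measure \x lebesgue_rV R n)%E measurableT mf (fun y _ => f0 y).
have mfc : measurable_fun setT (f \o @rV_cons R n) by exact: measurableT_comp.
rewrite preimage_setT in h.
have e := fubini_tonelli1 (m1 := lebesgue_measure) (m2 := lebesgue_rV R n) _ mfc (fun z => f0 _).
rewrite /fubini_F in e; rewrite -[RHS]e; apply: etrans h.
exact: eq_measure_integral.
Qed.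

Lemma ge0_integral_lebesgue_rVS' n (f : 'rV[R]_n.+1 -> \bar R) :
  measurable_fun setT f -> (forall x, 0 <= f x)%E ->
  (\int[lebesgue_rV R n.+1]_x f x =
   \int[lebesgue_rV R n]_y \int[lebesgue_measure]_s f (rV_cons (s, y)))%E.
Proof.
move=> mf f0; rewrite ge0_integral_lebesgue_rVS//.
apply: (fubini_tonelli (m1 := lebesgue_measure) (m2 := lebesgue_rV R n)
  (fun z => f (rV_cons z))) => //.
by apply: (measurableT_comp mf); exact: measurable_rV_cons.
Qed.

Lemma lebesgue_measure_shift (a : R) (A : set R) : measurable A ->
  pushforward lebesgue_measure ((fun s => s + a) : _ -> measurableTypeR R) A =
  lebesgue_measure A.
Proof.
have ma : measurable_fun setT ((fun s => s + a) : R -> measurableTypeR R).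
  exact: measurable_funD.
move=> mA; apply/esym.
apply: (lebesgue_measure_unique) => //= _ [[b c]] _ <-.
rewrite /pushforward (_ : _ @^-1` _ = `]b - a, c - a]%classic); last first.
  by apply/seteqP; split => s /=; rewrite !in_itv/= ltrBlDr lerBrDr.
rewrite !lebesgue_measure_itv/= !lte_fin ltrD2r.
by case: ifPn => // _; rewrite -!EFinB; congr EFin; lra.
Qed.

Lemma ge0_integral_shift (a : R) (f : R -> \bar R) :
  measurable_fun setT f -> (forall x, 0 <= f x)%E ->
  (\int[lebesgue_measure]_s f (s + a)%R = \int[lebesgue_measure]_s f s)%E.
Proof.
move=> mf f0.
have ma : measurable_fun setT ((fun s => s + a) : measurableTypeR R -> measurableTypeR R).
  exact: measurable_funD.
have := ge0_integral_pushforward ma lebesgue_measure measurableT mf (fun y _ => f0 y).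
rewrite preimage_setT => <-.
by apply: eq_measure_integral => A mA _; exact: lebesgue_measure_shift.
Qed.

Lemma rV_cons_shift n (a s : R) (y : 'rV[R]_n) :
  rV_cons (s, y) + a *: delta_mx ord0 ord0 = rV_cons (s + a, y).
Proof.
apply/rowP => i; rewrite mxE [X in _ + X]mxE [X in _ * X]mxE eqxx/=.
have [j ->|->] := unliftP ord0 i; last by rewrite !rV_cons0 eqxx mulr1.
by rewrite !rV_consS/= mulr0 addr0.
Qed.

Lemma measurable_rV_shift n (v : 'rV[R]_n) :
  measurable_fun setT (fun x : 'rV[R]_n => x + v).
Proof.
apply: measurable_fun_rVP => i; under eq_fun do rewrite mxE.
by apply: measurable_funD => //; exact: measurable_rV_coord.
Qed.

(** All half-lines in the lower bound have direction plus or minus [delta_mx ord0 ord0]. With the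
    first coordinate integrated innermost, such a translation acts on a one-dimensional integral. *)
Lemma ge0_integral_rV_shift n (a : R) (f : 'rV[R]_n.+1 -> \bar R) :
  measurable_fun setT f -> (forall x, 0 <= f x)%E ->
  (\int[lebesgue_rV R n.+1]_x f (x + a *: delta_mx ord0 ord0)%R =
   \int[lebesgue_rV R n.+1]_x f x)%E.
Proof.
move=> mf f0; rewrite ge0_integral_lebesgue_rVS'//; last first.
  exact: (measurableT_comp mf (measurable_rV_shift _)).
rewrite [RHS]ge0_integral_lebesgue_rVS'//; apply: eq_integral => y _.
under eq_integral do rewrite rV_cons_shift.
apply: (ge0_integral_shift a (f := fun s => f (rV_cons (s, y)))) => //.
apply: (measurableT_comp mf); apply: (measurableT_comp (@measurable_rV_cons R n)).
exact: measurable_fun_pair.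
Qed.

Lemma lebesgue_rV_shift n (a : R) (A : set 'rV[R]_n.+1) : measurable A ->
  lebesgue_rV R n.+1 [set x | A (x + a *: delta_mx ord0 ord0)] =
  lebesgue_rV R n.+1 A.
Proof.
move=> mA; have mB : measurable [set x | A (x + a *: delta_mx ord0 ord0)].
  by rewrite -[X in measurable X]setTI; exact: measurable_rV_shift.
have E B : measurable B ->
    lebesgue_rV R n.+1 B = (\int[lebesgue_rV R n.+1]_x (\1_B x)%:E)%E.
  by move=> mB'; rewrite integral_indic// setIT.
rewrite E// [RHS]E//.
rewrite -[RHS](ge0_integral_rV_shift a (f := EFin \o \1_A))//.
- exact/measurable_EFinP.
- by move=> x; rewrite lee_fin.
Qed.

Lemma lebesgue_rV_box_radius n (x : 'rV[R]_n) (r : R) : 0 <= r ->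
  lebesgue_rV R n (box x r) = ((2 * r) ^+ n)%:E.
Proof.
move=> r0.
rewrite (_ : box x r = [set y | forall i, `](x ord0 i - r), (x ord0 i + r)[%classic (y ord0 i)]); last first.
  by apply/seteqP; split => y /= H i; have := H i; rewrite in_itv/= ltr_distl => /andP[h1 h2];
  apply/andP; split; lra.
rewrite (lebesgue_rV_box (A := fun i => `](x ord0 i - r), (x ord0 i + r)[%classic)); last first.
  by move=> i; exact: measurable_itv.
under eq_bigr do rewrite lebesgue_measure_itv/= lte_fin.
transitivity (\prod_(i < n) (2 * r)%:E)%E; last first.
  by rewrite prodEFin prodr_const card_ord.
apply: eq_bigr => i _; case: ifPn => h; first by rewrite -EFinB; congr EFin; lra.
by congr EFin; lra.
Qed.

Lemma gauss_ge0 n t (z : 'rV[R]_n) : 0 <= gauss t z.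
Proof. by rewrite mulr_ge0 ?powR_ge0 ?expR_ge0. Qed.

Lemma gauss_gt0 n t (z : 'rV[R]_n) : 0 < t -> 0 < gauss t z.
Proof. by move=> t0; rewrite mulr_gt0 ?expR_gt0// powR_gt0// !mulr_gt0// pi_gt0. Qed.

Lemma gaussN n t (z : 'rV[R]_n) : gauss t (- z) = gauss t z.
Proof. by rewrite /gauss enormN. Qed.

Lemma gaussB n t (x y : 'rV[R]_n) : gauss t (x - y) = gauss t (y - x).
Proof. by rewrite -gaussN opprB. Qed.

Lemma measurable_gauss n t : measurable_fun setT (@gauss R n t).
Proof.
apply: measurable_funM => //; apply: measurableT_comp => //.
apply: measurableT_comp => //; apply: measurable_funM => //.
by apply: measurable_funX; exact: measurable_enorm.
Qed.

Lemma measurable_gaussB n t (y : 'rV[R]_n) :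
  measurable_fun setT (fun x : 'rV[R]_n => gauss t (x - y)).
Proof. exact: (measurableT_comp (measurable_gauss _) (measurable_rV_shift _)). Qed.

Lemma gaussS n t (s : R) (x : 'rV[R]_n) (y : 'rV[R]_n.+1) : 0 < t ->
  gauss t (rV_cons (s, x) - y) =
  normal_pdf (y ord0 ord0) (Num.sqrt t) s * gauss t (x - rV_behead y).
Proof.
move=> t0; have st0 : Num.sqrt t != 0 by rewrite gt_eqF// sqrtr_gt0.
have pt0 : 0 < 2 * pi * t by rewrite !mulr_gt0// pi_gt0.
rewrite normal_pdfE// /normal_peak /normal_fun /gauss !enorm_sqr big_ord_recl.
have -> : (rV_cons (s, x) - y) ord0 ord0 = s - y ord0 ord0.
  by rewrite mxE [X in _ + X]mxE rV_cons0.
have -> : \sum_(i < n) (rV_cons (s, x) - y) ord0 (lift ord0 i) ^+ 2 =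
    \sum_(i < n) (x - rV_behead y) ord0 i ^+ 2.
  apply: eq_bigr => i _; rewrite [in RHS]mxE [X in _ = (_ + X) ^+ 2]mxE.
  by rewrite [X in _ = (_ - X) ^+ 2]mxE mxE [X in (_ + X) ^+ 2]mxE rV_consS.
rewrite [(_ + _) / (2 * t)]mulrDl opprD expRD mulrACA; congr (_ * (_ * _)).
  rewrite (_ : n.+1%:R / 2 = 1 / 2 + n%:R / 2); last by rewrite -[n.+1%:R]natr1 mulrDl addrC.
  rewrite opprD powRD; last by rewrite (gt_eqF pt0) implybT.
  congr (_ * _); rewrite div1r powRN sqr_sqrtr ?ltW// powR12_sqrt ?ltW//.
  by rewrite mulr2n; congr (Num.sqrt _)^-1; lra.
by rewrite sqr_sqrtr ?ltW// mulNr mulr2n; congr expR; congr (- (_ / _)); lra.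
Qed.

Lemma integral_gauss n t (y : 'rV[R]_n) : 0 < t ->
  (\int[lebesgue_rV R n]_x (gauss t (x - y)%R)%:E = 1)%E.
Proof.
move=> t0; elim: n => [|n IHn] in y *.
  rewrite [LHS](integral_dirac (0 : 'rV[R]_0) measurableT); last first.
    by apply/measurable_EFinP; exact: measurable_gaussB.
  rewrite diracT mul1e /gauss (_ : 0 - y = 0); last by apply/rowP => -[].
  by rewrite enorm0 mul0r oppr0 powRr0 expr0n/= mul0r oppr0 expR0 mul1r.
rewrite ge0_integral_lebesgue_rVS; last 2 first.
- by apply/measurable_EFinP; exact: measurable_gaussB.
- by move=> x; rewrite lee_fin gauss_ge0.
rewrite -[RHS](integral_normal_pdf (y ord0 ord0) (Num.sqrt t)).
apply: eq_integral => s _.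
under eq_integral do rewrite gaussS// EFinM.
rewrite ge0_integralZl//; last 3 first.
- by apply/measurable_EFinP; exact: measurable_gaussB.
- by move=> x _; rewrite lee_fin gauss_ge0.
- by rewrite lee_fin normal_pdf_ge0.
by rewrite IHn mule1.
Qed.

End lebesgue_rV_theory.

(** * Determining sets and Jensen's inequality *)

Section generated_ring.
Variables (T : Type) (e : nat -> set T).

(* The finite Boolean combinations of the first [k] generators, indexed by their
   truth tables: a countable ring of sets. *)
Definition table_set (p : {k : nat & {ffun k.-tuple bool -> bool}}) : set T :=
  [set x | projT2 p [tuple `[< e i x >] | i < projT1 p]].

Lemma table_set_widen k l (kl : (k <= l)%N) (A : {ffun k.-tuple bool -> bool}) :
  table_set (existT _ k A) = table_set (existT _ l
    [ffun t : l.-tuple bool => A [tuple tnth t (widen_ord kl i) | i < k]]).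
Proof.
have E x : [tuple `[< e i x >] | i < k] =
    [tuple tnth [tuple `[< e i x >] | i < l] (widen_ord kl i) | i < k].
  by apply: eq_from_tnth => i; rewrite !tnth_mktuple.
by apply/seteqP; split => x; rewrite /table_set/= ffunE -E.
Qed.

Lemma table_setring : setring (range table_set).
Proof.
have two p q : exists k (A B : {ffun k.-tuple bool -> bool}),
    table_set p = table_set (existT _ k A) /\
    table_set q = table_set (existT _ k B).
  case: p q => [k A] [l B]; exists (maxn k l).
  rewrite (table_set_widen (leq_maxl k l)) (table_set_widen (leq_maxr k l)).
  by eexists; eexists; split.
split.
- exists (existT _ 0%N [ffun=> false]) => //.
  by rewrite -subset0 => x; rewrite /table_set/= ffunE.
- move=> _ _ [p _ <-] [q _ <-]; have [k [A [B [-> ->]]]] := two p q.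
  exists (existT _ k [ffun t => A t || B t]) => //.
  apply/seteqP; split => x; rewrite /table_set/= ffunE; first by move/orP.
  by move=> ?; apply/orP.
- move=> _ _ [p _ <-] [q _ <-]; have [k [A [B [-> ->]]]] := two p q.
  exists (existT _ k [ffun t => A t && ~~ B t]) => //.
  apply/seteqP; split => x; rewrite /table_set/= ffunE; first by case/andP => ? /negP.
  by move=> [? ?]; apply/andP; split => //; apply/negP.
Qed.

Lemma table_setT : range table_set setT.
Proof.
exists (existT _ 0%N [ffun=> true]) => //.
by apply/seteqP; split => x; rewrite /table_set/= ?ffunE.
Qed.

Lemma table_set_gen i : range table_set (e i).
Proof.
exists (existT _ i.+1 [ffun t => tnth t ord_max]) => //.
by apply/seteqP; split => x; rewrite /table_set/= ffunE tnth_mktuple => /asboolP.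
Qed.

(** The monotone class theorem for rings yields the generated sigma-ring; since the whole space is
    itself a table set, complements stay in it and it contains the generated sigma-algebra. *)
Lemma monotone_table_set (C : set (set T)) : monotone C ->
  range table_set `<=` C -> <<s range e >> `<=` C.
Proof.
move=> mC tC.
apply: subset_trans (monotone_setring_sub_g_sigma_ring mC table_setring tC).
apply: smallest_sub; last first.
  by move=> _ [i _ <-]; apply: sub_g_sigma_ring; exact: table_set_gen.
have [h0 hD hU] := smallest_sigma_ring (range table_set).
split => // A hA; apply: hD => //.
by apply: sub_g_sigma_ring; exact: table_setT.
Qed.

End generated_ring.

Section le0_table.
Local Open Scope ereal_scope.
Context d (T : measurableType d) (R : realType).
Variables (mu : {measure set T -> \bar R}) (O : set T) (e : nat -> set T).
Hypotheses (mO : measurable O) (me : @measurable _ T = <<s range e >>).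

Lemma measurable_table_set p : measurable (table_set e p).
Proof.
have mC : range (table_set e) `<=` measurable.
  have [h0 hU hD] := table_setring e.
  case: p => k A _ [] {}p _ <-.
  rewrite (_ : table_set e p = \bigcup_(t in [set t | projT2 p t])
     \bigcap_(i in [set: 'I_(projT1 p)]) [set x | `[< e i x >] = tnth t i]); last first.
    apply/seteqP; split => [x px|x [t /= pt] H].
      by exists [tuple `[< e i x >] | i < projT1 p] => // i _ /=; rewrite tnth_mktuple.
    rewrite /table_set/= (_ : [tuple _ | _ < _] = t)//.
    by apply: eq_from_tnth => i; rewrite tnth_mktuple; exact: H.
  apply: fin_bigcup_measurable => [|t _]; first exact: finite_finset.
   apply: fin_bigcap_measurable => // i _.
  have mei : measurable (e i) by rewrite me; apply: sub_sigma_algebra; exists i.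
  case: (tnth t i).
    rewrite (_ : mkset _ = e i)//.
    by apply/seteqP; split => x /=; [move/asboolP|move=> ?; apply/asboolP].
  rewrite (_ : mkset _ = ~` e i); first exact: measurableC.
  by apply/seteqP; split => x /=; [move/asboolPn|move=> ?; apply/asboolPn].
by apply: mC; exists p.
Qed.

(** By dominated convergence the measurable sets over which [h] has nonpositive integral form a
    monotone class, so every measurable set is among them. For the set where [h] is positive the
    integral is then zero. *)
Lemma ae_le0_table_set (h : T -> R) : mu.-integrable O (EFin \o h) ->
  (forall p, \int[mu]_(x in O `&` table_set e p) (h x)%:E <= 0) ->
  {ae mu, forall x, O x -> (h x <= 0)%R}.
Proof.
move=> ih hp.
have mh : measurable_fun O h by apply/measurable_EFinP; exact: measurable_int ih.
pose C := [set P | measurable P /\ \int[mu]_(x in O `&` P) (h x)%:E <= 0].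
(* Eventual equality of membership at each point covers increasing unions and decreasing
   intersections at once. *)
have cvgC (F : nat -> set T) (P : set T) : measurable P ->
    (forall i, C (F i)) ->
    (forall x, \forall n \near \oo, (x \in F n) = (x \in P)) -> C P.
  move=> mP CF FP; split=> //.
  have [] := @dominated_convergence _ _ _ mu O mO
    (fun n => (EFin \o h) \_ (F n)) ((EFin \o h) \_ P) (fun x => `|(h x)%:E|).
  - move=> n; apply/(measurable_restrict _ _ _) => //; first exact: (CF n).1.
    by apply/measurable_EFinP; exact: measurable_funS mh.
  - apply/(measurable_restrict _ _ _) => //.
    by apply/measurable_EFinP; exact: measurable_funS mh.
  - apply: aeW => x _; apply: cvg_near_cst.
    by apply: filterS (FP x) => n En; rewrite /patch En.
  - exact: integrable_abse.
  - apply: aeW => x n _; rewrite /patch; case: ifP => //= _.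
    by rewrite lee_fin normr0.
  move=> _ _; under eq_fun do rewrite -integral_mkcondr; rewrite -integral_mkcondr => L.
  apply: (cvge_le _ L); apply: nearW => n; exact: (CF n).2.
have : <<s range e >> `<=` C.
  apply: monotone_table_set; last by move=> _ [p _ <-]; split; [exact: measurable_table_set|exact: hp].
  split=> F mF CF; apply: (cvgC F) => //.
  - by apply: bigcup_measurable => n _; exact: (CF n).1.
  - move=> x; have [[n _ Fnx]|nF] := pselect ((\bigcup_i F i) x).
      exists n => // m /= nm; rewrite !mem_set//; first by exists n.
      by have /subsetPset := mF _ _ nm; exact.
    apply: nearW => n; rewrite !memNset// => Fn; apply: nF; by exists n.
  - by apply: bigcap_measurable => [|n _]; [exists 0%N|exact: (CF n).1].
  - move=> x; have [Fx|/existsNP[n /not_implyP[_ nF]]] := pselect ((\bigcap_i F i) x).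
      by apply: nearW => n; rewrite !mem_set//; exact: Fx.
    exists n => // m /= nm; rewrite !memNset//; first by move=> /(_ n I).
    have /subsetPset FF := mF _ _ nm; by move=> Fmx; apply: nF; exact: FF.
rewrite -me => CT.
pose P := [set x | O x /\ (0 < h x)%R].
have mP : measurable P.
  rewrite (_ : P = O `&` h @^-1` `]0%R, +oo[%classic); first exact: mh.
  by apply/seteqP; split => x [Ox]; rewrite /= ?in_itv/= ?andbT.
have OP : O `&` P = P by apply/setIidr => x [].
have [_] := CT _ mP; rewrite OP => hP.
have /(ae_eq_integral_abs _ mP) : \int[mu]_(x in P) `|(h x)%:E| = 0.
  apply/eqP; rewrite eq_le integral_ge0// andbT; apply: le_trans hP.
  by under eq_integral => x /set_mem[_ hx] do rewrite gee0_abs ?lee_fin ?ltW//.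
case.
  by apply/measurable_EFinP; apply: measurable_funS mh => // x [].
move=> N [mN N0 HN]; exists N; split => //; apply: subset_trans HN.
move=> x /= /not_implyP[Ox /negP]; rewrite -ltNge => hx.
by move=> /(_ (conj Ox hx)) [hx0]; rewrite hx0 ltxx in hx.
Qed.

End le0_table.

Lemma le_poweR (R : realType) (x y : \bar R) (p : R) :
  0 <= p -> (0 <= x)%E -> (x <= y)%E -> (x `^ p <= y `^ p)%E.
Proof.
move=> p0 x0 xy; apply: (gt0_ler_poweR p0) => //; rewrite in_itv/= leey andbT//.
exact: le_trans xy.
Qed.

Lemma ge0_integralZl_real d (T : measurableType d) (R : realType)
    (mu : {measure set T -> \bar R}) (D : set T) (k : R) (f : T -> R) :
  measurable D -> measurable_fun D f -> 0 <= k -> (forall x, D x -> 0 <= f x) ->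
  (\int[mu]_(x in D) (k * f x)%:E = k%:E * \int[mu]_(x in D) (f x)%:E)%E.
Proof.
move=> mD mf k0 f0; under eq_integral do rewrite EFinM.
have f0' x : D x -> (0 <= (f x)%:E)%E by move=> Dx; rewrite lee_fin; exact: f0.
have mf' : measurable_fun D (fun x => (f x)%:E) by exact/measurable_EFinP.
by rewrite ge0_integralZl.
Qed.

Section jensen.
Local Open Scope ereal_scope.
Context d (T : measurableType d) (R : realType).
Variable mu : {measure set T -> \bar R}.

(** Jensen for the measure [k dmu], of mass at most [A]: this is Hoelder applied to [k^(1/q)] and
    [k^(1/p) h] with [q = p / (p - 1)]. *)
Lemma integral_mul_powR_le (k h : T -> R) (p A : R) :
  measurable_fun setT k -> measurable_fun setT h ->
  (forall x, 0 <= k x)%R -> (forall x, 0 <= h x)%R -> (1 <= p)%R ->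
  \int[mu]_x (k x)%:E <= A%:E ->
  (\int[mu]_x (k x * h x)%:E) `^ p <=
  (A `^ (p - 1))%:E * \int[mu]_x (k x * h x `^ p)%:E.
Proof.
move=> mk mh k0 h0 p1 kA.
have kh0 : 0 <= \int[mu]_x (k x * h x)%:E.
  by apply: integral_ge0 => x _; rewrite lee_fin mulr_ge0.
(* For [p = 1] there is no finite conjugate exponent; both sides then agree, as [A^0 = 1]. *)
move: p1; rewrite le_eqVlt => /predU1P[<-|p1].
  rewrite subrr powRr0 mul1e poweRe1//.
  by under [leRHS]eq_integral do rewrite powRr1//.
have p0 : (0 < p)%R by rewrite (lt_trans ltr01).
have pn0 : (p != 0)%R by rewrite gt_eqF.
have p10 : (0 < p - 1)%R by rewrite subr_gt0.
pose q := (p / (p - 1))%R.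
have q0 : (0 < q)%R by rewrite divr_gt0.
have qn0 : (q != 0)%R by rewrite gt_eqF.
have pq : (q^-1 + p^-1 = 1)%R.
  by rewrite /q; field; rewrite pn0 gt_eqF.
have mkr (r : R) : measurable_fun setT (fun x => k x `^ r)%R.
  by apply: (measurableT_comp (measurable_powR r)).
have := hoelder mu (mkr q^-1%R) (measurable_funM (mkr p^-1%R) mh) q0 p0 pq.
rewrite Lnorm1 => H.
have {H} : (\int[mu]_x (k x * h x)%:E) <=
   'N[mu]_q%:E[EFin \o (fun x => k x `^ q^-1)%R] *
   'N[mu]_p%:E[EFin \o ((fun x => k x `^ p^-1)%R \* h)%R].
  apply: le_trans H; rewrite le_eqVlt; apply/orP; left; apply/eqP.
  apply: eq_integral => x _ /=; rewrite mulrA -powRD ?pq ?oner_eq0//.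
  by rewrite powRr1// ger0_norm// mulr_ge0.
move=> /(le_poweR (ltW p0) kh0) H.
apply: le_trans H _; rewrite poweRM ?Lnorm_ge0//.
rewrite (poweR_Lnorm _ _ pn0).
have -> : 'N[mu]_q%:E[EFin \o (fun x => k x `^ q^-1)%R] `^ p =
    (\int[mu]_x (k x)%:E) `^ (p - 1).
  have e : (p = q * (p - 1))%R by rewrite /q; field; rewrite gt_eqF.
  rewrite [in LHS]e poweRrM poweR_Lnorm//; congr (_ `^ _).
  apply: eq_integral => x _ /=; rewrite ger0_norm ?powR_ge0//.
  by rewrite ?poweR_EFin -powRrM mulVf// powRr1.
apply: lee_pmul.
- exact: poweR_ge0.
- by apply: integral_ge0 => x _; exact: poweR_ge0.
- by rewrite -poweR_EFin; apply: le_poweR (ltW p10) _ kA; apply: integral_ge0 => x _; rewrite lee_fin.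
rewrite le_eqVlt; apply/orP; left; apply/eqP; apply: eq_integral => x _ /=.
rewrite ger0_norm ?mulr_ge0 ?powR_ge0// ?poweR_EFin powRM ?powR_ge0//.
by rewrite -powRrM mulVf// powRr1.
Qed.

End jensen.

Section rV_generators.
Variables (R : realType) (n : nat).

(** A sequence of generators keeps the ring of table sets countable, so that almost-everywhere
    statements indexed by it can be intersected. Integers that code no pair give the empty set. *)
Definition rat_halfspace (k : nat) : set 'rV[R]_n :=
  if @unpickle ('I_n * rat)%type k is Some p then [set x | x ord0 p.1 < ratr p.2]
  else set0.

Lemma measurable_rat_halfspace :
  @measurable _ 'rV[R]_n = <<s range rat_halfspace >>.
Proof.
apply/seteqP; split; last first.
  apply: smallest_sub; first exact: sigma_algebra_measurable.
  move=> _ [k _ <-]; rewrite /rat_halfspace; case: unpickle => [[i q]|]//=.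
  rewrite (_ : (fun x : 'rV[R]_n => _) = (fun x : 'rV[R]_n => x ord0 i) @^-1` `]-oo, (ratr q)[%classic).
    rewrite -[X in measurable X]setTI; by apply: measurable_rV_coord.
  by apply/seteqP; split => x /=; rewrite in_itv.
apply: smallest_sub; first exact: smallest_sigma_algebra.
rewrite -bigcup_seq; apply: bigcup_sub => i _ _ [B mB <-] /=; rewrite setTI.
have : <<s @RGenInftyO.G R >> `<=`
    [set B | <<s range rat_halfspace >> ((fun x : 'rV[R]_n => x ord0 i) @^-1` B)].
  have [h0 hC hU] := @smallest_sigma_algebra _ setT (range rat_halfspace).
  apply: smallest_sub.
    split; first by rewrite /= preimage_set0.
    - by move=> A /=; rewrite setTD -preimage_setC -setTD; exact: hC.
    - by move=> F hF /=; rewrite preimage_bigcup; apply: hU.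
  move=> _ [r ->] /=.
  rewrite (_ : _ @^-1` _ = \bigcup_k (if @unpickle rat k is Some q then
      if ratr q <= r then [set x : 'rV[R]_n | x ord0 i < ratr q] else set0 else set0)); last first.
    apply/seteqP; split => x /=; rewrite in_itv/=.
      move=> /rat_in_itvoo[q]; rewrite in_itv/= => /andP[xq qr].
      have [k kq] : exists k, @unpickle rat k = Some q by exists (pickle q); exact: pickleK.
      by exists k; [exact: I|rewrite kq (ltW qr)].
    move=> [k _]; case: unpickle => // q; case: ifPn => // qr /= xq.
    exact: lt_le_trans qr.
  apply: hU => k; case: unpickle => // q; case: ifPn => // _.
  apply: sub_sigma_algebra; have [l lq] : exists l, @unpickle ('I_n * rat)%type l = Some (i, q).
    by exists (pickle (i, q)); exact: pickleK.
  by exists l; [exact: I|rewrite /rat_halfspace lq].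
apply; move: mB.
by rewrite -[<<s _ >>]/((RGenInftyO.G (R:=R)).-sigma.-measurable) -RGenInftyO.measurableE.
Qed.

End rV_generators.

(** * Lower bound for the kernel *)

Section calculus.
Variable R : realType.

Lemma is_derive_ge0_le (f f' : R -> R) (a b : R) : a <= b ->
  (forall s, a <= s <= b -> is_derive s 1 f (f' s)) ->
  (forall s, a <= s <= b -> 0 <= f' s) -> f a <= f b.
Proof.
move=> ab df f0.
have sub s : s \in `]a, b[ -> a <= s <= b.
  by rewrite in_itv/= => /andP[/ltW -> /ltW ->].
apply: (@ger0_derive1_ndecr _ f a b) => //.
- by move=> s /sub sab; have [] := df _ sab.
- by move=> s /sub sab; rewrite derive1E; have [_ ->] := df _ sab; exact: f0.
- apply: derivable_within_continuous => s; rewrite in_itv/= => sab.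
  by have [] := df _ sab.
Qed.

(** Both [g + f] and [g - f] are nondecreasing. *)
Lemma is_derive_ler_norm (f f' g g' : R -> R) (a b : R) : a <= b ->
  (forall s, a <= s <= b -> is_derive s 1 f (f' s)) ->
  (forall s, a <= s <= b -> is_derive s 1 g (g' s)) ->
  (forall s, a <= s <= b -> `|f' s| <= g' s) -> `|f b - f a| <= g b - g a.
Proof.
move=> ab df dg fg; rewrite ler_norml; apply/andP; split.
  rewrite opprB -subr_ge0.
  rewrite (_ : _ - _ = (f \+ g) b - (f \+ g) a); last by rewrite /=; ring.
  rewrite subr_ge0; apply: (@is_derive_ge0_le _ (f' \+ g')) => //= s sab.
    by have := df _ sab; have := dg _ sab => ? ?; exact: is_deriveD.
  by have := fg _ sab; rewrite ler_norml => /andP[h _]; lra.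
rewrite -subr_ge0 (_ : _ - _ = (g \- f) b - (g \- f) a); last by rewrite /=; ring.
rewrite subr_ge0; apply: (@is_derive_ge0_le _ (g' \- f')) => //= s sab.
  by have := df _ sab; have := dg _ sab => ? ?; exact: is_deriveB.
by have := fg _ sab; rewrite ler_norml subr_ge0 => /andP[].
Qed.

Lemma is_derive_quadratic (k0 k1 k2 s : R) :
  is_derive s 1 (fun s => k2 * s ^+ 2 + k1 * s + k0) (2 * k2 * s + k1).
Proof.
have hid : is_derive s 1 (id : R -> R) 1 by exact: is_derive_id.
have h1 := is_deriveZ k1 hid.
have h2 := is_deriveZ k2 (is_deriveX 2 hid).
have h := is_deriveD (is_deriveD h2 h1) (is_derive_cst k0 s 1).
apply: is_derive_eq h _.
by rewrite addr0 /GRing.scale/= expr1 mulr1 mulr2n; ring.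
Qed.

Lemma is_derive_line n (f : 'rV[R]_n -> R) (x v : 'rV[R]_n) (s : R) :
  differentiable f (x + s *: v) ->
  is_derive s 1 (fun r : R => f (x + r *: v)) ('D_v f (x + s *: v)).
Proof.
move=> df; have dv := @diff_derivable _ _ _ _ _ v df.
have E : (fun h : R => h^-1 *: ((fun r : R => f (x + r *: v)) (h *: (1:R) + s)
            - f (x + s *: v))) =
         (fun h : R => h^-1 *: ((f \o shift (x + s *: v)) (h *: v) - f (x + s *: v))).
  apply/funext => h /=; congr (_ *: (f _ - _)).
  by rewrite [h *: 1]mulr1 scalerDl addrCA addrA addrC.
split; first by rewrite /derivable; move: dv; rewrite /derivable -E.
by rewrite /derive -E.
Qed.

Lemma derive_grad n (f : 'rV[R]_n -> R) (x v : 'rV[R]_n) :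
  differentiable f x -> 'D_v f x = \sum_i grad f x ord0 i * v ord0 i.
Proof.
move=> df; rewrite deriveE// [in LHS](row_sum_delta v) linear_sum.
apply: eq_bigr => i _; rewrite linearZ /= mulrC; congr (_ * _).
by rewrite /grad mxE /partial deriveE.
Qed.

Lemma ler_derive_grad n (f : 'rV[R]_n -> R) (x v : 'rV[R]_n) :
  differentiable f x -> `|'D_v f x| <= enorm (grad f x) * enorm v.
Proof.
move=> df; rewrite ler_norml; apply/andP; split; last first.
  by rewrite derive_grad//; exact: cauchy_schwarz.
rewrite lerNl -[enorm v]enormN derive_grad// -sumrN.
under eq_bigr do rewrite -mulrN.
apply: le_trans (cauchy_schwarz _ _); rewrite le_eqVlt; apply/orP; left.
by apply/eqP; apply: eq_bigr => i _; rewrite [X in _ = _ * X]mxE.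
Qed.

Lemma grad_lipschitz n (f : 'rV[R]_n -> R) (L : R) :
  (forall x, differentiable f x) -> (forall x, enorm (grad f x) <= L) ->
  forall x y, `|f x - f y| <= L * enorm (x - y).
Proof.
move=> df fL x y; pose v := x - y.
have yv : y + v = x by rewrite addrC subrK.
have := @is_derive_ler_norm (fun s => f (y + s *: v)) (fun s => 'D_v f (y + s *: v))
  (fun s => L * enorm v * s) (fun s => L * enorm v) 0 1 ler01.
rewrite scale1r scale0r addr0 mulr1 mulr0 subr0 yv; apply.
- by move=> s _; exact: is_derive_line.
- move=> s _; have := is_derive_quadratic 0 (L * enorm v) 0 s.
  rewrite mulr0 mul0r add0r; under eq_fun do rewrite mul0r add0r addr0; exact.
- move=> s _; apply: le_trans (ler_derive_grad _ _) _ => //.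
  by rewrite ler_wpM2r// enorm_ge0.
Qed.

(* The comparison function decays like a Gaussian, but its derivative dominates
   that of a Gaussian of twice the rate as soon as the ray moves away. *)
Lemma gaussian_line_variation (g g' : R -> R) (N0 tau al B sig : R) :
  0 < al -> 0 <= B -> 0 <= tau -> tau ^+ 2 <= N0 -> 0 <= sig ->
  let N s := N0 + 2 * s * tau + s ^+ 2 in
  let P s := B * Num.sqrt al * expR 1 * expR (- (N s / (4 * al)) - (tau + s) / Num.sqrt al) in
  (forall s, 0 <= s <= sig -> is_derive s 1 g (g' s)) ->
  (forall s, 0 <= s <= sig -> `|g' s| <= B * expR (- (N s / (2 * al)))) ->
  `|g sig - g 0| <= P 0 - P sig.
Proof.
move=> al0 B0 tau0 tN sig0 N P dg bg.
have ra0 : 0 < Num.sqrt al by rewrite sqrtr_gt0.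
rewrite (_ : P 0 - P sig = (- P sig) - (- P 0)); last by ring.
pose q s := - (N s / (4 * al)) - (tau + s) / Num.sqrt al.
pose q' s := - ((2 * tau + 2 * s) / (4 * al)) - (Num.sqrt al)^-1.
have dq (s : R) : is_derive s 1 q (q' s).
  have := is_derive_quadratic (- (N0 / (4 * al)) - tau / Num.sqrt al)
    (- (2 * tau / (4 * al)) - (Num.sqrt al)^-1) (- (4 * al)^-1) s.
  rewrite (_ : (fun s => _) = q); last first.
    by apply/funext => r; rewrite /q /N; field; rewrite !gt_eqF.
  by move=> h; apply: is_derive_eq h _; rewrite /q'; field; rewrite !gt_eqF.
pose K := B * Num.sqrt al * expR 1.
have K0 : 0 <= K by rewrite !mulr_ge0 ?expR_ge0 ?sqrtr_ge0.
have dP (s : R) : is_derive s 1 (fun s => - P s) (- (K * (q' s * expR (q s)))).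
  have h := is_derive1_comp (is_derive_expR (q s)) (dq s).
  apply: is_derive_eq (is_deriveN (is_deriveZ K h)) _.
  by rewrite /GRing.scale/=; ring.
apply: (is_derive_ler_norm sig0 dg (fun s _ => dP s)) => s /andP[s0 ss].
apply: le_trans (bg s _) _; first by rewrite s0.
have ts0 : 0 <= tau + s by rewrite addr_ge0.
rewrite (_ : - (K * _) = B * (expR 1 * expR (q s) * (Num.sqrt al * - q' s))); last first.
  by rewrite /K; ring.
rewrite ler_wpM2l//.
(* Completing the square, with [N s = (tau + s)^2 + (N0 - tau^2)]; the factor [expR 1] in [P]
   supplies the constant term of the square. *)
have h1 : expR (- (N s / (2 * al))) <= expR 1 * expR (q s).
  rewrite -expRD ler_expR /q -subr_ge0.
  have sal : al = Num.sqrt al ^+ 2 by rewrite sqr_sqrtr// ltW.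
  apply: (@le_trans _ _ ((tau + s - 2 * Num.sqrt al) ^+ 2 / (4 * al) + (N0 - tau ^+ 2) / (4 * al))).
    by rewrite addr_ge0// divr_ge0 ?sqr_ge0 ?subr_ge0// mulr_ge0// ltW.
  rewrite le_eqVlt; apply/orP; left; apply/eqP; rewrite /N.
  move: (Num.sqrt al) ra0 sal => r r0 ->.
  by field; rewrite gt_eqF.
(* The linear term of the exponent contributes exactly 1; the quadratic one has the right sign
   because the ray moves away. *)
have h2 : 1 <= Num.sqrt al * - q' s.
  rewrite /q' opprB opprK mulrDr mulfV ?gt_eqF// lerDl.
  rewrite mulr_ge0 ?(ltW ra0)//.
  have a4 : 0 <= 4 * al by rewrite mulr_ge0// ltW.
  by apply: divr_ge0 => //; lra.
apply: le_trans h1 _.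
by rewrite ler_peMr// mulr_ge0// expR_ge0.
Qed.

End calculus.

(** * Sets that are stable under motion along a half-line inside [O] *)

Section shifts.
Variables (R : realType) (n : nat).
Implicit Types (O T : set 'rV[R]_n.+1) (e x : 'rV[R]_n.+1).

Definition in_seg O e (h : R) : set 'rV[R]_n.+1 :=
  [set x | forall s, 0 <= s <= h -> O (x + s *: e)].

(** Tube lemma: [[0, h]] is compact, so one neighbourhood of [x] serves for all [s]. *)
Lemma open_in_seg O e h : open O -> open (in_seg O e h).
Proof.
move=> oO; rewrite openE => x xh.
have /compact_near_coveringP K := @segment_compact R 0 h.
have := K _ (nbhs x) (fun y s => O (y + s *: e)) (nbhs_filter x) _.
have H (s : R) : `[0, h]%classic s ->
    \forall s' \near s & y \near x, O (y + s' *: e).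
  rewrite /= in_itv/= => sh.
  have c : (p.2 + p.1 *: e : 'rV[R]_n.+1) @[p --> (s, x)] --> x + s *: e.
    apply: cvgD; first exact: cvg_snd.
    by apply: cvgZr_tmp; exact: cvg_fst.
  exact: (c _ (oO _ (xh _ sh))).
move=> /(_ H); apply: (@filterS _ (nbhs x) (nbhs_filter x)) => y yh s sh.
by apply: yh; rewrite /= in_itv.
Qed.

Local Notation mu := (lebesgue_rV R n.+1).

Lemma measurable_in_seg O e h : open O -> measurable (in_seg O e h).
Proof. by move=> oO; apply: open_measurable_rV; exact: open_in_seg. Qed.

Lemma le_lebesgue_rV_shift (A B : set 'rV[R]_n.+1) (a : R) :
  measurable A -> measurable B ->
  (forall x, A x -> B (x + a *: delta_mx ord0 ord0)) -> (mu A <= mu B)%E.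
Proof.
move=> mA mB AB; rewrite -[leRHS](lebesgue_rV_shift a mB).
apply: le_measure; rewrite ?inE//.
by rewrite -[X in measurable X]setTI; exact: measurable_rV_shift.
Qed.

(* Translating [T] along [e] shows that the part of [T] that leaves [O] within
   time [N * h] is at most [N] times larger than the part that leaves [O] within
   time [h]; the quadratic bound then forces it to vanish.  What remains is
   invariant under all the translations and of finite measure. *)
Lemma shift_stable_null O T (sg D q : R) :
  let e : 'rV[R]_n.+1 := sg *: delta_mx ord0 ord0 in
  open O -> measurable T -> T `<=` O -> sg ^+ 2 = 1 -> 0 <= D ->
  (forall x s, 0 <= s -> T x -> in_seg O e s x -> T (x + s *: e)) ->
  (forall h, 0 < h -> (mu (T `\` in_seg O e h) <= (D * h ^+ 2)%:E)%E) ->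
  (mu T < +oo)%E -> (forall x, T x -> q <= sg * x ord0 ord0) ->
  mu T = 0%E.
Proof.
move=> e oO mT TO sg1 D0 stab exitD Tfin Tq.
have mS h : measurable (in_seg O e h) by exact: measurable_in_seg.
have mE h : measurable (T `\` in_seg O e h) by exact: measurableD.
have eE x s : x + s *: e = x + (s * sg) *: delta_mx ord0 ord0 by rewrite scalerA.
have exitS h (j : nat) : 0 < h -> (mu (T `\` in_seg O e (j.+1%:R * h)) <=
    mu (T `\` in_seg O e (j%:R * h)) + mu (T `\` in_seg O e h))%E.
  move=> h0; pose A := (T `&` in_seg O e (j%:R * h)) `\` in_seg O e (j.+1%:R * h).
  have mA : measurable A by apply: measurableD => //; exact: measurableI.
  have jh0 : 0 <= j%:R * h by rewrite mulr_ge0// ltW.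
  have : (mu A <= mu (T `\` in_seg O e h))%E.
    apply: (@le_lebesgue_rV_shift _ _ (j%:R * h * sg)) => // x [[Tx jx] Nx].
    rewrite -eE; split; first exact: stab.
    move=> hx; apply: Nx => s /andP[s0 sj].
    have [sjh|sjh] := leP s (j%:R * h); first by apply: jx; rewrite s0.
    have := hx (s - j%:R * h); rewrite -addrA -scalerDl subrKC; apply.
    move: sj; rewrite -natr1 mulrDl mul1r => sj.
    by rewrite subr_ge0 ltW//= lerBlDl.
  move=> Ale; apply: (@le_trans _ _ (mu (T `\` in_seg O e (j%:R * h)) + mu A)%E).
    apply: le_trans (measureU2 _ _ _) => //; apply: le_measure; rewrite ?inE//.
      exact: measurableU.
    move=> x [Tx Nx]; have [jx|jx] := pselect (in_seg O e (j%:R * h) x); last by left.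
    by right.
  by rewrite leeD2l.
have exitN h (j : nat) : 0 < h -> (mu (T `\` in_seg O e (j%:R * h)) <=
    (j%:R * (D * h ^+ 2))%:E)%E.
  move=> h0; elim: j => [|j IH].
    rewrite mul0r mul0r (_ : _ `\` _ = set0) ?measure0// -subset0 => x [Tx].
    apply; move=> s /andP[s0]; rewrite le_eqVlt ltNge s0 orbF => /eqP ->.
    by rewrite scale0r addr0; exact: TO.
  apply: le_trans (exitS _ _ h0) _.
  by rewrite -natr1 mulrDl mul1r EFinD leeD// exitD.
have exit0 B : 0 < B -> mu (T `\` in_seg O e B) = 0%E.
  move=> B0; apply/eqP; rewrite eq_le measure_ge0 andbT.
  apply/lee_addgt0Pr => eps eps0; rewrite add0e.
  (* With steps of length [B / N] the bound is [N * D * (B / N)^2 = D * B^2 / N], at most [eps] for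
     this [N]. *)
  pose N := (Num.truncn (D * B ^+ 2 / eps)).+1.
  have N0 : (0 : R) < N%:R by rewrite ltr0n.
  have := exitN (B / N%:R) N (divr_gt0 B0 N0).
  rewrite mulrC divfK ?gt_eqF// => /le_trans; apply; rewrite lee_fin.
  rewrite (_ : _ * _ = D * B ^+ 2 / N%:R); last by field; rewrite gt_eqF.
  rewrite ler_pdivrMr// [eps * _]mulrC -ler_pdivrMr// ltW//.
  exact: truncnS_gt.
pose Ti := T `&` \bigcap_k in_seg O e k%:R.
have mTi : measurable Ti by apply: measurableI => //; exact: bigcapT_measurable.
have TiS x s : 0 <= s -> Ti x -> Ti (x + s *: e).
  move=> s0 [Tx xi].
  have xi' r : in_seg O e r x.
    move=> r' /andP[r'0 r'r]; apply: (xi (Num.truncn r').+1 I).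
    by rewrite r'0 ltW// truncnS_gt.
  split; first by apply: stab.
  by move=> k _ r /andP[r0 _]; rewrite -addrA -scalerDl; apply: (xi' (s + r)); rewrite addr_ge0/=.
have muT : (mu T <= mu Ti)%E.
  apply: (@le_trans _ _ (mu (Ti `|` \bigcup_k (T `\` in_seg O e k.+1%:R)))).
    apply: le_measure; rewrite ?inE//.
      by apply: measurableU => //; exact: bigcupT_measurable.
    move=> x Tx; have [xi|/existsNP[k /not_implyP[_ nk]]] :=
      pselect ((\bigcap_k in_seg O e k%:R) x); first by left.
    right; exists k => //; split => // kx; apply: nk => s /andP[s0 sk].
    by apply: kx; rewrite s0 (le_trans sk)// ler_nat.
  apply: le_trans (measureU2 _ _ _) _ => //; first exact: bigcupT_measurable.
  rewrite [X in (_ + X)%E](_ : _ = 0%E) ?adde0//.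
  apply/eqP; rewrite eq_le measure_ge0 andbT.
  have := @measure_sigma_subadditive _ _ _ mu _ (fun k => T `\` in_seg O e k.+1%:R)
    (fun k => mE _) (bigcupT_measurable _ (fun k => mE _)) (@subset_refl _ _).
  move=> /le_trans; apply; rewrite eseries0// => k _ _ /=; apply: exit0.
  by rewrite ltr0n.
have Tifin : (mu Ti < +oo)%E.
  by apply: le_lt_trans Tfin; apply: le_measure; rewrite ?inE// => x [].
(* Translation by [N] carries [Ti] into [F N] without loss of measure, whereas [F N] decreases to
   the empty set inside a set of finite measure. *)
pose F N := Ti `&` [set x | q + N%:R <= sg * x ord0 ord0].
have mcoord (r : R) : measurable [set x : 'rV[R]_n.+1 | r <= sg * x ord0 ord0].
  have mc : measurable_fun setT (fun x : 'rV[R]_n.+1 => sg * x ord0 ord0).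
    by apply: measurable_funM => //; exact: measurable_rV_coord.
  have := mc measurableT `[r, +oo[%classic (measurable_itv _).
  congr measurable; apply/seteqP; split => x /=; rewrite in_itv/= andbT//.
  by case.
have mF N : measurable (F N) by apply: measurableI => //; exact: mcoord.
have F0 : mu (F N) @[N --> \oo] --> 0%E.
  have -> : (0 = mu (\bigcap_N F N))%E.
    rewrite (_ : \bigcap_N F N = set0) ?measure0// -subset0 => x xF.
    have := (xF (Num.truncn (sg * x ord0 ord0 - q)).+1 I).2; apply/negP.
    by rewrite -ltNge -ltrBlDl truncnS_gt.
  apply: nonincreasing_cvg_mu => //.
  - by apply: le_lt_trans Tifin; apply: le_measure; rewrite ?inE// => x [].
  - exact: bigcapT_measurable.
  - move=> i j ij; apply/subsetPset => x [Tix jx]; split => //.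
    by apply: le_trans jx; rewrite lerD2l ler_nat.
apply/eqP; rewrite eq_le measure_ge0 andbT.
apply: (cvge_ge _ F0); apply: nearW => N; apply: le_trans muT _.
apply: (@le_lebesgue_rV_shift _ _ (N%:R * sg)) => // x Tix.
rewrite -eE; split; first exact: TiS.
rewrite /= !mxE eqxx mulr1 mulrDr mulrCA -expr2 sg1 mulr1.
by rewrite lerD2r; apply: Tq; exact: Tix.1.
Qed.

End shifts.

(** * Quadratic smallness of H^1_0 functions on the points about to leave [O] *)

Section exit_estimate.
Variable R : realType.

Lemma lebesgue_measure_itv0 (h : R) : 0 <= h ->
  lebesgue_measure (`[0%R, h]%classic : set R) = h%:E.
Proof.
move=> h0; rewrite lebesgue_measure_itv/= lte_fin.
case: ifPn => [_|]; first by rewrite -EFinB subr0.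
by rewrite -leNgt => h0'; congr EFin; apply/eqP; rewrite eq_le h0 h0'.
Qed.

Lemma integral_indic_itv0 (h : R) : 0 <= h ->
  (\int[lebesgue_measure]_s (\1_`[0%R, h]%classic s)%:E = h%:E)%E.
Proof.
move=> h0; rewrite integral_indic//.
exact: (etrans (congr1 lebesgue_measure (setIT _)) (lebesgue_measure_itv0 h0)).
Qed.

(** As [F] vanishes at [sig], [|F 0|] is at most the integral of [|F'|] over [[0, sig]], hence over
    [[0, h]]; Cauchy-Schwarz gives the factor [h]. The right-hand side is free of [sig], which will
    vary with the starting point of the line. *)
Lemma sqr_le_integral_derive (F F' : R -> R) (h sig : R) :
  0 <= sig <= h -> (forall s : R, is_derive s 1 F (F' s)) -> continuous F' ->
  F sig = 0 ->
  (((F 0) ^+ 2)%:E <=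
   h%:E * \int[lebesgue_measure]_s (\1_`[0%R, h]%classic s * F' s ^+ 2)%:E)%E.
Proof.
move=> /andP[s0 sh] dF cF' Fs.
have h0 : 0 <= h by exact: le_trans sh.
have mF' : measurable_fun setT F' by exact: continuous_measurable_fun.
have m1 : measurable_fun setT (\1_`[0%R, h]%classic : R -> R).
  by apply: measurable_indic; exact: measurable_itv.
have cF : continuous F.
  by move=> s; apply: differentiable_continuous; apply/derivable1_diffP; have [] := dF s.
have I1 : (`|F 0|%:E <= \int[lebesgue_measure]_s (\1_`[0%R, h]%classic s * `|F' s|)%:E)%E.
  (* The fundamental theorem of calculus asks for a nondegenerate interval; for [sig = 0] the left
     side is 0. *)
  move: s0; rewrite le_eqVlt => /predU1P[s0|s0].
    rewrite s0 Fs normr0; apply: integral_ge0 => s _.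
    by rewrite lee_fin mulr_ge0.
  have dF0 : derivable_oo_LRcontinuous F 0 sig.
    split; first by move=> s _; have [] := dF s.
      by apply: cvg_at_right_filter; exact: cF.
    by apply: cvg_at_left_filter; exact: cF.
  have dF1 : {in `]0, sig[, F^`()%classic =1 F'}.
    by move=> s _; rewrite derive1E; have [_ ->] := dF s.
  have := continuous_FTC2 s0 (continuous_subspaceT cF') dF0 dF1.
  rewrite Fs sub0e => I; rewrite -normrN -abse_EFin EFinN -I.
  apply: le_trans (le_abse_integral _ _ _) _.
  - exact: measurable_itv.
  - by apply/measurable_EFinP; exact: measurable_funTS.
  rewrite integral_mkcond; apply: ge0_le_integral => //.
  - by move=> s _; rewrite /patch; case: ifP.
  - apply: (iffLR (measurable_restrictT _ (measurable_itv `[0%R, sig]))).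
    by apply: measurableT_comp => //; apply/measurable_EFinP; exact: measurable_funTS.
  - by apply/measurable_EFinP/measurable_funM => //; exact: measurableT_comp.
  - move=> s _; rewrite /patch; case: ifPn => [|_].
      rewrite inE/= in_itv/= => /andP[h1 h2].
      by rewrite indicE mem_set ?mul1r//= in_itv/= h1 (le_trans h2).
    by rewrite lee_fin mulr_ge0.
have mn : measurable_fun setT (fun s => `|F' s|) by exact: measurableT_comp.
have i0 s : 0 <= (\1_`[0%R, h]%classic : R -> R) s by rewrite indicE ler0n.
have n0 s : 0 <= `|F' s| by exact: normr_ge0.
(* Cauchy-Schwarz, as the case [p = 2] with the indicator of [[0, h]] as a density of mass [h]. *)
have := @integral_mul_powR_le _ _ R lebesgue_measure _ _ 2 h m1 mn i0 n0 (ler1n _ 2).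
rewrite integral_indic_itv0// => /(_ (lexx _)); rewrite (_ : 2 - 1 = 1 :> R) ?powRr1//; last by lra.
under [X in (_ <= _ * X)%E -> _]eq_integral => s _.
  rewrite powR_mulrn// real_normK ?num_real//; over.
apply: le_trans.
have := le_poweR (ler0n _ 2) _ I1.
rewrite poweR_EFin powR_mulrn// real_normK ?num_real//; apply.
by rewrite lee_fin.
Qed.

Local Notation e0 := (delta_mx ord0 ord0).

Lemma measurable_line n (e : 'rV[R]_n) :
  measurable_fun setT (fun z : 'rV[R]_n * R => z.1 + z.2 *: e).
Proof.
apply: measurable_fun_rVP => i; under eq_fun do rewrite !mxE.
apply: measurable_funD.
  by apply: (measurableT_comp (measurable_rV_coord i)); exact: measurable_fst.
by apply: measurable_funM => //; exact: measurable_snd.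
Qed.

(** The compact [K] is closed, so [f] vanishes near every point outside [O]. The derivative can thus
    be integrated over the whole space, where translations preserve the integral. *)
Lemma test_function_partial0 n (O : set 'rV[R]_n.+1) (f : 'rV[R]_n.+1 -> R) x :
  test_function O f -> ~ O x -> partial ord0 f x = 0.
Proof.
move=> [_ [K [cK KO K0]]] Ox; rewrite /partial.
have -> : 'D_e0 f x = 'D_e0 (cst 0 : 'rV[R]_n.+1 -> R) x; last exact: derive_cst.
apply: near_eq_derive.
have : open (~` K) by apply: closed_openC; apply: compact_closed cK; exact: norm_hausdorff.
rewrite openE => /(_ x) /(_ _) H.
apply: (@filterS _ (nbhs x) (nbhs_filter x)) (H _) => [y|Kx].
  by move=> /K0.
by apply: Ox; exact: KO.
Qed.

Lemma ge0_integral_rV_line n (sg s : R) (f : 'rV[R]_n.+1 -> \bar R) :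
  measurable_fun setT f -> (forall x, 0 <= f x)%E ->
  (\int[lebesgue_rV R n.+1]_x f (x + s *: (sg *: e0))%R =
   \int[lebesgue_rV R n.+1]_x f x)%E.
Proof.
move=> mf f0; rewrite -[RHS](ge0_integral_rV_shift (s * sg))//.
by apply: eq_integral => x _; rewrite scalerA.
Qed.

(** A segment that leaves [O] meets a zero of [f], so the one-dimensional inequality applies at its
    starting point. One factor [h] comes from Cauchy-Schwarz, the other from integrating over [s] in
    [[0, h]] after Tonelli, each integral over [x] being translation invariant. *)
Lemma test_function_exit n (O : set 'rV[R]_n.+1) (f : 'rV[R]_n.+1 -> R)
    (sg h : R) : open O -> test_function O f -> sg ^+ 2 = 1 -> 0 < h ->
  (\int[lebesgue_rV R n.+1]_(x in O `\` in_seg O (sg *: e0) h) (f x ^+ 2)%:E <=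
   (h ^+ 2)%:E * \int[lebesgue_rV R n.+1]_(x in O) (partial ord0 f x ^+ 2)%:E)%E.
Proof.
move=> oO tf sg1 h0; have [Cf [K [cK KO K0]]] := tf.
have [df /(_ ord0) cpf] : (forall x, differentiable f x) /\
    (forall i, continuous (partial i f)) by exact: (Cf 1%N).
set e : 'rV[R]_n.+1 := sg *: e0.
have mO : measurable O by exact: open_measurable_rV.
have mf : measurable_fun setT f.
  by apply: continuous_measurable_rV => x; exact: differentiable_continuous.
have mpf : measurable_fun setT (partial ord0 f) by exact: continuous_measurable_rV.
have mA : measurable (O `\` in_seg O e h).
  by apply: measurableD => //; exact: measurable_in_seg.
have sq0 x : (0 <= (partial ord0 f x ^+ 2)%:E)%E by rewrite lee_fin sqr_ge0.
have msq : measurable_fun setT (fun x => (partial ord0 f x ^+ 2)%:E).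
  by apply/measurable_EFinP; exact: measurable_funX.
pose J (z : 'rV[R]_n.+1 * R) : \bar R :=
  (\1_`[0%R, h]%classic z.2 * partial ord0 f (z.1 + z.2 *: e) ^+ 2)%:E.
have J0 z : (0 <= J z)%E by rewrite lee_fin mulr_ge0 ?sqr_ge0// indicE ler0n.
have mJ : measurable_fun setT J.
  apply/measurable_EFinP; apply: measurable_funM.
    apply: (measurableT_comp (f := (\1_`[0%R, h]%classic : R -> R))); last exact: measurable_snd.
    by apply: measurable_indic; exact: measurable_itv.
  by apply: measurable_funX; apply: (measurableT_comp mpf); exact: measurable_line.
have De y : 'D_e f y = sg * partial ord0 f y.
  by rewrite /partial !deriveE// linearZ.
have pw x : (O `\` in_seg O e h) x ->
    ((f x ^+ 2)%:E <= h%:E * \int[lebesgue_measure]_s J (x, s))%E.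
  move=> [Ox /existsNP[s /not_implyP[/andP[s0 sh] Os]]].
  have := @sqr_le_integral_derive (fun s => f (x + s *: e)) (fun s => 'D_e f (x + s *: e)) h s.
  rewrite s0 sh scale0r addr0 => /(_ isT (fun s => is_derive_line (df _))).
  have -> : (fun s : R => 'D_e f (x + s *: e)) =
      (fun s : R => sg * partial ord0 f (x + s *: e)) by apply/funext => r; rewrite De.
  rewrite K0; last by move=> /KO.
  have cD : continuous (fun r : R => sg * partial ord0 f (x + r *: e)).
    move=> r; apply: cvgM; first exact: cvg_cst.
    apply: (@continuous_comp _ _ _ (fun r : R => x + r *: e)); last exact: cpf.
    apply: cvgD; first exact: cvg_cst.
    by apply: cvgZr_tmp; exact: cvg_id.
  have -> : (\int[lebesgue_measure]_r J (x, r) = \int[lebesgue_measure]_r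
      (\1_`[0%R, h]%classic r * 'D_e f (x + r *: e) ^+ 2)%:E)%E.
    by apply: eq_integral => r _; rewrite /J/= De exprMn sg1 mul1r.
  by move=> H; exact: (H cD erefl).
have pf0 x : O x \/ partial ord0 f x = 0.
  by have [|/(test_function_partial0 tf)] := pselect (O x); [left|right].
rewrite [in leRHS]integral_mkcond.
rewrite (_ : ((fun x => (partial ord0 f x ^+ 2)%:E) \_ O) = (fun x => (partial ord0 f x ^+ 2)%:E)); last first.
  apply/funext => x; rewrite /patch; case: ifPn => //; rewrite notin_setE => Ox.
  by case: (pf0 x) => // ->; rewrite expr0n.
apply: (@le_trans _ _ (\int[lebesgue_rV R n.+1]_x (h%:E * \int[lebesgue_measure]_s J (x, s)))%E).
  rewrite integral_mkcond; apply: ge0_le_integral => //.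
  - by move=> x _; rewrite /patch; case: ifP => // _; rewrite lee_fin sqr_ge0.
  - apply: (iffLR (measurable_restrictT _ mA)); apply/measurable_EFinP.
    by apply: measurable_funX; exact: measurable_funTS.
  - apply: emeasurable_funM => //.
    exact: (measurable_fun_fubini_tonelli_F (m2 := lebesgue_measure) J).
  - move=> x _; rewrite /patch; case: ifPn => [/set_mem|_]; first exact: pw.
    by apply: mule_ge0; [rewrite lee_fin ltW|exact: integral_ge0].
have mI : measurable_fun setT (fun x => \int[lebesgue_measure]_s J (x, s))%E.
  exact: (measurable_fun_fubini_tonelli_F (m2 := lebesgue_measure) J).
have I0 x : setT x -> (0 <= \int[lebesgue_measure]_s J (x, s))%E.
  by move=> _; exact: integral_ge0.
have hE0 : (0 <= h%:E)%E by rewrite lee_fin ltW.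
have IZ := ge0_integralZl (lebesgue_rV R n.+1) measurableT mI I0 hE0.
rewrite [leLHS]IZ.
rewrite expr2 EFinM -muleA lee_pmul2l//.
rewrite (fubini_tonelli (m1 := lebesgue_rV R n.+1) (m2 := lebesgue_measure) J)//.
rewrite (_ : (h%:E = \int[lebesgue_measure]_s (\1_`[0%R, h]%classic s)%:E)%E); last first.
  by rewrite integral_indic_itv0// ltW.
rewrite -ge0_integralZr//; last 2 first.
- by apply/measurable_EFinP; apply: measurable_indic; exact: measurable_itv.
- by apply: integral_ge0.
apply: ge0_le_integral => //.
- by move=> s _; exact: integral_ge0.
- exact: (measurable_fun_fubini_tonelli_G (m1 := lebesgue_rV R n.+1) J).
- apply: emeasurable_funM => //.
  by apply/measurable_EFinP; apply: measurable_indic; exact: measurable_itv.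
move=> s _; rewrite /J/=; under eq_integral do rewrite EFinM.
have mq := measurableT_comp msq (measurable_rV_shift (s *: e)).
have i0 : (0 <= (\1_`[0%R, h]%classic s : R)%:E)%E by rewrite lee_fin indicE ler0n.
have IZs := ge0_integralZl (lebesgue_rV R n.+1) measurableT mq (fun x _ => sq0 _) i0.
rewrite [leLHS]IZs.
by rewrite (ge0_integral_rV_line sg s (f := fun x => (partial ord0 f x ^+ 2)%:E)).
Qed.

End exit_estimate.

Section H10_exit.
Variables (R : realType) (n : nat).
Local Notation mu := (lebesgue_rV R n.+1).
Local Notation e0 := (delta_mx ord0 ord0).

Lemma L2_normE d O (f : 'rV[R]_d -> R) : Lp_norm O (fun=> 1) 2 f =
  ((\int[lebesgue_rV R d]_(x in O) (f x ^+ 2)%:E) `^ 2^-1)%E.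
Proof.
rewrite /Lp_norm; congr (_ `^ _)%E; apply: eq_integral => x _.
by rewrite mulr1 powR_mulrn// real_normK ?num_real.
Qed.

Lemma L2_sqr d O (f : 'rV[R]_d -> R) :
  ((Lp_norm O (fun=> 1%R) 2%R f) `^ 2 =
  \int[lebesgue_rV R d]_(x in O) (f x ^+ 2)%:E)%E.
Proof.
rewrite L2_normE -poweRrM mulVf// poweRe1//.
by apply: integral_ge0 => x _; rewrite lee_fin sqr_ge0.
Qed.

Lemma L2_norm_cvg0 d O (f_ : nat -> 'rV[R]_d -> R) (eps : R) : 0 < eps ->
  Lp_norm O (fun=> 1) 2 (f_ k) @[k --> \oo] --> 0%E ->
  \forall k \near \oo, (\int[lebesgue_rV R d]_(x in O) (f_ k x ^+ 2)%:E <= eps%:E)%E.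
Proof.
move=> e0 f0; have s0 : (0 < (Num.sqrt eps)%:E)%E by rewrite lte_fin sqrtr_gt0.
have : \forall k \near \oo, (Lp_norm O (fun=> 1%R) 2%R (f_ k) < (Num.sqrt eps)%:E)%E.
  exact: (f0 _ (open_ereal_lt' s0)).
apply: filterS => k /ltW fk.
have -> : eps = Num.sqrt eps `^ 2.
  by rewrite powR_mulrn ?sqrtr_ge0// sqr_sqrtr// ltW.
rewrite -L2_sqr -poweR_EFin; apply: le_poweR fk => //; exact: poweR_ge0.
Qed.

Lemma integral_sqr_triangle d (T : measurableType d)
    (nu : {measure set T -> \bar R}) (A : set T) (f g : T -> R) :
  measurable A -> measurable_fun A f -> measurable_fun A g ->
  (\int[nu]_(x in A) (f x ^+ 2)%:E <=
   2%:E * \int[nu]_(x in A) ((g x - f x) ^+ 2)%:E +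
   2%:E * \int[nu]_(x in A) (g x ^+ 2)%:E)%E.
Proof.
move=> mA mf mg.
have sq0 (h : T -> R) x : A x -> (0 <= (h x ^+ 2)%:E)%E by rewrite lee_fin sqr_ge0.
have msq (h : T -> R) : measurable_fun A h -> measurable_fun A (fun x => (h x ^+ 2)%:E).
  by move=> mh; apply/measurable_EFinP; exact: measurable_funX.
have mgf := msq _ (measurable_funB mg mf).
have E (h : T -> R) : measurable_fun A h -> (2%:E * \int[nu]_(x in A) (h x ^+ 2)%:E =
    \int[nu]_(x in A) (2%:E * (h x ^+ 2)%:E))%E.
  by move=> mh; rewrite ge0_integralZl//; [exact: msq|exact: sq0].
have /= E' := E (fun x => g x - f x) (measurable_funB mg mf).
rewrite E' E//.
have pos (h : T -> R) x : A x -> (0 <= 2%:E * (h x ^+ 2)%:E)%E.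
  by move=> Ax; rewrite mule_ge0// sq0.
have mE (h : T -> R) : measurable_fun A h -> measurable_fun A (fun x => (2%:E * (h x ^+ 2)%:E)%E).
  by move=> mh; apply: emeasurable_funM => //; exact: msq.
have mEgf := mE _ (measurable_funB mg mf).
rewrite -ge0_integralD//; [|exact: (pos (fun x => g x - f x))|exact: pos|exact: mE].
apply: ge0_le_integral => //.
- exact: sq0.
- exact: msq.
- by apply: emeasurable_funD => //; exact: mE.
move=> x _; rewrite -!EFinM -EFinD lee_fin -subr_ge0.
rewrite (_ : _ - _ = (2 * g x - f x) ^+ 2) ?sqr_ge0//; ring.
Qed.

(** The constant is uniform in [h] although the approximating test function is chosen after [h]:
    squared L^2 error at most [h^2] for the function and at most 1 for its derivative. *)
Lemma H10_exit (O : set 'rV[R]_n.+1) u v : open O -> H10 O u v ->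
  exists2 D : R, 0 <= D & forall sg h, sg ^+ 2 = 1 -> 0 < h ->
    (\int[mu]_(x in O `\` in_seg O (sg *: e0) h) (u x ^+ 2)%:E <=
     (D * h ^+ 2)%:E)%E.
Proof.
move=> oO [[mu_ u2] /(_ ord0)[mv v2] [phi [tphi phi_u /(_ ord0) phi_v]]].
have mO : measurable O by exact: open_measurable_rV.
have V2 : (\int[mu]_(x in O) (v x ord0 ord0 ^+ 2)%:E < +oo)%E.
  by rewrite -L2_sqr; exact: poweR_lty.
have V0 : (0 <= \int[mu]_(x in O) (v x ord0 ord0 ^+ 2)%:E)%E.
  by apply: integral_ge0 => x _; rewrite lee_fin sqr_ge0.
pose V := fine (\int[mu]_(x in O) (v x ord0 ord0 ^+ 2)%:E).
have VE : (\int[mu]_(x in O) (v x ord0 ord0 ^+ 2)%:E)%E = V%:E.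
  by rewrite /V fineK// ge0_fin_numE.
have Vge0 : 0 <= V by rewrite -lee_fin -VE.
(* [2 h^2] from the approximation of [u], plus [2 h^2 (2 + 2 V)] from the exit estimate, the squared
   derivative integrating to at most [2 + 2 V]. *)
exists (4 * V + 6) => [|sg h sg1 h0]; first by rewrite addr_ge0// mulr_ge0.
have h20 : 0 < h ^+ 2 by rewrite exprn_gt0.
have : \forall k \near \oo,
    (\int[mu]_(x in O) ((phi k x - u x) ^+ 2)%:E <= (h ^+ 2)%:E)%E /\
    (\int[mu]_(x in O) ((partial ord0 (phi k) x - v x ord0 ord0) ^+ 2)%:E <= 1%:E)%E.
  have h1 := L2_norm_cvg0 (f_ := fun k x => phi k x - u x) h20 phi_u.
  have h2 := L2_norm_cvg0 (f_ := fun k x => partial ord0 (phi k) x - v x ord0 ord0) ltr01 phi_v.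
  exact: (filterI h1 h2).
case=> k _ /(_ k (leqnn k)) [Iu Iv].
have [df /(_ ord0) cpf] : (forall x, differentiable (phi k) x) /\
    (forall i, continuous (partial i (phi k))) by exact: ((tphi k).1 1%N).
have mf : measurable_fun setT (phi k).
  by apply: continuous_measurable_rV => x; exact: differentiable_continuous.
have mpf : measurable_fun setT (partial ord0 (phi k)) by exact: continuous_measurable_rV.
set A := O `\` _.
have mA : measurable A by apply: measurableD => //; exact: measurable_in_seg.
have AO : A `<=` O by move=> x [].
have mfS (D B : set 'rV[R]_n.+1) (f : 'rV[R]_n.+1 -> R) : measurable D -> B `<=` D -> measurable_fun D f -> measurable_fun B f.
  by move=> mD BD; exact: measurable_funS.
apply: le_trans (integral_sqr_triangle mu mA (mfS O A u mO AO mu_) (measurable_funTS mf)) _.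
apply: (@le_trans _ _ (2%:E * (h ^+ 2)%:E + 2%:E * ((h ^+ 2)%:E * (2 + 2 * V)%:E))%E); last first.
  by rewrite -!EFinM -EFinD lee_fin; nra.
apply: leeD.
  rewrite lee_pmul2l//; apply: le_trans Iu.
  apply: ge0_subset_integral => //.
    apply/measurable_EFinP; apply: measurable_funX; apply: measurable_funB => //.
    exact: measurable_funTS.
  by move=> x _; rewrite lee_fin sqr_ge0.
rewrite lee_pmul2l//; apply: le_trans (test_function_exit oO (tphi k) sg1 h0) _.
rewrite lee_pmul2l//.
apply: le_trans (integral_sqr_triangle (g := fun x => v x ord0 ord0) mu mO (measurable_funTS mpf) mv) _.
rewrite VE (_ : (2 + 2 * V)%:E = (2%:E * 1 + 2%:E * V%:E)%E); last first.
  by rewrite mule1 -EFinM -EFinD.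
apply: leeD => //; rewrite lee_pmul2l//; apply: le_trans Iv.
rewrite le_eqVlt; apply/orP; left; apply/eqP; apply: eq_integral => x _.
by rewrite -sqrrN opprB.
Qed.

End H10_exit.

(** * Measurability of sections and partial integrals on a rectangle *)

Section partial_integrals.
Context d1 d2 (T1 : measurableType d1) (T2 : measurableType d2) (R : realType).
Variable m2 : {sigma_finite_measure set T2 -> \bar R}.
Variables (A : set T1) (B : set T2).
Hypotheses (mA : measurable A) (mB : measurable B).

Lemma measurable_fun_section (g : T1 * T2 -> \bar R) x :
  measurable_fun (A `*` B) g -> A x -> measurable_fun B (fun y => g (x, y)).
Proof.
move=> mg Ax _ Y mY.
have := mg (measurableX mA mB) Y mY => /(measurable_xsection x).
congr measurable; apply/seteqP; split => y; rewrite /xsection/= inE/=.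
  by move=> [[_ ?] ?].
by move=> [? ?].
Qed.

(** Kernels are measurable on a rectangle only; extension by zero brings them under the Tonelli
    theorem on the whole product. *)
Lemma measurable_ge0_integral_section (g : T1 * T2 -> \bar R) :
  measurable_fun (A `*` B) g -> (forall z, (A `*` B) z -> 0 <= g z)%E ->
  measurable_fun A (fun x => \int[m2]_(y in B) g (x, y))%E.
Proof.
move=> mg g0.
pose h := g \_ (A `*` B).
have mh : measurable_fun setT h.
  by apply: (iffLR (measurable_restrictT _ (measurableX mA mB))).
have h0 z : (0 <= h z)%E.
  by rewrite /h /patch; case: ifPn => // /set_mem; exact: g0.
apply: (@eq_measurable_fun _ _ _ _ _ (fun x => \int[m2]_y h (x, y))%E); last first.
  by apply: measurable_funTS; exact: (measurable_fun_fubini_tonelli_F (m2 := m2) h).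
move=> x /set_mem Ax; rewrite [RHS]integral_mkcond; apply: eq_integral => y _.
rewrite /h /patch; case: (boolP (y \in B)) => [yB|yB].
  by rewrite mem_set//; split => //=; exact: set_mem.
by rewrite memNset// => -[_ /= By]; move: yB; rewrite notin_setE.
Qed.

Lemma measurable_integral_section (g : T1 * T2 -> \bar R) :
  measurable_fun (A `*` B) g ->
  measurable_fun A (fun x => \int[m2]_(y in B) g (x, y))%E.
Proof.
move=> mg.
have E x : (\int[m2]_(y in B) g (x, y) = \int[m2]_(y in B) (g^\+ (x, y)) -
    \int[m2]_(y in B) (g^\- (x, y)))%E.
  by rewrite [LHS]integralE; congr (_ - _)%E; apply: eq_integral => y _; rewrite !unlock.
apply: (eq_measurable_fun _ (fun x _ => esym (E x))).
apply: emeasurable_funB; apply: measurable_ge0_integral_section => //.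
  exact: measurable_funepos.
exact: measurable_funeneg.
Qed.

Lemma measurable_Rintegral_section (g : T1 * T2 -> R) :
  measurable_fun (A `*` B) g ->
  measurable_fun A (fun x => \int[m2]_(y in B) g (x, y))%R.
Proof.
move=> mg; apply: (measurableT_comp (fine_measurable measurableT)) => //.
apply: (measurable_integral_section (g := EFin \o g)).
exact/measurable_EFinP.
Qed.

(** A real-valued integral is 0 where it diverges, so sets defined through it are restricted to the
    points of convergence; this makes the restriction measurable. *)
Lemma measurable_integrable_section (g : T1 * T2 -> R) :
  measurable_fun (A `*` B) g ->
  measurable [set x | A x /\ m2.-integrable B (fun y => (g (x, y))%:E)].
Proof.
move=> mg.
have mgE : measurable_fun (A `*` B) (EFin \o g) by exact/measurable_EFinP.
have mI : measurable_fun A (fun x => \int[m2]_(y in B) `|(g (x, y))%:E|)%E.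
  apply: (measurable_ge0_integral_section (g := fun z => `|(g z)%:E|%E)) => //.
  exact: measurableT_comp.
rewrite (_ : mkset _ = A `&` (fun x => \int[m2]_(y in B) `|(g (x, y))%:E|)%E @^-1` `]-oo, (+oo%E : \bar R)[%classic).
  by apply: mI => //; exact: emeasurable_itv.
apply/seteqP; split => x [Ax] /=; rewrite in_itv/=.
  by case/integrableP.
move=> goo; split => //; apply/integrableP; split; last exact: goo.
exact: (measurable_fun_section mgE).
Qed.

End partial_integrals.

(** The Gaussian factor makes the indicator of any measurable set integrable and square integrable;
    being positive, it can be divided out pointwise at the end. *)
Definition gauss_indic (R : realType) n (W : set 'rV[R]_n) (y : 'rV[R]_n) : R :=
  gauss 1 y * \1_W y.

Lemma ae_forall_countable d (T : measurableType d) (R : realType)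
    (mu : {measure set T -> \bar R}) (I : countType) (P : I -> T -> Prop) :
  (forall i, {ae mu, forall x, P i x}) -> {ae mu, forall x, forall i, P i x}.
Proof.
move=> aeP.
have : {ae mu, forall x, forall k, if @unpickle I k is Some i then P i x else True}.
  by apply: ae_foralln => k; case: unpickle => [i|]; [exact: aeP|exact: aeW].
by apply: filterS => x Px i; have := Px (pickle i); rewrite pickleK.
Qed.

Lemma hyperplane_null (R : realType) n (a : R) :
  lebesgue_rV R n.+1 [set y | y ord0 ord0 = a] = 0%E.
Proof.
pose A (i : 'I_n.+1) := if i == ord0 then [set a] else [set: R].
have A0 : A ord0 = [set a] by rewrite /A eqxx.
have := @lebesgue_rV_box R n.+1 A.
rewrite (bigD1 ord0)//= A0 lebesgue_measure_set1 mul0e => <-.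
  congr (lebesgue_rV R n.+1 _); apply/seteqP; split => y /=; rewrite /A.
    by move=> <- i; case: eqP => // ->.
  by move/(_ ord0).
by move=> i; rewrite /A; case: ifP.
Qed.

(** * The almost-everywhere lower bound at a fixed time, with variance [al] and gradient amplitude
    [B y] *)

Section lower_bound.
Variables (R : realType) (n : nat).
Local Notation mu := (lebesgue_rV R n.+1).
Local Notation E := 'rV[R]_n.+1.
Local Notation e0 := (delta_mx ord0 ord0 : E).
Variables (O : set E) (St : (E -> R) -> E -> R) (Gt : E -> E -> R).
Variables (B : E -> R) (Bmax al : R).
Hypothesis oO : open O.
Hypothesis mG : measurable_fun (O `*` O) (fun z : E * E => Gt z.1 z.2).
Hypothesis repG : forall f, in_Lp O (fun=> 1) 2 f ->
  {ae mu, forall x, O x -> kernel_defined_at O Gt f x /\ St f x = kernel_op O Gt f x}.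
Hypothesis H10G : forall f, in_Lp O (fun=> 1) 2 f -> exists v, H10 O (St f) v.
Hypothesis al0 : 0 < al.
Hypothesis B0 : forall y, 0 <= B y <= Bmax.
Hypothesis mB : measurable_fun setT B.
Hypothesis dG : forall x y, O x -> O y -> differentiable (Gt ^~ y) x.
Hypothesis bG : forall x y, O x -> O y ->
  enorm (grad (Gt ^~ y) x) <= B y * expR (- (enorm (x - y) ^+ 2 / (2 * al))).

Let mO : measurable O. Proof. exact: open_measurable_rV. Qed.

(** The function [P] of [gaussian_line_variation], with [|x - y|^2] for [N s] and the signed first
    coordinate of [x - y] for [tau + s]. Its drop along a half-line that moves away from [y]
    dominates the variation of [Gt]. *)
Definition comparison (sg : R) (x y : E) : R :=
  B y * Num.sqrt al * expR 1 * expR (- (enorm (x - y) ^+ 2 / (4 * al)) -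
    sg * (x ord0 ord0 - y ord0 ord0) / Num.sqrt al).

Lemma comparison_ge0 sg x y : 0 <= comparison sg x y.
Proof. by rewrite !mulr_ge0 ?expR_ge0 ?sqrtr_ge0//; have /andP[] := B0 y. Qed.

(** The linear term may have either sign here; completing the square against the quadratic term
    bounds the exponent by 1. *)
Lemma comparison_le sg x y : sg ^+ 2 = 1 ->
  comparison sg x y <= Bmax * Num.sqrt al * expR 1 * expR 1.
Proof.
move=> sg1; have ra0 : 0 < Num.sqrt al by rewrite sqrtr_gt0.
apply: ler_pM; rewrite ?expR_ge0//.
- by rewrite !mulr_ge0 ?expR_ge0 ?sqrtr_ge0//; have /andP[] := B0 y.
- by rewrite ler_wpM2r ?expR_ge0// ler_wpM2r ?sqrtr_ge0//; have /andP[] := B0 y.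
rewrite ler_expR.
have := ge_enorm (x - y) ord0; rewrite -(@ler_pXn2r _ 2) ?nnegrE ?enorm_ge0//.
rewrite real_normK ?num_real// !mxE; move: (enorm _ ^+ 2) => N.
set z := x ord0 ord0 - y ord0 ord0 => zN.
have {}zN : (sg * z) ^+ 2 <= N by rewrite exprMn sg1 mul1r.
have sal : al = Num.sqrt al ^+ 2 by rewrite sqr_sqrtr// ltW.
rewrite -subr_ge0; apply: (@le_trans _ _ ((sg * z + 2 * Num.sqrt al) ^+ 2 / (4 * al) + (N - (sg * z) ^+ 2) / (4 * al))).
  by rewrite addr_ge0// divr_ge0 ?sqr_ge0 ?subr_ge0// mulr_ge0// ltW.
rewrite le_eqVlt; apply/orP; left; apply/eqP.
move: (Num.sqrt al) ra0 sal => r r0 ->.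
by field; rewrite gt_eqF.
Qed.

Lemma enorm_sqr_shift (z : E) (s sg : R) : sg ^+ 2 = 1 ->
  enorm (z + s *: (sg *: e0)) ^+ 2 =
  enorm z ^+ 2 + 2 * s * (sg * z ord0 ord0) + s ^+ 2.
Proof.
move=> sg1; rewrite !enorm_sqr (bigD1 ord0)//= [X in _ = X + _ + _](bigD1 ord0)//=.
have -> : \sum_(i < n.+1 | i != ord0) (z + s *: (sg *: e0)) ord0 i ^+ 2 =
    \sum_(i < n.+1 | i != ord0) z ord0 i ^+ 2.
  by apply: eq_bigr => i /negbTE i0; rewrite !mxE i0 andbF !mulr0 addr0.
rewrite !mxE !eqxx/= mulr1 sqrrD exprMn sg1 mulr1 mulr2n; ring.
Qed.

Lemma Gt_variation sg x y s : sg ^+ 2 = 1 -> 0 <= s ->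
  in_seg O (sg *: e0) s x -> O y -> sg * y ord0 ord0 <= sg * x ord0 ord0 ->
  `|Gt (x + s *: (sg *: e0)) y - Gt x y| <=
  comparison sg x y - comparison sg (x + s *: (sg *: e0)) y.
Proof.
move=> sg1 s0 xs Oy yx; set e : E := sg *: e0.
have ee : enorm e = 1.
  have := enorm_sqr_shift 0 1 sg1.
  rewrite add0r scale1r enorm0 mxE expr0n/= mulr0 mulr0 addr0 add0r expr1n => ee.
  by rewrite -[LHS]ger0_norm ?enorm_ge0// -sqrtr_sqr ee sqrtr1.
pose tau := sg * (x - y) ord0 ord0.
have tauE r : sg * ((x + r *: e) ord0 ord0 - y ord0 ord0) = tau + r.
  rewrite /tau !mxE !eqxx/= mulr1 mulrBr mulrDr mulrBr mulrCA -expr2 sg1 mulr1; ring.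
have NE r : enorm (x + r *: e - y) ^+ 2 = enorm (x - y) ^+ 2 + 2 * r * tau + r ^+ 2.
  by rewrite -enorm_sqr_shift// addrAC.
have := @gaussian_line_variation R (fun r => Gt (x + r *: e) y)
  (fun r => 'D_e (Gt ^~ y) (x + r *: e)) (enorm (x - y) ^+ 2) tau al (B y) s al0.
have /andP[By _] := B0 y => /(_ By).
have tau0 : 0 <= tau by rewrite /tau !mxE mulrBr subr_ge0.
have tauN : tau ^+ 2 <= enorm (x - y) ^+ 2.
  rewrite /tau exprMn sg1 mul1r -(real_normK (num_real _)).
  by rewrite ler_pXn2r ?nnegrE ?enorm_ge0// ge_enorm.
move=> /(_ tau0 tauN s0) /= H.
have compE r : comparison sg (x + r *: e) y = B y * Num.sqrt al * expR 1 *
    expR (- ((enorm (x - y) ^+ 2 + 2 * r * tau + r ^+ 2) / (4 * al)) -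
      (tau + r) / Num.sqrt al) by rewrite /comparison NE tauE.
have x0E : x = x + 0 *: e by rewrite scale0r addr0.
have H1 r : 0 <= r <= s -> is_derive r 1 (fun r => Gt (x + r *: e) y)
    ('D_e (Gt ^~ y) (x + r *: e)).
  by move=> rs; apply: is_derive_line; apply: dG => //; exact: xs.
have H2 r : 0 <= r <= s -> `|'D_e (Gt ^~ y) (x + r *: e)| <=
    B y * expR (- ((enorm (x - y) ^+ 2 + 2 * r * tau + r ^+ 2) / (2 * al))).
  move=> rs; apply: le_trans (ler_derive_grad _ _) _; first by apply: dG => //; exact: xs.
  by rewrite ee mulr1 -NE; apply: bG => //; exact: xs.
by have := H H1 H2; rewrite -!compE -x0E.
Qed.

Lemma measurable_comparison sg :
  measurable_fun setT (fun z : E * E => comparison sg z.1 z.2).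
Proof.
have m1 i : measurable_fun setT (fun z : E * E => z.1 ord0 i).
  exact: (measurableT_comp (measurable_rV_coord i) measurable_fst).
have m2 i : measurable_fun setT (fun z : E * E => z.2 ord0 i).
  exact: (measurableT_comp (measurable_rV_coord i) measurable_snd).
have mE : measurable_fun setT (fun z : E * E => enorm (z.1 - z.2)).
  apply: (measurableT_comp (@measurable_enorm R n.+1)).
  apply: measurable_fun_rVP => i; under eq_fun do rewrite !mxE.
  exact: measurable_funB.
have mB2 : measurable_fun setT (fun z : E * E => B z.2).
  exact: (measurableT_comp mB measurable_snd).
apply: measurable_funM; first by do 2 apply: measurable_funM => //.
apply: measurableT_comp => //; apply: measurable_funB.
  by apply: measurableT_comp => //; apply: measurable_funM => //; exact: measurable_funX.
by apply: measurable_funM => //; apply: measurable_funM => //; exact: measurable_funB.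
Qed.

Section defect.
Variables (W : set E) (sg q : R).
Hypotheses (mW : measurable W) (sg1 : sg ^+ 2 = 1).
Hypothesis Wq : forall y, W y -> sg * y ord0 ord0 <= q.

Local Notation f := (gauss_indic W).

Lemma gauss_indic_ge0 y : 0 <= f y.
Proof. by rewrite mulr_ge0 ?gauss_ge0// indicE ler0n. Qed.

Lemma measurable_gauss_indic : measurable_fun setT f.
Proof.
by apply: (measurable_funM (measurable_gauss _)); exact: measurable_indic.
Qed.

Lemma integrable_gauss_indic : mu.-integrable O (EFin \o f).
Proof.
have mf := measurable_gauss_indic; have f0 := gauss_indic_ge0.
apply/integrableP; split; first by apply/measurable_EFinP; exact: measurable_funTS.
apply: (@le_lt_trans _ _ (\int[mu]_x (gauss 1 (x - 0))%:E)%E); last first.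
  by rewrite integral_gauss// ltry.
rewrite integral_mkcond; apply: ge0_le_integral => //.
- by move=> x _; rewrite /patch; case: ifP.
- apply: (iffLR (measurable_restrictT _ mO)); apply: measurableT_comp => //.
  by apply/measurable_EFinP; exact: measurable_funTS.
- by apply/measurable_EFinP; exact: measurable_gaussB.
- move=> x _; rewrite subr0 /patch; case: ifPn => _; last by rewrite lee_fin gauss_ge0.
  by rewrite /= lee_fin ger0_norm// ler_piMr ?gauss_ge0.
Qed.

Lemma gauss_indic_L2 : in_Lp O (fun=> 1) 2 f.
Proof.
have mf := measurable_gauss_indic; have f0 := gauss_indic_ge0.
split; first exact: measurable_funTS.
rewrite L2_normE; apply: poweR_lty.
pose c0 := (2 * pi * (1:R)) `^ (- (n.+1%:R / 2)).
have fc y : f y <= c0.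
  rewrite /f; apply: (@le_trans _ _ (gauss 1 y)).
    by rewrite ler_piMr ?gauss_ge0.
  rewrite /gauss -[leRHS]mulr1 ler_wpM2l ?powR_ge0//.
  by rewrite -[leRHS]expR0 ler_expR oppr_le0 divr_ge0 ?sqr_ge0.
apply: (@le_lt_trans _ _ (c0%:E * \int[mu]_(x in O) (f x)%:E)%E).
  rewrite -ge0_integralZl_real ?powR_ge0//; last exact: measurable_funTS.
  apply: ge0_le_integral => //.
  - by move=> x _; rewrite lee_fin sqr_ge0.
  - by apply/measurable_EFinP; apply: measurable_funX; exact: measurable_funTS.
  - by apply/measurable_EFinP; apply: measurable_funM => //; exact: measurable_funTS.
  - by move=> x _; rewrite lee_fin expr2 ler_wpM2r.
rewrite lte_mul_pinfty//; first by rewrite lee_fin powR_ge0.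
by rewrite -ge0_fin_numE; [exact: (integrable_fin_num mO integrable_gauss_indic)|apply: integral_ge0 => x _; rewrite lee_fin].
Qed.

(** The correction by [comparison] makes this nondecreasing as [x] moves in the direction [sg]: [Gt]
    can grow by no more than [comparison] drops. *)
Definition defect (x : E) : R := \int[mu]_(y in O) ((- Gt x y - comparison sg x y) * f y).

Lemma measurable_kernel_gauss_indic : measurable_fun (O `*` O) (fun z : E * E => Gt z.1 z.2 * f z.2).
Proof.
have mf := measurable_gauss_indic; have f0 := gauss_indic_ge0.
apply: measurable_funM => //; apply: measurable_funTS.
exact: (measurableT_comp measurable_gauss_indic measurable_snd).
Qed.

Lemma integrable_comparison x : mu.-integrable O (fun y => (comparison sg x y * f y)%:E).
Proof.
have mf := measurable_gauss_indic; have f0 := gauss_indic_ge0.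
have ic : mu.-integrable O (fun y => ((Bmax * Num.sqrt al * expR 1 * expR 1) * f y)%:E).
  have := integrableZl mO (Bmax * Num.sqrt al * expR 1 * expR 1) integrable_gauss_indic.
  by apply: eq_integrable => //.
apply: le_integrable ic => //.
  apply/measurable_EFinP; apply: measurable_funM; apply: measurable_funTS => //.
  exact: (measurableT_comp (measurable_comparison sg) (measurable_pair1 x)).
move=> y _; rewrite /= lee_fin.
have h1 : 0 <= comparison sg x y * f y by rewrite mulr_ge0// comparison_ge0.
have h2 : comparison sg x y * f y <= Bmax * Num.sqrt al * expR 1 * expR 1 * f y.
  by rewrite ler_wpM2r// comparison_le.
by rewrite !ger0_norm// (le_trans h1 h2).
Qed.

Lemma integrable_defect x : kernel_defined_at O Gt f x ->
  mu.-integrable O (fun y => ((- Gt x y - comparison sg x y) * f y)%:E).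
Proof.
have mf := measurable_gauss_indic; have f0 := gauss_indic_ge0.
move=> kx; have := integrableB mO (integrableN kx) (integrable_comparison x).
apply: eq_integrable => // y _ /=.
by rewrite mulrBl mulNr.
Qed.

(** Convergence is part of the definition because a divergent integral would count as 0. The
    condition with [q] places [x] beyond [W], so that moving on leads away from every [y] in [W]. *)
Definition defect_set (kap : R) : set E := [set x | (O x /\ kernel_defined_at O Gt f x) /\
   (q <= sg * x ord0 ord0 /\ kap < defect x)].

Lemma measurable_defect_set kap : measurable (defect_set kap).
Proof.
have mf := measurable_gauss_indic; have f0 := gauss_indic_ge0.
have mD := measurable_integrable_section mu mO mO measurable_kernel_gauss_indic.
have mU : measurable_fun O defect.
  apply: (measurable_Rintegral_section mu mO mO
    (g := fun z : E * E => (- Gt z.1 z.2 - comparison sg z.1 z.2) * f z.2)).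
  apply: measurable_funM; last by apply: measurable_funTS; exact: (measurableT_comp measurable_gauss_indic measurable_snd).
  apply: measurable_funB; first exact: measurableT_comp.
  by apply: measurable_funTS; exact: measurable_comparison.
have mc : measurable_fun setT (fun x : E => sg * x ord0 ord0).
  by apply: measurable_funM => //; exact: measurable_rV_coord.
have m1 := mc measurableT `[q, +oo[%classic (measurable_itv _).
have m2 := mU mO `]kap, +oo[%classic (measurable_itv _).
have := measurableI _ _ mD (measurableI _ _ m1 m2).
congr measurable; apply/seteqP; split => x; rewrite /defect_set/= !in_itv/= !andbT.
  by move=> [[Ox kx] [[_ qx] [_ Ux]]].
by move=> [[Ox kx] [qx Ux]].
Qed.

Lemma defect_set_stable kap x s : 0 <= s -> defect_set kap x -> in_seg O (sg *: e0) s x ->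
  defect_set kap (x + s *: (sg *: e0)).
Proof.
have mf := measurable_gauss_indic; have f0 := gauss_indic_ge0.
move=> s0 [[Ox kx] [qx Ux]] xs; set x' := x + _.
have Ox' : O x' by apply: xs; rewrite s0 lexx.
have var y : O y -> `|Gt x' y * f y - Gt x y * f y| <=
    (comparison sg x y - comparison sg x' y) * f y.
  move=> Oy; rewrite -mulrBl normrM (ger0_norm (gauss_indic_ge0 y)).
  have [yW|yW] := pselect (W y); last first.
    by rewrite /f indicE memNset// !mulr0.
  rewrite ler_wpM2r//; apply: Gt_variation => //; exact: le_trans (Wq yW) qx.
(* Convergence is known only almost everywhere, but it propagates along the half-line: the integrand
   at [x'] is at most that at [x] in absolute value, plus the [comparison] term. *)
have kx' : kernel_defined_at O Gt f x'.
  have iS : mu.-integrable O (fun y => (`|Gt x y * f y| + comparison sg x y * f y)%:E).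
    exact: (integrableD mO (integrable_abse kx) (integrable_comparison x)).
  apply: le_integrable iS => //.
    have mGfE : measurable_fun (O `*` O) (fun z : E * E => (Gt z.1 z.2 * f z.2)%:E).
      by apply/measurable_EFinP; exact: measurable_kernel_gauss_indic.
    exact: (measurable_fun_section mO mO mGfE Ox').
  move=> y Oy; rewrite /= lee_fin [leRHS]ger0_norm; last first.
    by rewrite addr_ge0// mulr_ge0// comparison_ge0.
  have := ler_normD (Gt x' y * f y - Gt x y * f y) (Gt x y * f y).
  rewrite subrK => /le_trans; apply; rewrite addrC lerD2l.
  apply: le_trans (var _ Oy) _; rewrite ler_wpM2r// lerBlDr lerDl.
  exact: comparison_ge0.
split; first by split.
split.
  rewrite /x' !mxE !eqxx/= mulr1 mulrDr mulrCA -expr2 sg1 mulr1.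
  by rewrite (le_trans qx)// lerDl.
apply: lt_le_trans Ux _; apply: le_Rintegral => //; [exact: integrable_defect|exact: integrable_defect|].
move=> y Oy; have := var _ Oy; rewrite ler_norml => /andP[_].
by rewrite !mulrBl !mulNr; lra.
Qed.

(** Almost everywhere on this set [- St f] exceeds [kap], as [comparison] is nonnegative. Chebyshev
    turns the exit estimate for [St f] into the measure bound with constant [D / kap^2] that
    [shift_stable_null] asks for, and also gives finite measure. *)
Lemma defect_set_null kap : 0 < kap -> mu (defect_set kap) = 0%E.
Proof.
have mf := measurable_gauss_indic; have f0 := gauss_indic_ge0.
move=> k0; have [v Hv] := H10G gauss_indic_L2.
have [D D0 HD] := H10_exit oO Hv; have [[mu2 u2] _ _] := Hv.
have k20 : 0 < kap ^+ 2 by rewrite exprn_gt0.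
have TO : defect_set kap `<=` O by move=> x [[]].
have mTk := measurable_defect_set kap.
have cheb A : measurable A -> A `<=` defect_set kap ->
    ((kap ^+ 2)%:E * mu A <= \int[mu]_(x in A) (St f x ^+ 2)%:E)%E.
  move=> mA AT; rewrite -integral_cst//; apply: ae_ge0_le_integral => //.
  - by move=> x _; rewrite lee_fin ltW.
  - by move=> x _; rewrite lee_fin sqr_ge0.
  - apply/measurable_EFinP; apply: measurable_funX.
    by apply: measurable_funS mu2 => // x /AT /TO.
  apply: filterS (repG gauss_indic_L2) => x rep Ax.
  have [[Ox kx] [qx Ux]] := AT _ Ax; have [_ ->] := rep Ox.
  have : defect x <= - kernel_op O Gt f x.
    rewrite -mulN1r -(RintegralZl _ mO kx); apply: le_Rintegral => //.
    - exact: integrable_defect.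
    - by have := integrableZl mO (-1) kx; apply: eq_integrable.
    - move=> y Oy; rewrite mulN1r mulrBl mulNr gerBl.
      by rewrite mulr_ge0 ?comparison_ge0 ?gauss_indic_ge0.
  move=> /(lt_le_trans Ux) kK; rewrite lee_fin -[leRHS]sqrrN.
  have h1 := ltW kK; have h2 := ltW k0; have h3 := ltW (lt_trans k0 kK).
  by rewrite ler_pXn2r ?nnegrE.
apply: (@shift_stable_null R n O (defect_set kap) sg (D / kap ^+ 2) q oO mTk TO sg1).
- by rewrite divr_ge0// ltW.
- exact: defect_set_stable.
- move=> h h0; have mA : measurable (defect_set kap `\` in_seg O (sg *: e0) h).
    by apply: measurableD => //; exact: measurable_in_seg.
  rewrite -(@lee_pmul2l _ (kap ^+ 2)%:E)// -EFinM.
  rewrite (_ : kap ^+ 2 * _ = D * h ^+ 2); last by field; rewrite gt_eqF.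
  apply: le_trans (cheb _ mA _) _; first by move=> x [].
  apply: le_trans (HD _ _ sg1 h0); apply: ge0_subset_integral => //.
  - by apply: measurableD => //; exact: measurable_in_seg.
  - apply/measurable_EFinP; apply: measurable_funX.
    by apply: measurable_funS mu2 => // x [].
  - by move=> x _; rewrite lee_fin sqr_ge0.
  - by move=> x [/TO].
- have : ((kap ^+ 2)%:E * mu (defect_set kap) < +oo)%E.
    apply: le_lt_trans (cheb _ mTk (@subset_refl _ _)) _.
    apply: (@le_lt_trans _ _ (\int[mu]_(x in O) (St f x ^+ 2)%:E)%E).
      apply: ge0_subset_integral => //.
        by apply/measurable_EFinP; exact: measurable_funX.
      by move=> x _; rewrite lee_fin sqr_ge0.
    by rewrite -L2_sqr; exact: poweR_lty.
  move=> H; rewrite ltey; apply/negP => /eqP TE.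
  by move: H; rewrite TE gt0_muley ?lte_fin// ltxx.
- by move=> x [_ []].
Qed.

Lemma ae_defect_le0 : {ae mu, forall x, O x -> kernel_defined_at O Gt f x ->
  q <= sg * x ord0 ord0 -> defect x <= 0}.
Proof.
have : mu.-negligible (\bigcup_k defect_set k.+1%:R^-1).
  apply: negligible_bigcup => k; apply/negligibleP.
    exact: measurable_defect_set.
  by apply: defect_set_null; rewrite invr_gt0 ltr0n.
apply: negligibleS => x /= /not_implyP[Ox /not_implyP[kx /not_implyP[qx /negP]]].
rewrite -ltNge => U0; exists (Num.truncn (defect x)^-1) => //; split => //; split => //.
by rewrite invf_plt ?posrE// truncnS_gt.
Qed.

End defect.

Lemma kernel_defined_gauss W x : measurable W -> O x ->
  kernel_defined_at O Gt (gauss_indic setT) x -> kernel_defined_at O Gt (gauss_indic W) x.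
Proof.
move=> mW Ox kx; apply: le_integrable kx => //.
  apply: (measurable_fun_section mO mO (g := fun z : E * E => (Gt z.1 z.2 * gauss_indic W z.2)%:E) _ Ox).
  by apply/measurable_EFinP; exact: measurable_kernel_gauss_indic.
move=> y _; rewrite /= lee_fin normrM [leRHS]normrM; apply: ler_wpM2l => //.
rewrite !ger0_norm ?gauss_indic_ge0// /gauss_indic ler_wpM2l ?gauss_ge0//.
by rewrite !indicE in_setT; case: (_ \in _).
Qed.

(** For almost every [x] the sign of [defect] is known for countably many [W] simultaneously, and
    integrals over table sets determine the sign of the integrand for almost every [y]. *)
Lemma kernel_half_bound sg : sg ^+ 2 = 1 ->
  {ae mu, forall x, O x -> {ae mu, forall y, O y ->
    sg * y ord0 ord0 < sg * x ord0 ord0 -> - Gt x y <= comparison sg x y}}.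
Proof.
move=> sg1.
pose H (r : rat) := [set y : E | sg * y ord0 ord0 <= ratr r].
have mH r : measurable (H r).
  have mc : measurable_fun setT (fun y : E => sg * y ord0 ord0).
    by apply: measurable_funM => //; exact: measurable_rV_coord.
  have := mc measurableT `]-oo, ratr r]%classic (measurable_itv _).
  by congr measurable; apply/seteqP; split => y; rewrite /H/= in_itv/=; [case|].
have mtab := measurable_table_set (@measurable_rat_halfspace R n.+1).
pose I := ({k : nat & {ffun k.-tuple bool -> bool}} * rat)%type.
(* A rational hyperplane separates [y] from [x]; intersecting with [H] puts the whole test set
   behind it, as [ae_defect_le0] requires. *)
pose W (i : I) := table_set (@rat_halfspace R n.+1) i.1 `&` H i.2.
have mW i : measurable (W i) by apply: measurableI.
have ae1 : {ae mu, forall x, forall i : I, O x ->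
    kernel_defined_at O Gt (gauss_indic (W i)) x ->
    ratr i.2 <= sg * x ord0 ord0 -> defect (W i) sg x <= 0}.
  apply: ae_forall_countable => i.
  by apply: ae_defect_le0 => // y [].
have ae2 := repG (gauss_indic_L2 (@measurableT _ E)).
apply: filterS2 ae1 ae2 => x D1 D2 Ox.
have [kx _] := D2 Ox.
have : {ae mu, forall y, forall r : rat, O y -> H r y ->
    ratr r <= sg * x ord0 ord0 -> - Gt x y <= comparison sg x y}.
  apply: ae_forall_countable => r.
  have [rx|rx] := leP (ratr r) (sg * x ord0 ord0); last by apply: aeW.
  pose h y := (- Gt x y - comparison sg x y) * gauss_indic setT y.
  have ih : mu.-integrable (O `&` H r) (EFin \o h).
    apply: (integrableS mO (measurableI _ _ mO (mH r)) (@subIsetl _ _ _)).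
    exact: integrable_defect.
  have := ae_le0_table_set (measurableI _ _ mO (mH r)) (@measurable_rat_halfspace R n.+1) ih.
  case.
    move=> p; have := D1 (p, r) Ox (kernel_defined_gauss (mW _) Ox kx) rx.
    rewrite /defect /Rintegral.
    have -> : (\int[mu]_(y in O) ((- Gt x y - comparison sg x y) * gauss_indic (W (p, r)) y)%:E =
        \int[mu]_(y in O `&` H r `&` table_set (@rat_halfspace R n.+1) p) (h y)%:E)%E.
      rewrite -setIA [in RHS]integral_mkcondr; apply: eq_integral => y _.
      rewrite /h /gauss_indic /patch /W setIC indicE indicT mulr1.
      by case: ifP => _; rewrite ?mulr1 ?mulr0.
    move=> h0; rewrite -[leLHS]fineK ?lee_fin//.
    have mOH := measurableI _ _ mO (mH r).
    apply: integrable_fin_num; first exact: measurableI.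
    exact: (integrableS mOH (measurableI _ _ mOH (mtab p)) (@subIsetl _ _ _) ih).
  move=> N hN; exists N; case: hN => mN N0 HN; split => //.
  apply: subset_trans HN => y /= /not_implyP[Oy /not_implyP[Hy /not_implyP[_ nG]]] Hh.
  apply: nG; have := Hh (conj Oy Hy).
  rewrite /h /gauss_indic indicT mulr1 pmulr_lle0 ?gauss_gt0//.
  by rewrite subr_le0.
apply: filterS => y Hy Oy /rat_in_itvoo[r]; rewrite in_itv/= => /andP[yr rx].
by apply: (Hy r) => //; exact: ltW.
Qed.

(** The two signs treat the [y] on either side of [x], the hyperplane between them being null. On
    each side the linear term in the exponent of [comparison] has a favourable sign and is
    dropped. *)
Theorem kernel_lower_bound :
  {ae mu, forall x, O x -> {ae mu, forall y, O y ->
    - Gt x y <= B y * (Num.sqrt al * expR 1) * expR (- (enorm (x - y) ^+ 2 / (4 * al)))}}.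
Proof.
have sgP : (1 : R) ^+ 2 = 1 by rewrite expr1n.
have sgN : (- 1 : R) ^+ 2 = 1 by rewrite sqrrN expr1n.
apply: filterS2 (kernel_half_bound sgP) (kernel_half_bound sgN) => x hP hN Ox.
have ne : {ae mu, forall y : E, y ord0 ord0 <> x ord0 ord0}.
  exists [set y : E | y ord0 ord0 = x ord0 ord0]; split => //.
  - have := @measurable_rV_coord R n.+1 ord0 measurableT [set x ord0 ord0] (measurable_set1 _).
    by rewrite setTI.
  - exact: hyperplane_null.
  - by move=> y /= /contrapT.
apply: filterS3 (hP Ox) (hN Ox) ne => y bP bN /eqP yx Oy.
have le sg : 0 <= sg * (x ord0 ord0 - y ord0 ord0) -> comparison sg x y <=
    B y * (Num.sqrt al * expR 1) * expR (- (enorm (x - y) ^+ 2 / (4 * al))).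
  move=> h; rewrite /comparison !mulrA ler_wpM2l//.
    by rewrite !mulr_ge0 ?expR_ge0 ?sqrtr_ge0//; have /andP[] := B0 y.
  by rewrite ler_expR gerBl divr_ge0// sqrtr_ge0.
have [yx'|yx'|yx'] := ltgtP (y ord0 ord0) (x ord0 ord0); last by rewrite yx' eqxx in yx.
  apply: le_trans (bP Oy _) (le _ _); first by rewrite !mul1r.
  by rewrite mul1r subr_ge0 ltW.
apply: le_trans (bN Oy _) (le _ _); first by rewrite !mulN1r ltrN2.
by rewrite mulN1r opprB subr_ge0 ltW.
Qed.

End lower_bound.

(** * Distance to the boundary *)

Section boundary_distance.
Variables (R : realType) (d : nat).
Implicit Types (O : set 'rV[R]_d) (x y z : 'rV[R]_d).

(** With an empty frontier [O] is closed as well as open; its trace on the line from [x] to any [y]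
    is then a nonempty clopen subset of the real line, hence everything. *)
Lemma frontier_nonempty O x : open O -> O <> setT -> O x -> frontier O !=set0.
Proof.
move=> oO OT Ox; apply/set0P/negP => /eqP f0.
have cO : closed O.
  move=> y cy; apply: contrapT => Oy.
  have : frontier O y by split => // /interior_subset.
  by rewrite f0.
apply: OT; apply/seteqP; split => // y _.
pose g (s : R) := x + s *: (y - x).
have cg : continuous g.
  move=> s; apply: cvgD; first exact: cvg_cst.
  by apply: cvgZr_tmp; exact: cvg_id.
have oA : open (g @^-1` O) by apply: open_comp => // s _; exact: cg.
have cA : closed (g @^-1` O) by apply: preimage_closed => // s _; exact: cg.
have cT : connected [set: R] by apply/connected_intervalP.
have gT : g @^-1` O = setT.
  apply: cT.
  - by exists 0; rewrite /g/= scale0r addr0.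
  - by exists (g @^-1` O) => //; rewrite setTI.
  - by exists (g @^-1` O) => //; rewrite setTI.
have : (g @^-1` O) 1 by rewrite gT.
by rewrite /g/= scale1r subrKC.
Qed.

Lemma rho_lt O x (e : R) : frontier O !=set0 -> rho O x < e ->
  exists2 y, frontier O y & enorm (x - y) < e.
Proof.
move=> [y0 fy0] re.
have [_ [y fy <-] ye] : exists2 r, [set enorm (x - y) | y in frontier O] r & r < e.
  by apply: inf_lt => //; exists (enorm (x - y0)), y0.
by exists y.
Qed.

Lemma rho_le O x y : frontier O y -> rho O x <= enorm (x - y).
Proof.
move=> fy; apply: ge_inf; last by exists y.
by exists 0 => _ [z _ <-]; exact: enorm_ge0.
Qed.

Lemma rho_ge0 O x : 0 <= rho O x.
Proof.
have [[y fy]|/set0P/negP/negPn/eqP f0] := pselect (frontier O !=set0).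
  apply: lb_le_inf; first by exists (enorm (x - y)), y.
  by move=> _ [z _ <-]; exact: enorm_ge0.
by rewrite /rho f0 image_set0 inf0.
Qed.

Lemma rho_lipschitz O x y : `|rho O x - rho O y| <= 1 * enorm (x - y).
Proof.
have [fn|/set0P/negP/negPn/eqP f0] := pselect (frontier O !=set0); last first.
  by rewrite /rho f0 !image_set0 subrr normr0 mul1r enorm_ge0.
have H a b : rho O a <= rho O b + enorm (a - b).
  apply/ler_addgt0Pr => e e0.
  have [z fz bz] : exists2 z, frontier O z & enorm (b - z) < rho O b + e.
    by apply: rho_lt => //; rewrite ltrDl.
  apply: le_trans (rho_le a fz) _; apply: le_trans (ler_enorm_trans b _ _) _.
  by move: bz; lra.
have := H x y; have := H y x; rewrite [enorm (y - x)]enormB mul1r ler_norml.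
by move=> h1 h2; apply/andP; split; lra.
Qed.

Lemma measurable_rho O : measurable_fun setT (rho O).
Proof.
apply: continuous_measurable_rV.
exact: (enorm_lipschitz_continuous (@rho_lipschitz O)).
Qed.

Lemma rho_gt0 O x : open O -> O <> setT -> O x -> 0 < rho O x.
Proof.
(* Without a frontier point [rho] would take the default value 0 of [inf]. *)
move=> oO OT Ox; have fn := frontier_nonempty oO OT Ox.
have [r r0 rO] := nbhs_box (oO _ Ox).
rewrite lt_neqAle rho_ge0 andbT; apply/negP => /eqP rx.
have [y [_ Oy] xy] : exists2 y, frontier O y & enorm (x - y) < r.
  by apply: rho_lt => //; rewrite -rx.
apply: Oy; apply: (oO y); apply: rO => i.
by apply: le_lt_trans xy; have := ge_enorm (x - y) i; rewrite !mxE.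
Qed.

End boundary_distance.

(** * The boundary as a Lipschitz graph in rotated coordinates *)

Section orthogonal.
Variable R : realType.

Lemma enorm_mxE n (x : 'rV[R]_n) : enorm x ^+ 2 = (x *m x^T) ord0 ord0.
Proof. by rewrite enorm_sqr mxE; apply: eq_bigr => i _; rewrite mxE expr2. Qed.

Lemma enorm_orthogonal n (Q : 'M[R]_n) (x : 'rV[R]_n) :
  Q *m Q^T = 1%:M -> enorm (x *m Q) = enorm x.
Proof.
move=> QQ; apply/eqP; rewrite -(@eqrXn2 _ 2)// ?enorm_ge0//; apply/eqP.
by rewrite !enorm_mxE trmx_mul mulmxA -(mulmxA x) QQ mulmx1.
Qed.

Lemma enorm_sqr_last n (v : 'rV[R]_n.+1) :
  enorm v ^+ 2 = enorm (col' ord_max v) ^+ 2 + v ord0 ord_max ^+ 2.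
Proof.
rewrite !enorm_sqr big_ord_recr/=; congr (_ + _); apply: eq_bigr => i _.
rewrite mxE; congr (v _ _ ^+ 2); apply: val_inj => /=.
by rewrite /bump leqNgt ltn_ord.
Qed.

Lemma enorm_col'_le n (v : 'rV[R]_n.+1) : enorm (col' ord_max v) <= enorm v.
Proof.
rewrite -(@ler_pXn2r _ 2)// ?nnegrE ?enorm_ge0// [leRHS]enorm_sqr_last lerDl.
exact: sqr_ge0.
Qed.

Lemma row_col'B n (u v : 'rV[R]_n.+1) :
  col' ord_max (u - v) = col' ord_max u - col' ord_max v.
Proof. by apply/rowP => i; rewrite !mxE. Qed.

Lemma enorm_le_last n (v : 'rV[R]_n.+1) :
  enorm v <= enorm (col' ord_max v) + `|v ord0 ord_max|.
Proof.
rewrite -(@ler_pXn2r _ 2)// ?nnegrE ?addr_ge0 ?enorm_ge0// enorm_sqr_last sqrrD.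
rewrite real_normK ?num_real// -addrA [X in _ <= _ + X]addrC addrA lerDl.
by rewrite mulrn_wge0// mulr_ge0// enorm_ge0.
Qed.

End orthogonal.

Section boundary_graph.
Variables (R : realType) (n : nat) (O : set 'rV[R]_n.+1).
Variables (z : 'rV[R]_n.+1) (Q : 'M[R]_n.+1) (phi : 'rV[R]_n -> R) (r0 L : R).
Hypotheses (oO : open O) (QQ : Q *m Q^T = 1%:M).
Hypothesis phiL : forall x y, `|phi x - phi y| <= L * enorm (x - y).
Hypothesis graph : forall x, enorm (x - z) < r0 ->
  let y := (x - z) *m Q in O x <-> phi (col' ord_max y) < y ord0 ord_max.
Hypothesis L0 : 0 <= L.

Let v (x : 'rV[R]_n.+1) := (x - z) *m Q.

Lemma enorm_coords x y : enorm (v x - v y) = enorm (x - y).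
Proof.
by rewrite /v -mulmxBl enorm_orthogonal// opprB addrA subrK.
Qed.

(** A point strictly above the graph lies in [O], hence in its interior. Strictly below it, [D] is
    positive at [y] and, having Lipschitz constant [L + 1], stays nonnegative within distance [e],
    so no point of [O] comes near [y]. *)
Lemma frontier_graph y : frontier O y -> enorm (y - z) < r0 ->
  v y ord0 ord_max = phi (col' ord_max (v y)).
Proof.
move=> [cy Oy] yz.
have {}Oy : ~ O y by move=> Oy'; apply: Oy; exact: (oO Oy').
apply/eqP; rewrite eq_le; apply/andP; split.
  by rewrite leNgt; apply/negP => h; apply: Oy; apply/(graph yz).
rewrite leNgt; apply/negP => h.
pose D x := phi (col' ord_max (v x)) - v x ord0 ord_max.
have Dy : 0 < D y by rewrite subr_gt0.
pose e := minr (D y / (L + 1)) (r0 - enorm (y - z)).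
have L1 : 0 < L + 1 by rewrite ltr_wpDl.
have e0 : 0 < e by rewrite lt_min divr_gt0//= subr_gt0.
have sd0 : 0 < Num.sqrt n.+1%:R + 1 :> R by rewrite ltr_wpDl// sqrtr_ge0.
have [x [Ox xy]] := cy _ (box_nbhs y (divr_gt0 e0 sd0)).
have {}xy : enorm (y - x) < e.
  apply: (@le_lt_trans _ _ (Num.sqrt n.+1%:R * (e / (Num.sqrt n.+1%:R + 1)))).
    apply: enorm_le_box => [|i]; first by rewrite ltW// divr_gt0.
    by rewrite !mxE ltW//; exact: xy.
  by rewrite mulrA ltr_pdivrMr// [ltRHS]mulrC ltr_pM2r// ltrDl.
have xz : enorm (x - z) < r0.
  apply: le_lt_trans (ler_enorm_trans y _ _) _; rewrite enormB -ltrBrDr.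
  by apply: lt_le_trans xy _; rewrite ge_min lexx orbT.
have := (graph xz).1 Ox; rewrite -/(v x) -subr_lt0 -/(D x).
apply/negP; rewrite -leNgt.
have DL : `|D y - D x| <= (L + 1) * enorm (y - x).
  rewrite /D (_ : _ - _ = (phi (col' ord_max (v y)) - phi (col' ord_max (v x))) -
     (v y - v x) ord0 ord_max); last by rewrite !mxE; ring.
  apply: le_trans (ler_normB _ _) _; rewrite mulrDl mul1r; apply: lerD.
    apply: le_trans (phiL _ _) _; rewrite ler_wpM2l//.
    by rewrite -(enorm_coords y x) -row_col'B; exact: enorm_col'_le.
  by rewrite -(enorm_coords y x); exact: ge_enorm.
have : (L + 1) * enorm (y - x) < D y.
  rewrite mulrC -ltr_pdivlMr//; apply: lt_le_trans xy _.
  by rewrite ge_min lexx.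
by move: DL; rewrite ler_norml => /andP[_]; lra.
Qed.

(** The height difference of two frontier points is a difference of values of [phi], controlled by
    their tangential distance. *)
Lemma frontier_graph_lipschitz x y : frontier O x -> frontier O y ->
  enorm (x - z) < r0 -> enorm (y - z) < r0 ->
  enorm (x - y) <= (1 + L) * enorm (col' ord_max (v x) - col' ord_max (v y)).
Proof.
move=> fx fy xz yz; rewrite -(enorm_coords x y).
apply: le_trans (enorm_le_last _) _; rewrite row_col'B mulrDl mul1r lerD2l.
rewrite mxE [X in _ + X]mxE frontier_graph// frontier_graph//; exact: phiL.
Qed.

End boundary_graph.

(** * Volume of the boundary layer *)

Section minkowski.
Variables (R : realType) (n : nat).
Local Notation mu := (lebesgue_rV R n.+1).

Lemma measure_finite_cover (A : set 'rV[R]_n.+1) (I : finType)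
    (F : I -> set 'rV[R]_n.+1) (c : R) :
  measurable A -> (forall i, measurable (F i)) -> 0 <= c ->
  (forall i, mu (F i) <= c%:E)%E -> A `<=` \bigcup_i F i ->
  (mu A <= (#|I|%:R * c)%:E)%E.
Proof.
move=> mA mF c0 Fc AF.
have fI : finite_set [set: I] by exact: finite_finset.
have := content_sub_fsum mu fI (fun i _ => mF i) mA AF => /le_trans; apply.
rewrite fsbig_finite//.
have /le_trans := @lee_sum R I (fun i => mu (F i)) (fun=> c%:E) (finmap.enum_fset (fset_set [set: I])) xpredT (fun i _ => Fc i).
apply.
rewrite sumEFin lee_fin big_const_seq iter_addr addr0 count_predT -[leLHS]mulr_natl.
rewrite ler_wpM2r// ler_nat cardE uniq_leq_size// => [|i _]; last by rewrite mem_enum.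
exact: finmap.fset_uniq.
Qed.

(* The boundary is a Lipschitz graph near each of its points, so the frontier
   points at distance [r] are covered by [O((r / eps) ^ n)] boxes of size [eps]:
   one for each cell of a grid of mesh [eps] in the tangent hyperplane that
   contains the projection of some frontier point. *)
Lemma boundary_layer (O : set 'rV[R]_n.+1) (beta : R) :
  open O -> O <> setT -> C1beta_domain beta O ->
  exists eta C : R, [/\ 0 < eta, 0 < C & forall z r eps, 0 < eps -> eps <= r -> r <= eta ->
    (mu [set x | O x /\ box z r x /\ (rho O x < eps)%R] <= (C * r ^+ n * eps)%:E)%E].
Proof.
move=> oO OT [r0 [L [r00 HL]]].
pose L1 := maxr L 0.
have L10 : 0 <= L1 by rewrite le_max lexx orbT.
pose sd := Num.sqrt n.+1%:R : R.
have sd0 : 0 <= sd by exact: sqrtr_ge0.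
(* Along the chain [y], [x], [z], [x1], [y1] two steps are shorter than [eps <= r] and two stay in a
   box, at most [sd * r] each. So the frontier points in use lie within [K * r] of [y1], and the
   choice of [eta] keeps [K * r < r0]. *)
pose K := 2 + 2 * sd.
have K0 : 0 < K by rewrite ltr_pwDl// mulr_ge0.
(* Distance, in units of [eps], from a point of the layer to the representative frontier point: 1 to
   a nearby frontier point, then [(1 + L1) * sqrt n] along the graph within one cell. *)
pose ka := 1 + (1 + L1) * Num.sqrt n%:R.
have ka0 : 0 < ka by rewrite ltr_pwDl// mulr_ge0// ?addr_ge0// sqrtr_ge0.
exists (r0 / (2 * K)), ((2 * K + 1) ^+ n * (2 * ka) ^+ n.+1).
split; [by rewrite divr_gt0// mulr_gt0 | by rewrite mulr_gt0// exprn_gt0// ?mulr_gt0//  addr_gt0// mulr_gt0|].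
move=> z r eps eps0 epsr reta.
have rp : 0 < r by exact: lt_le_trans epsr.
have mO : measurable O by exact: open_measurable_rV.
set A := [set x | _].
have mA : measurable A.
  rewrite (_ : A = O `&` (box z r `&` (rho O @^-1` `]-oo, eps[%classic))).
    apply: measurableI => //; apply: measurableI; first exact: measurable_box.
    by rewrite -[X in measurable X]setTI; exact: (measurable_rho O measurableT (measurable_itv _)).
  by apply/seteqP; split => x /=; rewrite in_itv.
have [[x1 [Ox1 [zx1 rx1]]]|A0] := pselect (A !=set0); last first.
  rewrite (_ : A = set0); last by apply/seteqP; split => // x Ax; apply: A0; exists x.
  by rewrite measure0 lee_fin !mulr_ge0 ?exprn_ge0 ?ltW// ?mulr_gt0// addr_gt0// mulr_gt0.
have fn : frontier O !=set0 by exact: frontier_nonempty Ox1.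
have [y1 fy1 xy1] := rho_lt fn rx1.
(* A single chart, centred at the frontier point [y1], serves for the whole of [A]. *)
have [Q [phi [QQ _ [dphi gphi] _ graph]]] := HL _ fy1.
have phiL := grad_lipschitz dphi (fun x => le_trans (gphi x) (_ : L <= L1)).
have LL1 : L <= L1 by rewrite le_max lexx.
have {}phiL := phiL LL1.
pose v (x : 'rV[R]_n.+1) := (x - y1) *m Q.
pose w x := col' ord_max (v x).
have Kr : K * r < r0.
  apply: le_lt_trans (ler_wpM2l (ltW K0) reta) _.
  by rewrite invfM mulrCA mulrA mulrACA divff ?gt_eqF// mulr1 ltr_pdivrMr// ltr_pMr// ltr1n.
have box_enorm (a b : 'rV[R]_n.+1) (e : R) : 0 <= e -> box a e b -> enorm (a - b) <= sd * e.
  by move=> e0 ab; apply: enorm_le_box => // i; rewrite !mxE ltW//; exact: ab.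
have near x y : A x -> enorm (x - y) < eps -> enorm (y - y1) < K * r.
  move=> [Ox [zx rx]] xy.
  have h1 := box_enorm _ _ _ (ltW rp) zx; have h2 := box_enorm _ _ _ (ltW rp) zx1.
  have h3 := ler_enorm_trans x y y1; have h4 := ler_enorm_trans z x y1.
  have h5 := ler_enorm_trans x1 z y1.
  rewrite (enormB x z) in h4; rewrite (enormB y x) in h3.
  rewrite /K mulrDl -mulrA; lra.
(* Tangential coordinates lie in [[- K * r, K * r]]; shifted by [K * r] they fall into at most [N]
   intervals of length [eps] per axis. *)
pose N := (Num.truncn (2 * K * r / eps)).+1.
have NE : N%:R <= (2 * K + 1) * r / eps.
  rewrite (_ : _ / eps = 2 * K * r / eps + r / eps); last by ring.
  rewrite /N -natr1; apply: lerD; last by rewrite ler_pdivlMr// mul1r.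
  by rewrite truncn_le// divr_ge0 ?mulr_ge0// ltW.
pose cell (y : 'rV[R]_n.+1) (Z : {ffun 'I_n -> 'I_N}) :=
  forall i, Num.truncn ((w y ord0 i + K * r) / eps) = Z i :> nat.
pose ok Z y := [/\ frontier O y, enorm (y - y1) < r0,
  forall i, 0 <= w y ord0 i + K * r & cell y Z].
pose rep (Z : {ffun 'I_n -> 'I_N}) : 'rV[R]_n.+1 := get (ok Z).
have := @measure_finite_cover A _ (fun Z => box (rep Z) (ka * eps)) ((2 * (ka * eps)) ^+ n.+1) mA.
move=> /(_ (fun Z => @measurable_box R n.+1 _ _)).
have ke0 : 0 <= ka * eps by rewrite mulr_ge0// ltW.
move=> H; apply: le_trans (H _ _ _) _.
- by rewrite exprn_ge0// mulr_ge0.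
- by move=> Z; rewrite lebesgue_rV_box_radius.
- move=> x Ax; have [Ox [zx rx]] := Ax.
  have [y fy xy] := rho_lt fn rx.
  have yK := near _ _ Ax xy; have yr0 : enorm (y - y1) < r0 by exact: lt_trans Kr.
  have wy i : `|w y ord0 i| <= K * r.
    apply: le_trans (ge_enorm _ _) _; apply: le_trans (enorm_col'_le _) _.
    by rewrite enorm_orthogonal// ltW.
  have cN i : (Num.truncn ((w y ord0 i + K * r) / eps) < N)%N.
    rewrite ltnS le_truncn// ler_wpM2r ?invr_ge0 ?(ltW eps0)//.
    by have := wy i; rewrite ler_norml => /andP[]; lra.
  pose Z := [ffun i => Ordinal (cN i)].
  have wy0 i : 0 <= w y ord0 i + K * r.
    by have := wy i; rewrite ler_norml => /andP[]; lra.
  have yZ : ok Z y by split => // i; rewrite ffunE.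
  have [frep rr0 wrep crep] : ok Z (rep Z) by exact: (getPex (ex_intro _ y yZ)).
  exists Z => // i.
  have wi j : `|(w (rep Z) - w y) ord0 j| <= eps.
    have := crep j; rewrite ffunE/= => e1.
    have /truncn_itv/andP[] : 0 <= (w (rep Z) ord0 j + K * r) / eps.
      by rewrite divr_ge0// ltW.
    have /truncn_itv/andP[] : 0 <= (w y ord0 j + K * r) / eps by rewrite divr_ge0// ltW.
    rewrite e1; move: (Num.truncn _) => k; rewrite -natr1.
    rewrite !ler_pdivlMr// !ltr_pdivrMr// => h1 h2 h3 h4.
    by rewrite mxE [X in _ + X]mxE ler_norml; apply/andP; split; lra.
  have := @frontier_graph_lipschitz R n O y1 Q phi r0 L1 oO QQ phiL graph L10 (rep Z) y frep fy rr0 yr0.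
  have /(enorm_le_box (ltW eps0)) h1 := wi.
  move=> h2; have h3 := ler_enorm_trans y (rep Z) x.
  have := ge_enorm (rep Z - x) i; rewrite !mxE => /le_lt_trans; apply.
  apply: le_lt_trans h3 _; rewrite (enormB y x) /ka mulrDl mul1r addrC ltr_leD//.
  apply: le_trans h2 _; rewrite -mulrA ler_wpM2l// addr_ge0//.
rewrite card_ffun !card_ord lee_fin natrX.
apply: (@le_trans _ _ (((2 * K + 1) * r / eps) ^+ n * (2 * (ka * eps)) ^+ n.+1)).
  rewrite ler_wpM2r ?exprn_ge0// ?(mulr_ge0 _ ke0)//; apply: lerXn2r => //.
    by rewrite nnegrE.
  by rewrite nnegrE; exact: le_trans NE.
rewrite [(2 * (ka * eps))]mulrA !exprMn exprVn [eps ^+ n.+1]exprS.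
rewrite le_eqVlt; apply/orP; left; apply/eqP; field.
by rewrite expf_neq0// gt_eqF.
Qed.

End minkowski.

(** * Gaussian averages of powers of the distance *)

Section gauss_average.
Variables (R : realType) (d : nat).
Local Notation mu := (lebesgue_rV R d).
Local Notation E := 'rV[R]_d.

Definition close_pairs (r : R) : set (E * E) := [set z | box z.1 r z.2].

Lemma measurable_close_pairs r : measurable (close_pairs r).
Proof.
rewrite (_ : close_pairs r = \bigcap_(i in [set: 'I_d])
    (fun z : E * E => `|z.1 ord0 i - z.2 ord0 i|) @^-1` `]-oo, r[%classic); last first.
  apply/seteqP; split => [z H i _|z H i]; first by rewrite /= in_itv/=; exact: H.
  by have := H i I; rewrite /= in_itv.
apply: fin_bigcap_measurable => // i _; rewrite -[X in measurable X]setTI.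
have m : measurable_fun setT (fun z : E * E => `|z.1 ord0 i - z.2 ord0 i|).
  apply: measurableT_comp => //; apply: measurable_funB.
    exact: (measurableT_comp (measurable_rV_coord i) measurable_fst).
  exact: (measurableT_comp (measurable_rV_coord i) measurable_snd).
exact: (m measurableT _ (measurable_itv _)).
Qed.

(** From [|x - z|^2 <= 2 |x - y|^2 + 2 |z - y|^2]: moving the point by less than [r] per coordinate
    costs a doubled variance. *)
Lemma gauss_near s r (x y z : E) : 0 < s -> 0 <= r -> box z r y ->
  gauss s (x - y) <=
  2 `^ (d%:R / 2) * expR (d%:R * r ^+ 2 / (2 * s)) * gauss (2 * s) (x - z).
Proof.
move=> s0 r0 zy.
have zyd : enorm (z - y) ^+ 2 <= d%:R * r ^+ 2.
  have h : enorm (z - y) <= Num.sqrt d%:R * r.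
    by apply: enorm_le_box => // i; rewrite !mxE ltW//; exact: zy.
  rewrite -[X in X * _](@sqr_sqrtr _ d%:R)// -exprMn.
  by rewrite ler_pXn2r ?nnegrE ?enorm_ge0// mulr_ge0// sqrtr_ge0.
have tri : enorm (x - z) ^+ 2 <= 2 * enorm (x - y) ^+ 2 + 2 * enorm (z - y) ^+ 2.
  have := ler_enorm_trans y x z; rewrite (enormB y z).
  have := enorm_ge0 (x - y); have := enorm_ge0 (z - y); have := enorm_ge0 (x - z).
  move: (enorm (x - y)) (enorm (z - y)) (enorm (x - z)) => a b c c0 b0 a0 h.
  have h1 : c ^+ 2 <= (a + b) ^+ 2 by rewrite ler_pXn2r ?nnegrE// addr_ge0.
  have h2 := sqr_ge0 (a - b); move: h1 h2; rewrite sqrrD sqrrB; lra.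
rewrite /gauss (_ : 2 * pi * (2 * s) = 2 * (2 * pi * s)); last by ring.
rewrite [(2 * (2 * pi * s)) `^ _]powRM ?mulr_ge0 ?pi_ge0 ?(ltW s0)//.
rewrite (_ : _ * expR (d%:R * _ / _) * _ = (2 `^ (d%:R / 2) * 2 `^ (- (d%:R / 2))) *
  ((2 * pi * s) `^ (- (d%:R / 2)) * (expR (d%:R * r ^+ 2 / (2 * s)) *
  expR (- (enorm (x - z) ^+ 2 / (2 * (2 * s))))))); last by ring.
have -> : 2 `^ (d%:R / 2) * 2 `^ (- (d%:R / 2)) = 1 :> R.
  by rewrite powRN mulfV// gt_eqF// powR_gt0.
rewrite mul1r ler_wpM2l ?powR_ge0//.
rewrite -expRD ler_expR -subr_ge0.
rewrite (_ : _ - _ = (2 * enorm (x - y) ^+ 2 + 2 * (d%:R * r ^+ 2) - enorm (x - z) ^+ 2) / (4 * s)).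
  have s40 : 0 <= 4 * s by rewrite mulr_ge0// ltW.
  by apply: divr_ge0 s40; lra.
by field; rewrite gt_eqF.
Qed.

(** The factor [(2 r)^d] is the volume of the box around [y]. Written as an integral over [z] and
    exchanged, it lets the Gaussian at [y] be replaced by one at [z], so that only integrals of [F]
    over boxes remain. *)
Lemma gauss_box_average s r (F : E -> R) (M : R) (x : E) : 0 < s -> 0 < r ->
  measurable_fun setT F -> (forall y, 0 <= F y) -> 0 <= M ->
  (forall z, \int[mu]_(y in box z r) (F y)%:E <= M%:E)%E ->
  (((2 * r) ^+ d)%:E * \int[mu]_y (gauss s (x - y)%R * F y)%:E <=
   (2 `^ (d%:R / 2) * expR (d%:R * r ^+ 2 / (2 * s)) * M)%:E)%E.
Proof.
move=> s0 r0 mF F0 M0 HM.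
set K := 2 `^ _ * expR _; have K0 : 0 <= K by rewrite mulr_ge0 ?powR_ge0 ?expR_ge0.
have mg : measurable_fun setT (fun y : E => gauss s (x - y)).
  by under eq_fun do rewrite gaussB; exact: measurable_gaussB.
have g0 y : 0 <= gauss s (x - y) * F y by rewrite mulr_ge0 ?gauss_ge0.
have mgF := measurable_funM mg mF.
have d0 : 0 <= (2 * r) ^+ d by rewrite exprn_ge0// mulr_ge0// ltW.
have ind_close y z : \1_(close_pairs r) (y, z) = \1_(box y r) z :> R.
  by rewrite !indicE; congr (_%:R); congr nat_of_bool.
have mi y : measurable_fun setT (\1_(box y r) : E -> R).
  by apply: measurable_indic; exact: measurable_box.
have i0 y z : 0 <= \1_(box y r) z :> R by rewrite indicE ler0n.
pose H (p : E * E) : \bar R := (gauss s (x - p.1) * F p.1 * \1_(close_pairs r) p)%:E.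
have H0 p : (0 <= H p)%E by rewrite lee_fin mulr_ge0// indicE ler0n.
have mH : measurable_fun setT H.
  apply/measurable_EFinP; apply: measurable_funM; last first.
    by apply: measurable_indic; exact: measurable_close_pairs.
  exact: (measurableT_comp mgF measurable_fst).
have -> : (((2 * r) ^+ d)%:E * \int[mu]_y (gauss s (x - y)%R * F y)%:E =
    \int[mu]_y \int[mu]_z H (y, z))%E.
  rewrite -ge0_integralZl_real//; apply: eq_integral => y _.
  have E1 : (\int[mu]_z H (y, z) = \int[mu]_z ((gauss s (x - y) * F y) * \1_(box y r) z)%:E)%E.
    by apply: eq_integral => z _; rewrite /H ind_close.
  rewrite E1 ge0_integralZl_real//.
  rewrite integral_indic//; last exact: measurable_box.
  rewrite setIT [X in (_ * X)%E](_ : _ = ((2 * r) ^+ d)%:E); last first.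
    exact: (lebesgue_rV_box_radius y (ltW r0)).
  by rewrite -EFinM mulrC.
rewrite (fubini_tonelli (m1 := mu) (m2 := mu) H)//.
apply: (@le_trans _ _ (\int[mu]_z ((K * M) * gauss (2 * s) (z - x))%:E)%E); last first.
  have mgx := measurable_gaussB (2 * s) x.
  have gx0 z : 0 <= gauss (2 * s) (z - x) by exact: gauss_ge0.
  rewrite ge0_integralZl_real ?mulr_ge0//.
  by rewrite integral_gauss ?mulr_gt0// mule1.
apply: ge0_le_integral => //.
- by move=> z _; exact: integral_ge0.
- exact: (measurable_fun_fubini_tonelli_G (m1 := mu) H).
- by apply/measurable_EFinP; apply: measurable_funM => //; exact: measurable_gaussB.
move=> z _.
apply: (@le_trans _ _ (\int[mu]_y ((K * gauss (2 * s) (x - z)) * (F y * \1_(box z r) y))%:E)%E).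
  apply: ge0_le_integral => //.
  - exact: (measurableT_comp mH (measurable_pair2 z)).
  - apply/measurable_EFinP; apply: measurable_funM => //; exact: measurable_funM.
  move=> y _; rewrite /H lee_fin.
  have -> : \1_(close_pairs r) (y, z) = \1_(box z r) y :> R.
    rewrite ind_close !indicE; congr (_%:R); congr nat_of_bool.
    by apply/idP/idP => /set_mem h; apply/mem_set => i; rewrite distrC; exact: h.
  rewrite indicE; case: (boolP (y \in _)) => [/set_mem zy|_]; last by rewrite !mulr0.
  rewrite !mulr1 ler_wpM2r//; apply: gauss_near => //; exact: ltW.
have mFi : measurable_fun setT (fun y => F y * \1_(box z r) y) by exact: measurable_funM.
have Fi0 y : 0 <= F y * \1_(box z r) y by rewrite mulr_ge0.
have Kg0 : 0 <= K * gauss (2 * s) (x - z) by apply: mulr_ge0 => //; exact: gauss_ge0.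
rewrite ge0_integralZl_real//.
rewrite (_ : K * M * _ = K * gauss (2 * s) (x - z) * M); last by rewrite gaussB; ring.
rewrite [leRHS]EFinM; apply: lee_wpmul2l; first by rewrite lee_fin mulr_ge0 ?gauss_ge0.
apply: le_trans (HM z); rewrite [leRHS]integral_mkcond.
rewrite le_eqVlt; apply/orP; left; apply/eqP; apply: eq_integral => y _.
by rewrite /patch indicE; case: ifP => _; rewrite ?mulr1 ?mulr0.
Qed.

End gauss_average.

Lemma geometric_partial_sum_le (R : realType) (q : R) N : 0 <= q -> q < 1 ->
  \sum_(0 <= k < N) q ^+ k <= (1 - q)^-1.
Proof.
move=> q0 q1; have q10 : 0 < 1 - q by rewrite subr_gt0.
rewrite -[leRHS]div1r ler_pdivlMr// mulrC.
suff -> : (1 - q) * \sum_(0 <= k < N) q ^+ k = 1 - q ^+ N.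
  by rewrite gerBl exprn_ge0.
elim: N => [|N IH]; first by rewrite big_nil mulr0 expr0 subrr.
by rewrite big_nat_recr//= mulrDr IH exprS; ring.
Qed.

Lemma powR_opp_le (R : realType) (a x g : R) : 0 < a -> a <= x -> 0 <= g ->
  x `^ (- g) <= a `^ (- g).
Proof.
move=> a0 ax g0; have x0 := lt_le_trans a0 ax.
rewrite !powRN lef_pV2 ?posrE ?powR_gt0//.
by apply: ge0_ler_powR => //; rewrite nnegrE ltW.
Qed.

(** * Negative powers of [mt]: integrals over boxes and Gaussian averages *)

Section mt_integral.
Variables (R : realType) (n : nat) (O : set 'rV[R]_n.+1).
Local Notation mu := (lebesgue_rV R n.+1).
Local Notation E := 'rV[R]_n.+1.
Hypotheses (oO : open O) (OT : O <> setT).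

Lemma mt_le1 t (x : E) : mt O t x <= 1.
Proof. by rewrite /mt ge_min lexx. Qed.

Lemma mt_gt0 t x : 0 < t -> O x -> 0 < mt O t x.
Proof. by move=> t0 Ox; rewrite /mt lt_min ltr01 divr_gt0 ?rho_gt0 ?sqrtr_gt0. Qed.

Lemma mt_ge0 t (x : E) : 0 <= mt O t x.
Proof. by rewrite /mt le_min ler01 divr_ge0 ?rho_ge0 ?sqrtr_ge0. Qed.

Lemma measurable_mt t : measurable_fun setT (@mt R n.+1 O t).
Proof.
apply: measurable_minr => //; apply: measurable_funM => //; exact: measurable_rho.
Qed.

Definition mt_weight (t gam : R) (y : E) : R := \1_O y * mt O t y `^ (- gam).

Lemma mt_weight_ge0 t gam y : 0 <= mt_weight t gam y.
Proof. by rewrite mulr_ge0 ?powR_ge0// indicE ler0n. Qed.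

Lemma measurable_mt_weight t gam : measurable_fun setT (mt_weight t gam).
Proof.
apply: measurable_funM.
  by apply: measurable_indic; exact: open_measurable_rV.
exact: (measurableT_comp (measurable_powR (- gam)) (measurable_mt t)).
Qed.

Variables (eta C gam : R).
Hypotheses (eta0 : 0 < eta) (C0 : 0 < C) (gam0 : 0 <= gam) (gam1 : gam < 1).
Hypothesis layer : forall z r eps, 0 < eps -> eps <= r -> r <= eta ->
  (mu [set x | O x /\ box z r x /\ (rho O x < eps)%R] <= (C * r ^+ n * eps)%:E)%E.

(** Box size in units of [sqrt t]: it keeps [theta * sqrt t] at most [eta] for [t <= 1]. It is
    unrelated to the exponent of the weight. *)
Let theta := minr 1 eta.
Let b : R := 2 `^ gam.
Let A z r k : set E := [set x | O x /\ box z r x /\ rho O x < r / 2 ^+ k].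

Let theta0 : 0 < theta. Proof. by rewrite lt_min ltr01. Qed.

Let measurable_A z r k : measurable (A z r k).
Proof.
rewrite (_ : A z r k = O `&` (box z r `&` (rho O @^-1` `]-oo, (r / 2 ^+ k)[%classic))).
  apply: measurableI; first exact: open_measurable_rV.
  apply: measurableI; first exact: measurable_box.
  by rewrite -[X in measurable X]setTI; exact: (measurable_rho O measurableT (measurable_itv _)).
by apply/seteqP; split => x /=; rewrite in_itv.
Qed.

(** Dyadic layers: if [r / 2^(k+1) <= rho < r / 2^k], then [mt] is at least [theta / 2^(k+1)] and
    its power [- gam] is at most the [k]-th term, as [b = 2^gam]. The constant term serves the
    points with [rho >= r]. *)
Lemma mt_weight_le_layers t z y : 0 < t -> let r := theta * Num.sqrt t in
  box z r y -> ((mt_weight t gam y)%:E <= (theta `^ (- gam))%:E +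
    \sum_(0 <= k <oo) (theta `^ (- gam) * b ^+ k.+1 * \1_(A z r k) y)%:E)%E.
Proof.
move=> t0 r zy; have st0 : 0 < Num.sqrt t by rewrite sqrtr_gt0.
have r0 : 0 < r by rewrite mulr_gt0.
have th1 : theta <= 1 by rewrite ge_min lexx.
have b0 : 0 <= b by exact: powR_ge0.
have pos k : (0 <= (theta `^ (- gam) * b ^+ k.+1 * \1_(A z r k) y)%:E)%E.
  by rewrite lee_fin !mulr_ge0 ?powR_ge0 ?exprn_ge0// indicE ler0n.
have [Oy|Oy] := pselect (O y); last first.
  rewrite /mt_weight indicE memNset// mul0r adde_ge0 ?lee_fin ?powR_ge0//.
  exact: nneseries_ge0.
rewrite /mt_weight indicE mem_set// mul1r.
have mtge a : 0 < a -> a <= 1 -> a * r <= rho O y -> a * theta <= mt O t y.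
  move=> a0 a1 h; rewrite /mt le_min; apply/andP; split.
    by rewrite mulr_ile1 ?(ltW a0) ?(ltW theta0).
  by rewrite ler_pdivlMr// -mulrA.
have [ry|ry] := leP r (rho O y).
  rewrite -[leLHS]adde0 leeD ?nneseries_ge0// lee_fin; apply: powR_opp_le => //.
  by rewrite -[leLHS]mul1r; apply: mtge => //; rewrite mul1r.
have ry0 : 0 < rho O y by exact: rho_gt0.
have exj : exists j, r / 2 ^+ j <= rho O y.
  pose N := (Num.truncn (r / rho O y)).+1; exists N.
  have NR : r / rho O y < N%:R by exact: truncnS_gt.
  rewrite ler_pdivrMr ?exprn_gt0// mulrC -ler_pdivrMr//.
  apply: (@le_trans _ _ N%:R); first exact: ltW.
  by rewrite -natrX ler_nat ltnW// ltn_expl.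
(* The layer of [y] is found from the least [m] with [r / 2^m <= rho]; [m = 0] is the case already
   settled. *)
have [m Pm mmin] := ex_minnP exj.
case: m Pm mmin => [|k] Pm mmin.
  by move: Pm; rewrite expr0 divr1 leNgt ry.
have yk : A z r k y.
  split => //; split => //; rewrite ltNge; apply/negP => /mmin.
  by rewrite ltnn.
pose a : R := (2 ^+ k.+1)^-1.
have a0 : 0 < a by rewrite invr_gt0 exprn_gt0.
have a1 : a <= 1 by rewrite invf_le1 ?exprn_gt0// exprn_ege1// ler1n.
have am : a * theta <= mt O t y by apply: mtge => //; rewrite mulrC.
have ab : a `^ (- gam) = b ^+ k.+1.
  have E2 : 2 ^+ k.+1 = 2 `^ k.+1%:R :> R by rewrite powR_mulrn.
  rewrite /a /b E2 -powRN -powRrM -[RHS]powR_mulrn ?powR_ge0//.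
  by rewrite -powRrM; congr (_ `^ _); ring.
apply: (@le_trans _ _ (theta `^ (- gam) * b ^+ k.+1 * \1_(A z r k) y)%:E).
  rewrite indicE mem_set// mulr1 lee_fin -ab mulrC -powRM ?(ltW a0) ?(ltW theta0)//.
  by apply: powR_opp_le => //; rewrite mulr_gt0.
apply: (@le_trans _ _ (\sum_(0 <= k <oo) (theta `^ (- gam) * b ^+ k.+1 * \1_(A z r k) y)%:E)%E); last first.
  by rewrite leeDr// lee_fin powR_ge0.
apply: le_trans (nneseries_lim_ge (P := xpredT) k.+1 (fun n _ _ => pos n)).
by rewrite big_nat_recr//= leeDr// sume_ge0.
Qed.

(** The [k]-th layer has volume at most [C r^n r / 2^k], against a weight of order [2^(gam k)]: a
    geometric series of ratio [b / 2 = 2^(gam - 1)], convergent because [gam < 1]. *)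
Lemma mt_weight_box t z : 0 < t -> t <= 1 ->
  (\int[mu]_(y in box z (theta * Num.sqrt t)) (mt_weight t gam y)%:E <=
   (theta `^ (- gam) * (2 ^+ n.+1 + b * C / (1 - b / 2)) *
    (theta * Num.sqrt t) ^+ n.+1)%:E)%E.
Proof.
move=> t0 t1; set r := theta * Num.sqrt t; have st0 : 0 < Num.sqrt t by rewrite sqrtr_gt0.
have r0 : 0 < r by rewrite mulr_gt0.
have st1 : Num.sqrt t <= 1 by rewrite -sqrtr1 ler_wsqrtr.
have reta : r <= eta.
  apply: (@le_trans _ _ theta); last by rewrite ge_min lexx orbT.
  by rewrite ler_piMr// ltW.
have b0 : 0 < b by rewrite powR_gt0.
have q0 : 0 <= b / 2 by rewrite divr_ge0// ltW.
have q1 : b / 2 < 1.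
  rewrite ltr_pdivrMr// mul1r.
  have -> : 2 = b * 2 `^ (1 - gam) :> R.
    by rewrite /b -powRD ?subrKC ?powRr1// pnatr_eq0 implybT.
  rewrite ltr_pMr// -[ltLHS](_ : 1 `^ (1 - gam) = 1); last by rewrite powR1.
  by apply: gt0_ltr_powR; rewrite ?subr_gt0 ?nnegrE ?ltr1n.
have th0 : 0 <= theta `^ (- gam) by exact: powR_ge0.
have c0 k : 0 <= theta `^ (- gam) * b ^+ k.+1 by rewrite mulr_ge0// exprn_ge0// ltW.
have mA k : measurable_fun (box z r) (\1_(A z r k) : E -> R).
  by apply: measurable_indic; exact: measurable_A.
have mD : measurable (box z r) by exact: measurable_box.
have i0 k y : 0 <= \1_(A z r k) y :> R by rewrite indicE ler0n.
have mF k : measurable_fun (box z r) (fun y => (theta `^ (- gam) * b ^+ k.+1 * \1_(A z r k) y)%:E).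
  by apply/measurable_EFinP; apply: measurable_funM.
have F0 k y : box z r y -> (0 <= (theta `^ (- gam) * b ^+ k.+1 * \1_(A z r k) y)%:E)%E.
  by move=> _; rewrite lee_fin mulr_ge0.
have mS : measurable_fun (box z r) (fun y =>
    \sum_(0 <= k <oo) (theta `^ (- gam) * b ^+ k.+1 * \1_(A z r k) y)%:E)%E.
  by apply: (ge0_emeasurable_sum (P := xpredT)) => // k y By _; exact: F0.
have S0 y : box z r y -> (0 <= \sum_(0 <= k <oo) (theta `^ (- gam) * b ^+ k.+1 * \1_(A z r k) y)%:E)%E.
  by move=> By; apply: nneseries_ge0 => k _ _; exact: F0.
apply: (@le_trans _ _ (\int[mu]_(y in box z r) ((theta `^ (- gam))%:E +
    \sum_(0 <= k <oo) (theta `^ (- gam) * b ^+ k.+1 * \1_(A z r k) y)%:E))%E).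
  apply: ge0_le_integral => //.
  - by move=> y _; rewrite lee_fin mt_weight_ge0.
  - by apply/measurable_EFinP; apply: measurable_funTS; exact: measurable_mt_weight.
  - exact: emeasurable_funD.
  - by move=> y By; exact: mt_weight_le_layers.
rewrite ge0_integralD//.
rewrite integral_cst// integral_nneseries//.
have -> : theta `^ (- gam) * (2 ^+ n.+1 + b * C / (1 - b / 2)) * r ^+ n.+1 =
  theta `^ (- gam) * (2 * r) ^+ n.+1 + theta `^ (- gam) * b * C * r ^+ n.+1 * (1 - b / 2)^-1.
  rewrite [(2 * r) ^+ _]exprMn; move: (2 ^+ n.+1) (r ^+ n.+1) (theta `^ _) => u1 u2 u3.
  by ring.
rewrite EFinD; apply: leeD.
  rewrite [leRHS]EFinM; apply: lee_wpmul2l; first by rewrite lee_fin.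
  by rewrite le_eqVlt; apply/orP; left; apply/eqP; exact: (lebesgue_rV_box_radius z (ltW r0)).
have K0 : 0 <= theta `^ (- gam) * b * C * r ^+ n.+1.
  by rewrite !mulr_ge0 ?exprn_ge0 ?(ltW b0) ?(ltW C0) ?(ltW r0).
have term k : (\int[mu]_(y in box z r) (theta `^ (- gam) * b ^+ k.+1 * \1_(A z r k) y)%:E <=
    (theta `^ (- gam) * b * C * r ^+ n.+1 * (b / 2) ^+ k)%:E)%E.
  rewrite ge0_integralZl_real// integral_indic//.
  apply: (@le_trans _ _ ((theta `^ (- gam) * b ^+ k.+1)%:E * (C * r ^+ n * (r / 2 ^+ k))%:E)%E).
    apply: lee_wpmul2l; first by rewrite lee_fin.
    apply: (@le_trans _ _ (mu (A z r k))).
      apply: le_measure => [||y []//]; rewrite inE; last exact: measurable_A.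
      by apply: measurableI => //; exact: measurable_A.
    apply: layer => //; first by rewrite divr_gt0// exprn_gt0.
    by rewrite ler_pdivrMr ?exprn_gt0// ler_peMr ?(ltW r0)// exprn_ege1// ler1n.
  rewrite -EFinM lee_fin le_eqVlt; apply/orP; left; apply/eqP.
  by rewrite !exprS expr_div_n; field; rewrite expf_neq0.
apply: lime_le; first by apply: is_cvg_nneseries => k _ _; apply: integral_ge0; exact: F0.
apply: nearW => N; apply: (@le_trans _ _ (\sum_(0 <= k < N)
    (theta `^ (- gam) * b * C * r ^+ n.+1 * (b / 2) ^+ k)%:E)%E).
  by apply: lee_sum => k _; exact: term.
rewrite sumEFin lee_fin -mulr_sumr ler_wpM2l//.
exact: geometric_partial_sum_le.
Qed.

End mt_integral.

(** Boxes of size [th * sqrt t] match the Gaussian scale: the exponential loss, a function of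
    [r^2 / t], is free of [t], and [r^(n+1)] cancels against the box volume. *)
Lemma gauss_mt_bound (R : realType) n (O : set 'rV[R]_n.+1) (beta gam tau : R) :
  open O -> O <> setT -> C1beta_domain beta O -> 0 <= gam -> gam < 1 -> 0 < tau ->
  exists2 A : R, 0 < A & forall t x, 0 < t -> t <= 1 ->
    (\int[lebesgue_rV R n.+1]_y (gauss (tau * t) (x - y)%R * mt_weight O t gam y)%:E
      <= A%:E)%E.
Proof.
move=> oO OT dO g0 g1 tau0.
have [eta [C [eta0 C0 layer]]] := boundary_layer oO OT dO.
pose th := minr 1 eta; have th0 : 0 < th by rewrite lt_min ltr01.
pose b : R := 2 `^ gam.
pose M := th `^ (- gam) * (2 ^+ n.+1 + b * C / (1 - b / 2)).
pose K := 2 `^ (n.+1%:R / 2) * expR (n.+1%:R * th ^+ 2 / (2 * tau)).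
have K0 : 0 <= K by rewrite mulr_ge0 ?powR_ge0 ?expR_ge0.
exists (K * `|M| + 1) => [|t x t0 t1]; first by rewrite ltr_wpDl// mulr_ge0.
have st0 : 0 < Num.sqrt t by rewrite sqrtr_gt0.
pose r := th * Num.sqrt t; have r0 : 0 < r by rewrite mulr_gt0.
have rn0 : 0 < r ^+ n.+1 by rewrite exprn_gt0.
have box_le z : (\int[lebesgue_rV R n.+1]_(y in box z r) (mt_weight O t gam y)%:E <=
    (`|M| * r ^+ n.+1)%:E)%E.
  apply: le_trans (mt_weight_box oO OT eta0 C0 g0 g1 layer z t0 t1) _.
  by rewrite lee_fin ler_wpM2r ?(ltW rn0)// ler_norm.
have tt0 : 0 < tau * t by rewrite mulr_gt0.
have M0 : 0 <= `|M| * r ^+ n.+1 by rewrite mulr_ge0// ltW.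
have := gauss_box_average x tt0 r0 (measurable_mt_weight oO t gam)
  (mt_weight_ge0 O t gam) M0 box_le.
have -> : n.+1%:R * r ^+ 2 / (2 * (tau * t)) = n.+1%:R * th ^+ 2 / (2 * tau).
  by rewrite /r exprMn sqr_sqrtr ?(ltW t0)//; field; rewrite !gt_eqF.
rewrite -/K => H.
have d0 : 0 < (2 * r) ^+ n.+1 by rewrite exprn_gt0// mulr_gt0.
rewrite -(@lee_pmul2l _ ((2 * r) ^+ n.+1)%:E)//; apply: le_trans H _.
rewrite -EFinM lee_fin [(2 * r) ^+ _]exprMn.
have two1 : 1 <= 2 ^+ n.+1 :> R by rewrite exprn_ege1// ler1n.
have KM0 : 0 <= K * `|M| by rewrite mulr_ge0.
move: rn0 two1; move: (r ^+ n.+1) (2 ^+ n.+1) => u1 u2 u10 u2p.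
rewrite mulrA (_ : u2 * u1 * _ = u2 * (K * `|M| + 1) * u1); last by ring.
rewrite ler_pM2r//; apply: (@le_trans _ _ (K * `|M| + 1)); first by rewrite lerDl.
by rewrite ler_peMl// addr_ge0.
Qed.

Lemma powR_expR_bound (R : realType) (a c : R) : 0 <= a -> 0 < c ->
  exists2 K : R, 0 < K & forall N, 0 <= N -> (1 + N) `^ a <= K * expR (N / (4 * c)).
Proof.
(* Chosen so that [e * (a + 1) = 1 / (4 c)]; [a + 1] in place of [a] keeps it meaningful at
   [a = 0]. *)
move=> a0 c0; pose e := (4 * c * (a + 1))^-1.
have a10 : 0 < a + 1 by rewrite ltr_wpDl.
have e0 : 0 < e by rewrite invr_gt0 !mulr_gt0.
pose k := maxr 1 e^-1.
have k0 : 0 < k by rewrite lt_max ltr01.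
exists (k `^ a) => [|N N0]; first exact: powR_gt0.
have h : 1 + N <= k * expR (e * N).
  apply: (@le_trans _ _ (k * (1 + e * N))); last first.
    by rewrite ler_wpM2l ?(ltW k0)// expR_ge1Dx.
  rewrite mulrDr mulr1 mulrA; apply: lerD; first by rewrite le_max lexx.
  rewrite ler_peMl// -(@mulVf _ e) ?gt_eqF// ler_wpM2r ?(ltW e0)//.
  by rewrite le_max lexx orbT.
apply: (@le_trans _ _ ((k * expR (e * N)) `^ a)).
  by apply: ge0_ler_powR => //; rewrite nnegrE ?addr_ge0// mulr_ge0 ?(ltW k0)// expR_ge0.
rewrite powRM ?expR_ge0 ?(ltW k0)// ler_wpM2l ?powR_ge0//.
rewrite -expRM ler_expR.
rewrite (_ : N / (4 * c) = e * N * (a + 1)); last first.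
  by rewrite /e; field; rewrite !gt_eqF.
by rewrite ler_wpM2l ?mulr_ge0 ?(ltW e0)// lerDl.
Qed.

(** Half of the exponent is set aside to absorb polynomial factors; the other half is a Gaussian of
    twice the variance. *)
Lemma gauss_double (R : realType) d s (z : 'rV[R]_d) : 0 < s ->
  gauss s z = 2 `^ (d%:R / 2) * expR (- (enorm z ^+ 2 / (4 * s))) * gauss (2 * s) z.
Proof.
move=> s0; rewrite /gauss (_ : 2 * pi * (2 * s) = 2 * (2 * pi * s)); last by ring.
rewrite [(2 * (2 * pi * s)) `^ _]powRM ?mulr_ge0 ?pi_ge0 ?(ltW s0)//.
have c2 : 2 `^ (d%:R / 2) * 2 `^ (- (d%:R / 2)) = 1 :> R.
  by rewrite powRN mulfV// gt_eqF// powR_gt0.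
have -> : expR (- (enorm z ^+ 2 / (2 * s))) =
    expR (- (enorm z ^+ 2 / (4 * s))) * expR (- (enorm z ^+ 2 / (2 * (2 * s)))).
  by rewrite -expRD; congr expR; field; rewrite gt_eqF.
by rewrite -[LHS]mul1r -[X in X * _ = _]c2; ring.
Qed.

(** * Moving the weights from [x] to [y] across a Gaussian *)

Section weights.
Variables (R : realType) (n : nat) (O : set 'rV[R]_n.+1).
Local Notation E := 'rV[R]_n.+1.
Variables (theta delta tau : R).
Hypotheses (th0 : 0 <= theta) (de0 : 0 <= delta) (tau0 : 0 < tau).

Lemma wdelta_gt0 (x : E) : 0 < wdelta delta x.
Proof. by rewrite powR_gt0// ltr_pwDl// sqr_ge0. Qed.

Lemma wdelta_le1 (x : E) : wdelta delta x <= 1.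
Proof.
rewrite -[leRHS](_ : 1 `^ (- delta) = 1); last by rewrite powR1.
apply: powR_opp_le => //.
by rewrite lerDl sqr_ge0.
Qed.

Lemma measurable_wdelta : measurable_fun setT (@wdelta R n.+1 delta).
Proof.
apply: (measurableT_comp (measurable_powR (- delta))).
by apply: measurable_funD => //; apply: measurable_funX; exact: measurable_enorm.
Qed.

Lemma measurable_wtheta : measurable_fun setT (wtheta_delta O theta delta).
Proof.
apply: measurable_minr; last exact: measurable_wdelta.
exact: (measurableT_comp (measurable_powR theta) (measurable_rho O)).
Qed.

Lemma wtheta_ge0 x : 0 <= wtheta_delta O theta delta x.
Proof. by rewrite le_min powR_ge0 ltW// wdelta_gt0. Qed.

Lemma wtheta_gt0 x : open O -> O <> setT -> O x -> 0 < wtheta_delta O theta delta x.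
Proof. by move=> oO OT Ox; rewrite lt_min wdelta_gt0 andbT powR_gt0// rho_gt0. Qed.

Lemma wtheta_le_wdelta x : wtheta_delta O theta delta x <= wdelta delta x.
Proof. by rewrite ge_min lexx orbT. Qed.

(* Peetre's inequality and the Gaussian decay. *)
Lemma wdelta_gauss : exists2 C : R, 0 < C & forall t (x y : E), 0 < t -> t <= 1 ->
  wdelta delta x * gauss (tau * t) (x - y) <=
  C * wdelta delta y * gauss (2 * (tau * t)) (x - y).
Proof.
have [K K0 HK] := powR_expR_bound de0 tau0.
exists (2 `^ delta * K * 2 `^ (n.+1%:R / 2)).
  by rewrite !mulr_gt0 ?powR_gt0.
move=> t x y t0 t1; have tt0 : 0 < tau * t by rewrite mulr_gt0.
rewrite gauss_double//; set N := enorm (x - y) ^+ 2.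
have N0 : 0 <= N by exact: sqr_ge0.
set g := gauss _ _; have g0 : 0 <= g by exact: gauss_ge0.
clearbody g.
have x1 : 0 < 1 + enorm x ^+ 2 by rewrite ltr_pwDl// sqr_ge0.
have y1 : 0 < 1 + enorm y ^+ 2 by rewrite ltr_pwDl// sqr_ge0.
have tri : 1 + enorm y ^+ 2 <= 2 * (1 + N) * (1 + enorm x ^+ 2).
  have := ler_enorm_trans x y 0; rewrite !subr0 (enormB y x).
  rewrite /N; have := enorm_ge0 x; have := enorm_ge0 y; have := enorm_ge0 (x - y).
  move: (enorm x) (enorm y) (enorm (x - y)) => a b c c0 b0 a0 h.
  have h1 : b ^+ 2 <= (c + a) ^+ 2 by rewrite ler_pXn2r ?nnegrE// addr_ge0.
  have h2 := sqr_ge0 (a - c); have h3 : 0 <= c ^+ 2 * a ^+ 2 by rewrite mulr_ge0 ?sqr_ge0.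
  move: h1 h2 h3; rewrite !sqrrD sqrrN; nra.
have peetre : wdelta delta x <= 2 `^ delta * (1 + N) `^ delta * wdelta delta y.
  rewrite /wdelta !powRN -[leRHS]mulrC ler_pdivlMl ?powR_gt0//.
  rewrite ler_pdivrMr ?powR_gt0// -!powRM ?(ltW x1) ?addr_ge0//.
    by apply: ge0_ler_powR => //; rewrite nnegrE ?mulr_ge0 ?addr_ge0 ?sqr_ge0.
  by rewrite mulr_ge0// addr_ge0.
(* Here [t <= 1] enters: [N / (4 tau t)] is at least [N / (4 tau)]. *)
have E1 : (1 + N) `^ delta * expR (- (N / (4 * (tau * t)))) <= K.
  apply: (@le_trans _ _ ((1 + N) `^ delta * expR (- (N / (4 * tau))))).
    rewrite ler_wpM2l ?powR_ge0// ler_expR lerN2 ler_wpM2l//.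
    rewrite lef_pV2 ?posrE ?mulr_gt0// ler_wpM2l//.
    by rewrite ler_piMr// ltW.
  by rewrite expRN ler_pdivrMr ?expR_gt0//; exact: HK.
rewrite [leLHS](_ : _ = wdelta delta x * 2 `^ (n.+1%:R / 2) *
  expR (- (N / (4 * (tau * t)))) * g); last by ring.
rewrite ler_wpM2r//.
apply: (@le_trans _ _ (2 `^ delta * (1 + N) `^ delta * wdelta delta y *
    2 `^ (n.+1%:R / 2) * expR (- (N / (4 * (tau * t)))))).
  by rewrite ler_wpM2r ?expR_ge0// ler_wpM2r ?powR_ge0.
rewrite (_ : _ * expR _ = 2 `^ delta * 2 `^ (n.+1%:R / 2) * wdelta delta y *
   ((1 + N) `^ delta * expR (- (N / (4 * (tau * t)))))); last by ring.
rewrite (_ : _ * K * _ * _ = 2 `^ delta * 2 `^ (n.+1%:R / 2) * wdelta delta y * K); last by ring.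
by rewrite ler_wpM2l// !mulr_ge0 ?powR_ge0.
Qed.

(** With [D = |x - y|], [rho x <= rho y + D] and [mt] at most both 1 and [rho y / sqrt t], the
    product [rho x * mt] is at most [rho y * (1 + D / sqrt t)]. The Gaussian of variance [tau t]
    absorbs powers of [D / sqrt t] uniformly in [t]. *)
Lemma rho_gauss : exists2 C : R, 0 < C & forall t (x y : E), 0 < t -> t <= 1 ->
  rho O x `^ theta * gauss (tau * t) (x - y) * mt O t y `^ theta <=
  C * rho O y `^ theta * gauss (2 * (tau * t)) (x - y).
Proof.
have [K K0 HK] := powR_expR_bound th0 tau0.
exists (2 `^ theta * K * 2 `^ (n.+1%:R / 2)).
  by rewrite !mulr_gt0 ?powR_gt0.
move=> t x y t0 t1; have tt0 : 0 < tau * t by rewrite mulr_gt0.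
have st0 : 0 < Num.sqrt t by rewrite sqrtr_gt0.
rewrite gauss_double//; set D := enorm (x - y).
have D0 : 0 <= D by exact: enorm_ge0.
set g := gauss _ _; have g0 : 0 <= g by exact: gauss_ge0.
clearbody g.
pose u := D / Num.sqrt t; have u0 : 0 <= u by rewrite divr_ge0// ltW.
have prod : rho O x * mt O t y <= rho O y * (2 * (1 + u ^+ 2)).
  have rx : rho O x <= rho O y + D.
    by have := rho_lipschitz O x y; rewrite mul1r ler_norml => /andP[_]; rewrite -/D; lra.
  apply: (@le_trans _ _ ((rho O y + D) * mt O t y)); first by rewrite ler_wpM2r ?mt_ge0.
  rewrite mulrDl; apply: (@le_trans _ _ (rho O y * 1 + D * (rho O y / Num.sqrt t))).
    apply: lerD; rewrite ler_wpM2l ?rho_ge0//; first exact: mt_le1.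
    by rewrite /mt ge_min lexx orbT.
  rewrite (_ : _ + _ = rho O y * (1 + u)); last by rewrite /u; ring.
  rewrite ler_wpM2l ?rho_ge0//; have := sqr_ge0 (u - 1); rewrite sqrrB; nra.
have E1 : (1 + u ^+ 2) `^ theta * expR (- (D ^+ 2 / (4 * (tau * t)))) <= K.
  rewrite expRN ler_pdivrMr ?expR_gt0//.
  rewrite (_ : D ^+ 2 / (4 * (tau * t)) = u ^+ 2 / (4 * tau)); first exact: HK (sqr_ge0 _).
  have -> : u ^+ 2 = D ^+ 2 / t.
    by rewrite /u expr_div_n (sqr_sqrtr (ltW t0)).
  by field; rewrite !gt_eqF.
apply: (@le_trans _ _ ((rho O x * mt O t y) `^ theta * (2 `^ (n.+1%:R / 2) *
    expR (- (D ^+ 2 / (4 * (tau * t)))) * g))).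
  by rewrite powRM ?rho_ge0 ?mt_ge0// le_eqVlt; apply/orP; left; apply/eqP; ring.
apply: (@le_trans _ _ ((rho O y * (2 * (1 + u ^+ 2))) `^ theta * (2 `^ (n.+1%:R / 2) *
    expR (- (D ^+ 2 / (4 * (tau * t)))) * g))).
  rewrite ler_wpM2r ?mulr_ge0 ?powR_ge0 ?expR_ge0//.
  by apply: ge0_ler_powR => //; rewrite nnegrE !mulr_ge0 ?rho_ge0 ?mt_ge0 ?addr_ge0 ?sqr_ge0.
rewrite powRM ?rho_ge0 ?mulr_ge0 ?addr_ge0 ?sqr_ge0// powRM ?addr_ge0 ?sqr_ge0//.
rewrite (_ : _ * (_ * expR _ * g) = 2 `^ theta * 2 `^ (n.+1%:R / 2) * rho O y `^ theta * g *
   ((1 + u ^+ 2) `^ theta * expR (- (D ^+ 2 / (4 * (tau * t)))))); last by ring.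
rewrite (_ : _ * K * _ * _ * _ = 2 `^ theta * 2 `^ (n.+1%:R / 2) * rho O y `^ theta * g * K); last by ring.
by rewrite ler_wpM2l// !mulr_ge0 ?powR_ge0.
Qed.

End weights.

(** * Schur test *)

Section weights_comparison.
Variables (R : realType) (n : nat) (O : set 'rV[R]_n.+1).
Local Notation E := 'rV[R]_n.+1.
Variables (theta delta tau : R).
Hypotheses (th0 : 0 <= theta) (de0 : 0 <= delta) (tau0 : 0 < tau).

Lemma mt_powR_le1 t (y : E) : mt O t y `^ theta <= 1.
Proof.
rewrite -[leRHS](_ : 1 `^ theta = 1); last by rewrite powR1.
by apply: ge0_ler_powR; rewrite ?nnegrE ?mt_ge0 ?mt_le1.
Qed.

Lemma wtheta_gauss : exists2 C : R, 0 < C & forall t (x y : E), 0 < t -> t <= 1 ->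
  wtheta_delta O theta delta x * gauss (tau * t) (x - y) * mt O t y `^ theta <=
  C * wtheta_delta O theta delta y * gauss (2 * (tau * t)) (x - y).
Proof.
have [C1 C10 H1] := rho_gauss O th0 tau0.
have [C2 C20 H2] := @wdelta_gauss R n delta tau de0 tau0.
exists (maxr C1 C2) => [|t x y t0 t1]; first by rewrite lt_max C10.
have g0 : 0 <= gauss (tau * t) (x - y) by exact: gauss_ge0.
have gg0 : 0 <= gauss (2 * (tau * t)) (x - y) by exact: gauss_ge0.
have m0 : 0 <= mt O t y `^ theta by exact: powR_ge0.
have h1 : wtheta_delta O theta delta x * gauss (tau * t) (x - y) * mt O t y `^ theta <=
    maxr C1 C2 * rho O y `^ theta * gauss (2 * (tau * t)) (x - y).
  apply: (@le_trans _ _ (rho O x `^ theta * gauss (tau * t) (x - y) * mt O t y `^ theta)).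
    by rewrite ler_wpM2r// ler_wpM2r// ge_min lexx.
  apply: le_trans (H1 _ _ _ t0 t1) _; rewrite ler_wpM2r// ler_wpM2r ?powR_ge0//.
  by rewrite le_max lexx.
have h2 : wtheta_delta O theta delta x * gauss (tau * t) (x - y) * mt O t y `^ theta <=
    maxr C1 C2 * wdelta delta y * gauss (2 * (tau * t)) (x - y).
  apply: (@le_trans _ _ (wdelta delta x * gauss (tau * t) (x - y) * 1)).
    apply: ler_pM => //; [by rewrite mulr_ge0 ?wtheta_ge0| |exact: mt_powR_le1].
    by rewrite ler_wpM2r// wtheta_le_wdelta.
  rewrite mulr1; apply: le_trans (H2 _ _ _ t0 t1) _; rewrite ler_wpM2r//.
  by rewrite ler_wpM2r ?(ltW (wdelta_gt0 _ _))// le_max lexx orbT.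
by rewrite {2}/wtheta_delta; case: (leP (rho O y `^ theta)).
Qed.

(** The kernel factor creates the boundary weight: at time 1, [mt] is at most both [rho] and 1, so
    its power [theta] times [wdelta] lies below both branches of the minimum. *)
Lemma wdelta_gauss_theta : exists2 C : R, 0 < C & forall x y : E,
  wdelta delta x * gauss (tau * 1) (x - y) * mt O 1 y `^ theta <=
  C * wtheta_delta O theta delta y * gauss (2 * (tau * 1)) (x - y).
Proof.
have [C C0 H] := @wdelta_gauss R n delta tau de0 tau0.
exists C => // x y; have := H 1 x y ltr01 (lexx _).
have gg0 : 0 <= gauss (2 * (tau * 1)) (x - y) by exact: gauss_ge0.
have m0 : 0 <= mt O 1 y `^ theta by exact: powR_ge0.
move=> h; apply: le_trans (ler_wpM2r m0 h) _.
rewrite mulrAC ler_wpM2r// -mulrA ler_wpM2l ?(ltW C0)//.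
rewrite le_min; apply/andP; split.
  rewrite -[leRHS]mul1r; apply: ler_pM => //; first exact: ltW (wdelta_gt0 _ _).
    exact: wdelta_le1.
  apply: ge0_ler_powR; rewrite ?nnegrE ?mt_ge0 ?rho_ge0//.
  by rewrite /mt sqrtr1 divr1 ge_min lexx orbT.
by rewrite ler_piMr ?(ltW (wdelta_gt0 _ _))// mt_powR_le1.
Qed.

End weights_comparison.

(** For [theta <= p], which includes [p = 1], the exponent 0 serves; otherwise
    [theta = p + gam (p - 1)] has its solution below 1 precisely because [theta < 2 p - 1]. *)
Lemma exists_layer_exponent (R : realType) (p theta : R) :
  1 <= p -> theta < 2 * p - 1 ->
  exists2 gam : R, 0 <= gam < 1 & theta <= p + gam * (p - 1).
Proof.
move=> p1 th; have [tp|pt] := leP theta p.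
  by exists 0; rewrite ?lexx ?ltr01// mul0r addr0.
have p10 : 0 < p - 1 by lra.
exists ((theta - p) / (p - 1)).
  by rewrite divr_ge0 ?(ltW p10) ?subr_ge0 ?(ltW pt)//= ltr_pdivrMr// mul1r; lra.
by rewrite divfK ?gt_eqF// subrKC.
Qed.

Section schur.
Variables (R : realType) (n : nat) (O : set 'rV[R]_n.+1).
Local Notation E := 'rV[R]_n.+1.
Local Notation mu := (lebesgue_rV R n.+1).
Variables (p theta gam t s A Cw : R) (W w f : E -> R).
Hypotheses (oO : open O) (OT : O <> setT) (t0 : 0 < t) (s0 : 0 < s).
Hypotheses (p1 : 1 <= p) (thg : theta <= p + gam * (p - 1)).
Hypotheses (mW : measurable_fun setT W) (W0 : forall x, 0 <= W x).
Hypotheses (mw : measurable_fun setT w) (w0 : forall x, 0 <= w x).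
Hypotheses (Cw0 : 0 <= Cw) (mf : measurable_fun O f).
Hypothesis HA : forall x,
  (\int[mu]_y (gauss s (x - y)%R * mt_weight O t gam y)%:E <= A%:E)%E.
Hypothesis HW : forall x y,
  W x * gauss s (x - y) * mt O t y `^ theta <= Cw * w y * gauss (2 * s) (x - y).

Let mO : measurable O. Proof. exact: open_measurable_rV. Qed.

Let fO := f \_ O.

Let mfO : measurable_fun setT fO.
Proof. by apply: (iffLR (measurable_restrictT _ mO)). Qed.

Let mgauss (r : R) x : measurable_fun setT (fun y : E => gauss r (x - y)).
Proof. by under eq_fun do rewrite gaussB; exact: measurable_gaussB. Qed.

Let mgauss2 (r : R) : measurable_fun setT (fun z : E * E => gauss r (z.1 - z.2)).
Proof.
apply: (measurableT_comp (measurable_gauss r)).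
apply: measurable_fun_rVP => i; under eq_fun do rewrite !mxE.
apply: measurable_funB.
  exact: (measurableT_comp (measurable_rV_coord i) measurable_fst).
exact: (measurableT_comp (measurable_rV_coord i) measurable_snd).
Qed.

(** Extended-valued, so that it makes sense before any convergence is known; finiteness almost
    everywhere will follow from the Schur bound itself. *)
Definition majorant (x : E) : \bar R :=
  (\int[mu]_(y in O) (mt O t y * gauss s (x - y)%R * `|f y|)%:E)%E.

Let h (y : E) : R := mt O t y `^ (1 + gam) * `|fO y|.
Let G (y : E) : R := \1_O y * mt O t y `^ theta * `|fO y| `^ p.

Let mh : measurable_fun setT h.
Proof.
apply: measurable_funM; last exact: measurableT_comp.
exact: (measurableT_comp (measurable_powR _) (measurable_mt O t)).
Qed.

Let mG : measurable_fun setT G.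
Proof.
apply: measurable_funM.
  apply: measurable_funM; first exact: measurable_indic.
  exact: (measurableT_comp (measurable_powR _) (measurable_mt O t)).
by apply: (measurableT_comp (measurable_powR p)); exact: measurableT_comp.
Qed.

Let G0 y : 0 <= G y.
Proof. by rewrite !mulr_ge0 ?powR_ge0// indicE ler0n. Qed.

(** Writing [mt = mt^(- gam) * mt^(1 + gam)], Jensen is applied to the density
    [gauss s * mt^(- gam)] of mass at most [A]. The resulting exponent
    [- gam + p (1 + gam) = p + gam (p - 1)] is at least [theta], and [mt <= 1]. *)
Let majorant_powR x :
  ((majorant x) `^ p <= (A `^ (p - 1))%:E * \int[mu]_y (gauss s (x - y)%R * G y)%:E)%E.
Proof.
have mw0 y : 0 <= mt_weight O t gam y by exact: mt_weight_ge0.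
have mmw : measurable_fun setT (mt_weight O t gam) by exact: measurable_mt_weight.
have -> : majorant x =
    (\int[mu]_y ((gauss s (x - y)%R * mt_weight O t gam y) * h y)%:E)%E.
  rewrite /majorant integral_mkcond; apply: eq_integral => y _.
  rewrite /patch /mt_weight /h /fO /patch indicE; case: ifPn => [/set_mem Oy|_]; last first.
    by rewrite mul0r mulr0 mul0r.
  congr EFin; have m0 := mt_gt0 oO OT t0 Oy.
  have e : mt O t y `^ (- gam) * mt O t y `^ (1 + gam) = mt O t y.
    rewrite -powRD; last by rewrite (gt_eqF m0) implybT.
    by rewrite (_ : - gam + (1 + gam) = 1) ?powRr1 ?(ltW m0)//; ring.
  rewrite -[in LHS]e mul1r; move: (gauss s (x - y)) => q.
  by rewrite [q * _]mulrC -!mulrA; congr (_ * _); rewrite mulrCA.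
have h0 y : 0 <= h y by rewrite mulr_ge0 ?powR_ge0.
have k0 y : 0 <= gauss s (x - y) * mt_weight O t gam y by rewrite mulr_ge0 ?gauss_ge0.
have mk : measurable_fun setT (fun y : E => gauss s (x - y) * mt_weight O t gam y).
  exact: measurable_funM.
apply: le_trans (integral_mul_powR_le mk mh k0 h0 p1 (HA x)) _.
apply: lee_wpmul2l; first by rewrite lee_fin powR_ge0.
apply: ge0_le_integral => //.
- by move=> y _; rewrite lee_fin mulr_ge0 ?powR_ge0.
- apply/measurable_EFinP; apply: measurable_funM => //.
  exact: (measurableT_comp (measurable_powR _) mh).
- by apply/measurable_EFinP; apply: measurable_funM.
move=> y _; rewrite lee_fin -mulrA ler_wpM2l ?gauss_ge0//.
rewrite /mt_weight /h /G indicE; case: (boolP (y \in O)) => [/set_mem Oy|_]; last by rewrite !mul0r.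
have m0 := mt_gt0 oO OT t0 Oy.
rewrite !mul1r powRM ?powR_ge0// mulrA ler_wpM2r ?powR_ge0//.
rewrite -powRrM -powRD; last by rewrite (gt_eqF m0) implybT.
apply: ger_powR; first by rewrite m0 mt_le1.
by rewrite (_ : - gam + _ = p + gam * (p - 1)) //; ring.
Qed.

Lemma measurable_majorant : measurable_fun O majorant.
Proof.
apply: (measurable_ge0_integral_section mu mO mO
  (g := fun z : E * E => (mt O t z.2 * gauss s (z.1 - z.2) * `|f z.2|)%:E)).
  apply/measurable_EFinP; apply: measurable_funM.
    apply: measurable_funTS; apply: measurable_funM => //.
    exact: (measurableT_comp (measurable_mt O t) measurable_snd).
  apply: measurableT_comp => //.
  have : measurable_fun (O `*` O) (fun z : E * E => fO z.2).
    by apply: measurable_funTS; exact: (measurableT_comp mfO measurable_snd).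
  apply: eq_measurable_fun => z /set_mem[_ Oz]; rewrite /fO /patch mem_set//.
move=> z _; rewrite lee_fin; apply: mulr_ge0 => //; apply: mulr_ge0; [exact: mt_ge0|exact: gauss_ge0].
Qed.

Lemma majorant_ge0 x : (0 <= majorant x)%E.
Proof. 
apply: integral_ge0 => y _; rewrite lee_fin; apply: mulr_ge0 => //.
by apply: mulr_ge0; [exact: mt_ge0|exact: gauss_ge0]. Qed.

(** After Jensen, [HW] moves the weight across the Gaussian, which integrates to 1 in [x]. The two
    weights are kept distinct: equal ones serve for [t <= 1], while [wdelta] on the left expresses
    the gain at time 1. *)
Lemma schur : (\int[mu]_(x in O) ((majorant x) `^ p * (W x)%:E) <=
  (A `^ (p - 1) * Cw)%:E * \int[mu]_(y in O) (`|f y| `^ p * w y)%:E)%E.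
Proof.
pose B x := (\int[mu]_y (gauss s (x - y)%R * G y)%:E)%E.
have gG0 (z : E * E) : (0 <= (gauss s (z.1 - z.2) * G z.2)%:E)%E.
  by rewrite lee_fin mulr_ge0 ?gauss_ge0.
have mgG : measurable_fun setT (fun z : E * E => (gauss s (z.1 - z.2) * G z.2)%:E).
  apply/measurable_EFinP; apply: measurable_funM => //.
  exact: (measurableT_comp mG measurable_snd).
have mB : measurable_fun setT B.
  exact: (measurable_fun_fubini_tonelli_F (m2 := mu) (fun z : E * E => (gauss s (z.1 - z.2) * G z.2)%:E)).
have B0 x : (0 <= B x)%E by apply: integral_ge0 => y _; rewrite lee_fin mulr_ge0 ?gauss_ge0.
have Ap0 : (0 <= (A `^ (p - 1))%:E)%E by rewrite lee_fin powR_ge0.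
pose H (z : E * E) := (Cw * (gauss (2 * s) (z.1 - z.2) * (\1_O z.2 * `|fO z.2| `^ p * w z.2)))%:E.
have H0 z : (0 <= H z)%E.
  by rewrite lee_fin !mulr_ge0 ?gauss_ge0 ?powR_ge0// indicE ler0n.
have mf1 : measurable_fun setT (fun y : E => \1_O y * `|fO y| `^ p * w y).
  apply: measurable_funM => //; apply: measurable_funM; first exact: measurable_indic.
  by apply: (measurableT_comp (measurable_powR p)); exact: measurableT_comp.
have f10 y : 0 <= \1_O y * `|fO y| `^ p * w y by rewrite !mulr_ge0 ?powR_ge0// indicE ler0n.
have mH : measurable_fun setT H.
  apply/measurable_EFinP; apply: measurable_funM => //; apply: measurable_funM => //.
  exact: (measurableT_comp mf1 measurable_snd).
apply: (@le_trans _ _ ((A `^ (p - 1))%:E * \int[mu]_x \int[mu]_y H (x, y))%E).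
  rewrite -ge0_integralZl//; last 2 first.
  - exact: (measurable_fun_fubini_tonelli_F (m2 := mu) H).
  - by move=> x _; exact: integral_ge0.
  rewrite [leLHS]integral_mkcond; apply: ge0_le_integral => //.
  - by move=> x _; rewrite /patch; case: ifP => // _; rewrite mule_ge0 ?poweR_ge0 ?lee_fin.
  - apply: (iffLR (measurable_restrictT _ mO)); apply: emeasurable_funM.
      exact: (measurableT_comp (measurable_poweR p) measurable_majorant).
    by apply/measurable_EFinP; exact: measurable_funTS.
  - apply: emeasurable_funM => //.
    exact: (measurable_fun_fubini_tonelli_F (m2 := mu) H).
  move=> x _; rewrite /patch; case: ifPn => _; last first.
    by rewrite mule_ge0// integral_ge0.
  apply: (@le_trans _ _ ((A `^ (p - 1))%:E * B x * (W x)%:E)%E).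
    by rewrite lee_wpmul2r ?lee_fin// majorant_powR.
  rewrite -muleA lee_wpmul2l// muleC -ge0_integralZl_real//; last 2 first.
  - exact: measurable_funM.
  - by move=> y _; rewrite mulr_ge0 ?gauss_ge0.
  apply: ge0_le_integral => //.
  - by move=> y _; rewrite lee_fin; apply: mulr_ge0 => //; apply: mulr_ge0; first exact: gauss_ge0.
  - by apply/measurable_EFinP; apply: measurable_funM => //; exact: measurable_funM.
  - exact: (measurableT_comp mH (measurable_pair1 x)).
  move=> y _; rewrite /H/= lee_fin /G.
  have := ler_wpM2r (_ : 0 <= \1_O y * `|fO y| `^ p) (HW x y).
  rewrite mulr_ge0 ?powR_ge0 ?indicE ?ler0n// => /(_ isT).
  by congr (_ <= _); ring.
rewrite EFinM -muleA lee_wpmul2l//.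
rewrite (fubini_tonelli (m1 := mu) (m2 := mu) H)//.
rewrite -ge0_integralZl_real//; last 2 first.
- apply: measurable_funM; last exact: measurable_funTS.
  by apply: (measurableT_comp (measurable_powR p)); exact: measurableT_comp.
- by move=> y _; rewrite mulr_ge0 ?powR_ge0.
rewrite [leRHS]integral_mkcond le_eqVlt; apply/orP; left; apply/eqP.
apply: eq_integral => y _; rewrite /H/=.
under eq_integral => x _.
  rewrite (_ : Cw * _ = (Cw * (\1_O y * `|fO y| `^ p * w y)) * gauss (2 * s) (x - y)); last by ring.
  over.
rewrite ge0_integralZl_real ?mulr_ge0//; last 2 first.
- exact: measurable_gaussB.
- by move=> x _; exact: gauss_ge0.
rewrite integral_gauss ?mulr_gt0// mule1 /fO /patch indicE.
by case: (boolP (y \in O)) => _; rewrite ?mul1r// !mul0r mulr0.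
Qed.

End schur.

(** * Kernel operators *)

(** Unless the positive and negative parts are both finite, their difference is infinite, and [fine]
    sends infinite values to 0. *)
Lemma Rintegral_not_integrable d (T : measurableType d) (R : realType)
    (mu : {measure set T -> \bar R}) (D : set T) (f : T -> R) :
  measurable D -> measurable_fun D f -> ~ mu.-integrable D (EFin \o f) ->
  \int[mu]_(x in D) f x = 0.
Proof.
move=> mD mf nif; have mEf : measurable_fun D (EFin \o f) by exact/measurable_EFinP.
rewrite /Rintegral integralE.
have P0 : (0 <= \int[mu]_(x in D) (EFin \o f)^\+ x)%E by exact: integral_ge0.
have N0 : (0 <= \int[mu]_(x in D) (EFin \o f)^\- x)%E by exact: integral_ge0.
have PN : (\int[mu]_(x in D) `|(EFin \o f) x| =
    \int[mu]_(x in D) (EFin \o f)^\+ x + \int[mu]_(x in D) (EFin \o f)^\- x)%E.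
  rewrite -ge0_integralD//; [|exact: measurable_funepos|exact: measurable_funeneg].
  by apply: eq_integral => x _; rewrite -/((abse \o (EFin \o f)) x) fune_abse.
move: P0 N0 PN.
case: (\int[mu]_(x in D) (EFin \o f)^\+ x)%E => [r| |] //.
  case: (\int[mu]_(x in D) (EFin \o f)^\- x)%E => [s| |] //= _ _ PN.
  by exfalso; apply: nif; apply/integrableP; split => //; rewrite PN ltry.
by case: (\int[mu]_(x in D) (EFin \o f)^\- x)%E => [s| |].
Qed.

Lemma RintegralZl_measurable d (T : measurableType d) (R : realType)
    (mu : {measure set T -> \bar R}) (D : set T) (k : R) (f : T -> R) :
  measurable D -> measurable_fun D f ->
  \int[mu]_(x in D) (k * f x) = k * \int[mu]_(x in D) f x.
Proof.
move=> mD mf; have [->|k0] := eqVneq k 0.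
  rewrite mul0r; under eq_Rintegral do rewrite mul0r.
  by rewrite /Rintegral integral0.
have [i_f|nif] := pselect (mu.-integrable D (EFin \o f)); first exact: RintegralZl.
rewrite (Rintegral_not_integrable mD mf nif) mulr0.
apply: Rintegral_not_integrable => //; first exact: measurable_funM.
move=> ikf; apply: nif; have := integrableZl mD k^-1 ikf.
by apply: eq_integrable => // x _; rewrite /= -EFinM mulrA mulVf// mul1r.
Qed.

(** * Fubini on a rectangle, for real-valued iterated integrals *)

Section fubini_rectangle.
Context d1 d2 (T1 : measurableType d1) (T2 : measurableType d2) (R : realType).
Variables (m1 : {sigma_finite_measure set T1 -> \bar R}).
Variables (m2 : {sigma_finite_measure set T2 -> \bar R}).
Variables (A : set T1) (B : set T2) (F : T1 * T2 -> R).
Hypotheses (mA : measurable A) (mB : measurable B).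
Hypothesis mF : measurable_fun (A `*` B) F.
Hypothesis Foo : (\int[m1]_(x in A) \int[m2]_(y in B) `|F (x, y)|%:E < +oo)%E.

Let f z := (EFin \o F \_ (A `*` B)) z.

Let fl x : A x -> (fun y => f (x, y)) = (fun y => (F (x, y))%:E) \_ B.
Proof.
move=> Ax; apply/funext => y; rewrite /f /= /patch.
case: ifPn => [/set_mem[_ By]|xy]; first by rewrite mem_set.
by case: ifPn => // /set_mem By; move/negP: xy; case; exact/mem_set.
Qed.

Let fr y : B y -> (fun x => f (x, y)) = (fun x => (F (x, y))%:E) \_ A.
Proof.
move=> By; apply/funext => x; rewrite /f /= /patch.
case: ifPn => [/set_mem[Ax _]|xy]; first by rewrite mem_set.
by case: ifPn => // /set_mem Ax; move/negP: xy; case; exact/mem_set.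
Qed.

Let f0l x : ~ A x -> (fun y => f (x, y)) = cst 0%E.
Proof.
move=> Ax; apply/funext => y; rewrite /f /= /patch.
by case: ifPn => // /set_mem[].
Qed.

Let f0r y : ~ B y -> (fun x => f (x, y)) = cst 0%E.
Proof.
move=> By; apply/funext => x; rewrite /f /= /patch.
by case: ifPn => // /set_mem[].
Qed.

Let intf : (m1 \x m2)%E.-integrable setT f.
Proof.
apply/integrable12ltyP.
  apply/measurable_EFinP; apply: (iffLR (measurable_restrictT _ _)) => //.
  exact: measurableX.
apply: le_lt_trans Foo; rewrite [leRHS]integral_mkcond le_eqVlt; apply/orP; left.
apply/eqP; apply: eq_integral => x _; rewrite /patch; case: ifPn => [/set_mem Ax|/negP Ax].
  rewrite [RHS]integral_mkcond; apply: eq_integral => y _.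
  by rewrite -[f (x, y)]/((fun y => f (x, y)) y) fl// /patch; case: ifP; rewrite ?normr0 ?abse0.
under eq_integral => y _.
  by rewrite -[f (x, y)]/((fun y => f (x, y)) y) f0l ?abse0; [over|move/mem_set].
by rewrite integral0.
Qed.

Let intG : m2.-integrable setT (fubini_G m1 f).
Proof.
have mf : measurable_fun setT f by case/integrableP: intf.
have mG := measurable_fubini_G intf.
apply/integrableP; split => //.
apply: le_lt_trans (iffLR (integrable21ltyP m1 m2 mf) intf).
apply: ge0_le_integral => //.
- exact: measurableT_comp.
- apply: (measurable_fun_fubini_tonelli_G (m1 := m1) (abse \o f)) => //=.
  exact: measurableT_comp.
move=> y _; apply: le_abse_integral => //.
exact: (measurableT_comp mf (measurable_pair2 y)).
Qed.

Lemma fubini_rect_integrable :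
  m2.-integrable B (fun y => (\int[m1]_(x in A) F (x, y))%:E).
Proof.
have iG : m2.-integrable B (fubini_G m1 f).
  by apply: (integrableS measurableT) => //; exact: intG.
have mG : measurable_fun B (fubini_G m1 f) by case/integrableP: iG.
have : m2.-integrable B (EFin \o fine \o fubini_G m1 f).
  apply: le_integrable iG => //.
    by apply/measurable_EFinP; apply: measurableT_comp; first exact: fine_measurable.
  by move=> y _ /=; case: (fubini_G m1 f y) => [r| |] //=; rewrite normr0 leey.
apply: eq_integrable => // y /set_mem By; rewrite /= /fubini_G /Rintegral fr//.
by rewrite -integral_mkcond.
Qed.

Lemma fubini_rect : \int[m1]_(x in A) (\int[m2]_(y in B) F (x, y)) =
  \int[m2]_(y in B) (\int[m1]_(x in A) F (x, y)).
Proof.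
congr fine.
have -> : (\int[m1]_(x in A) (\int[m2]_(y in B) F (x, y))%:E =
    \int[m1]_x \int[m2]_y f (x, y))%E.
  rewrite integral_mkcond.
  have -> : (fun x => (\int[m2]_(y in B) F (x, y))%R%:E) \_ A =
      EFin \o fine \o fubini_F m2 f.
    apply/funext => x; rewrite /patch /fubini_F /=; case: ifPn => [/set_mem Ax|/negP Ax].
      by rewrite fl// -integral_mkcond.
    by rewrite f0l ?integral0//; move/mem_set.
  (* [fine] alters the inner integral only where it is infinite, on a null set. *)
  have iF := integrable_fubini_F intf.
  apply: ae_eq_integral => //.
  - apply/measurable_EFinP; apply: measurableT_comp; first exact: fine_measurable.
    by case/integrableP: iF.
  - by case/integrableP: iF.
  by apply: filterS (integrable_ae measurableT iF) => x /(_ I) h _; rewrite /= fineK.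
have -> : (\int[m2]_(y in B) (\int[m1]_(x in A) F (x, y))%:E =
    \int[m2]_y \int[m1]_x f (x, y))%E.
  rewrite integral_mkcond.
  have -> : (fun y => (\int[m1]_(x in A) F (x, y))%R%:E) \_ B =
      EFin \o fine \o fubini_G m1 f.
    apply/funext => y; rewrite /patch /fubini_G /=; case: ifPn => [/set_mem By|/negP By].
      by rewrite fr// -integral_mkcond.
    by rewrite f0r ?integral0//; move/mem_set.
  have iG := intG.
  apply: ae_eq_integral => //.
  - apply/measurable_EFinP; apply: measurableT_comp; first exact: fine_measurable.
    by case/integrableP: iG.
  - by case/integrableP: iG.
  by apply: filterS (integrable_ae measurableT iG) => y /(_ I) h _; rewrite /= fineK.
exact: Fubini.
Qed.

End fubini_rectangle.

(** * Kernel operators on weighted L^p spaces *)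

Section Lp_operators.
Variables (R : realType) (d : nat) (O : set 'rV[R]_d).
Local Notation E := 'rV[R]_d.
Local Notation mu := (lebesgue_rV R d).
Hypothesis mO : measurable O.
Implicit Types (w f g : E -> R) (K : E -> E -> R).

Lemma kernel_op_linear K (k : R) f g x :
  kernel_defined_at O K f x -> kernel_defined_at O K g x ->
  kernel_op O K (fun y => k * f y + g y) x = k * kernel_op O K f x + kernel_op O K g x.
Proof.
move=> df dg; rewrite /kernel_op -(RintegralZl _ mO df) -RintegralD//.
  by apply: eq_Rintegral => y _; ring.
exact: (integrableZl mO k df).
Qed.

Lemma kernel_opZ K (k : R) f x : kernel_defined_at O K f x ->
  kernel_op O K (fun y => k * f y) x = k * kernel_op O K f x.
Proof.
move=> df; rewrite /kernel_op -(RintegralZl _ mO df).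
by apply: eq_Rintegral => y _; ring.
Qed.

Lemma measurable_Lp_integrand w p f : measurable_fun O w -> measurable_fun O f ->
  measurable_fun O (fun x => (`|f x| `^ p * w x)%:E).
Proof.
move=> mw mf; apply/measurable_EFinP; apply: measurable_funM => //.
by apply: (measurableT_comp (measurable_powR p)); exact: measurableT_comp.
Qed.

Lemma Lp_norm_ge0 w p f : (0 <= Lp_norm O w p f)%E.
Proof. exact: poweR_ge0. Qed.

Lemma Lp_norm_ae w p f g : measurable_fun O w -> measurable_fun O f -> measurable_fun O g ->
  {ae mu, forall x, O x -> f x = g x} -> Lp_norm O w p f = Lp_norm O w p g.
Proof.
move=> mw mf mg fg; rewrite /Lp_norm.
rewrite (@ae_eq_integral _ _ _ mu O _ _ mO (measurable_Lp_integrand p mw mf)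
  (measurable_Lp_integrand p mw mg))//.
by apply: filterS fg => x h Ox; rewrite h.
Qed.

Lemma Lp_normZ w p (k : R) f : 0 < p -> measurable_fun O w -> (forall x, 0 <= w x) ->
  measurable_fun O f -> Lp_norm O w p (fun x => k * f x) = (`|k|%:E * Lp_norm O w p f)%E.
Proof.
move=> p0 mw w0 mf; have /measurable_EFinP mI := measurable_Lp_integrand p mw mf.
have I0 x : O x -> 0 <= `|f x| `^ p * w x by rewrite mulr_ge0 ?powR_ge0.
have k0 : 0 <= `|k| `^ p by exact: powR_ge0.
rewrite /Lp_norm; under eq_integral => x _.
  by rewrite normrM powRM// -mulrA; over.
rewrite ge0_integralZl_real//.
rewrite poweRM ?lee_fin ?powR_ge0//; last first.
  by apply: integral_ge0 => x _; rewrite lee_fin mulr_ge0 ?powR_ge0.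
by rewrite poweR_EFin -powRrM mulfV ?gt_eqF// powRr1.
Qed.

Lemma kernel_op_norm_le_intro w p K (B : R) : 0 <= B ->
  (forall f, in_Lp O w p f ->
    [/\ {ae mu, forall x, O x -> kernel_defined_at O K f x},
        measurable_fun O (kernel_op O K f) &
        (Lp_norm O w p (kernel_op O K f) <= B%:E * Lp_norm O w p f)%E]) ->
  kernel_op_norm_le O w p K B.
Proof.
move=> B0 H.
have op : (op_norm O w p (kernel_op O K) <= B%:E)%E.
  apply: ge_ereal_sup => _ [f [Lf f1] <-]; have [_ _ h] := H f Lf.
  by apply: le_trans h _; rewrite -[leRHS]mule1 lee_wpmul2l.
split; [by move=> f /H[]| |exact: op].
split; last exact: le_lt_trans op (ltry _).
- move=> f Lf; have [_ mK h] := H f Lf; split; first exact: mK.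
  by apply: le_lt_trans h (lte_mul_pinfty _ _ Lf.2); rewrite ?lee_fin.
move=> k f g Lf Lg; have [df _ _] := H f Lf; have [dg _ _] := H g Lg.
by apply: filterS2 df dg => x df dg Ox; rewrite kernel_op_linear//; [exact: df|exact: dg].
Qed.

Lemma kernel_op_norm_le_elim w p K (B : R) f : 0 < B -> 0 < p ->
  measurable_fun O w -> (forall x, 0 <= w x) ->
  kernel_op_norm_le O w p K B -> in_Lp O w p f ->
  (Lp_norm O w p (kernel_op O K f) <= B%:E * Lp_norm O w p f)%E.
Proof.
move=> B0 p0 mw w0 [Kdef [KLp _ _] KB] Lf.
have [mf foo] := Lf; have [mKf _] := KLp _ Lf.
have fE : Lp_norm O w p f \is a fin_num by rewrite ge0_fin_numE ?Lp_norm_ge0.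
set N := fine (Lp_norm O w p f).
have N0 : 0 <= N by rewrite fine_ge0 ?Lp_norm_ge0.
apply/lee_addgt0Pr => e e0.
(* Normalising by [N + e / B] instead of the norm [N] allows [N = 0]; the surplus contributes
   exactly [e], which is arbitrary. *)
have r0 : 0 < N + e / B by rewrite ltr_wpDl ?divr_gt0.
set r := N + e / B in r0.
have -> : (B%:E * Lp_norm O w p f + e%:E = r%:E * B%:E)%E.
  rewrite -(fineK fE) -/N -EFinM -EFinD -EFinM; congr EFin.
  by rewrite /r; field; rewrite gt_eqF.
pose g y := r^-1 * f y.
have mg : measurable_fun O g by exact: measurable_funM.
have gN : Lp_norm O w p g = (r^-1%:E * Lp_norm O w p f)%E.
  by rewrite Lp_normZ// ger0_norm// invr_ge0 ltW.
have Lg : in_Lp O w p g.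
  have r1 : (0 <= r^-1%:E)%E by rewrite lee_fin invr_ge0 ltW.
  by split; [exact: mg|rewrite gN; exact: lte_mul_pinfty].
have g1 : (Lp_norm O w p g <= 1)%E.
  rewrite gN -(fineK fE) -/N -EFinM lee_fin mulrC ler_pdivrMr// mul1r /r.
  by rewrite lerDl divr_ge0// ltW.
have [mKg _] := KLp _ Lg.
have := le_trans (ereal_sup_ubound (ex_intro2 _ _ g (conj Lg g1) erefl)) KB.
rewrite (@Lp_norm_ae w p (kernel_op O K g) (fun x => r^-1 * kernel_op O K f x))//; last 2 first.
- exact: measurable_funM.
- by apply: filterS (Kdef _ Lf) => x df Ox; rewrite kernel_opZ//; exact: df.
rewrite Lp_normZ// ger0_norm ?invr_ge0 ?(ltW r0)// => h.
have := lee_wpmul2l (_ : 0 <= r%:E)%E h; rewrite lee_fin (ltW r0) => /(_ isT).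
by rewrite muleA -EFinM mulfV ?gt_eqF// mul1e.
Qed.

(** Fubini for [a z * b z y * f y]. The factor [f y] can be taken out at every [y] of [O], even
    where the integral over [z] diverges, by [RintegralZl_measurable]. *)
Lemma kernel_comp (a : E -> R) (b : E -> E -> R) f : measurable_fun O a ->
  measurable_fun (O `*` O) (fun z : E * E => b z.1 z.2) -> measurable_fun O f ->
  (\int[mu]_(z in O) (`|a z|%:E * \int[mu]_(y in O) `|b z y * f y|%:E) < +oo)%E ->
  let H y := \int[mu]_(z in O) (a z * b z y) in
  mu.-integrable O (fun y => (H y * f y)%:E) /\
  \int[mu]_(y in O) (H y * f y) = \int[mu]_(z in O) (a z * \int[mu]_(y in O) (b z y * f y)).
Proof.
move=> ma mb mf foo H.
pose F (q : E * E) := a q.1 * (b q.1 q.2 * f q.2).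
have mbf : measurable_fun (O `*` O) (fun q : E * E => b q.1 q.2 * f q.2).
  apply: measurable_funM => //.
  by apply: (measurable_comp mO _ mf) => [_ [q [_ ?] <-]//|]; exact: measurable_funTS.
have mF : measurable_fun (O `*` O) F.
  apply: measurable_funM => //.
  by apply: (measurable_comp mO _ ma) => [_ [q [? _] <-]//|]; exact: measurable_funTS.
have sec z : O z -> measurable_fun O (fun y => b z y * f y).
  move=> Oz; have := measurable_fun_section (g := fun q : E * E => (b q.1 q.2 * f q.2)%:E) mO mO _ Oz.
  by move/measurable_EFinP : mbf => mbf /(_ mbf)/measurable_EFinP.
have sec2 y : O y -> measurable_fun O (fun z => a z * b z y).
  move=> Oy; apply: measurable_funM => //.
  have mOO : measurable (O `*` O) by exact: measurableX.
  move=> _ Y mY; have := mb mOO Y mY => /(measurable_ysection y).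
  congr measurable; apply/seteqP; split => z; rewrite /ysection/= inE/=.
    by move=> [[]].
  by move=> [? ?].
have Foo : (\int[mu]_(x in O) \int[mu]_(y in O) `|F (x, y)|%:E < +oo)%E.
  apply: le_lt_trans foo; rewrite le_eqVlt; apply/orP; left; apply/eqP.
  apply: eq_integral => z /set_mem Oz; rewrite -ge0_integralZl_real//; last first.
    by apply: measurableT_comp => //; exact: sec.
  by apply: eq_integral => y _; rewrite /F/= normrM.
have HF y : O y -> \int[mu]_(z in O) F (z, y) = H y * f y.
  move=> Oy; rewrite [RHS]mulrC /H -RintegralZl_measurable//; last exact: sec2.
  by apply: eq_Rintegral => z _; rewrite /F/=; ring.
split.
  apply: eq_integrable (fubini_rect_integrable mO mO mF Foo) => //.
  by move=> y /set_mem Oy; rewrite HF.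
rewrite -(_ : \int[mu]_(y in O) \int[mu]_(z in O) F (z, y) = \int[mu]_(y in O) (H y * f y)); last first.
  by apply: eq_Rintegral => y /set_mem Oy; rewrite HF.
rewrite -(fubini_rect mO mO mF Foo); apply: eq_Rintegral => z /set_mem Oz.
by rewrite -RintegralZl_measurable//; exact: sec.
Qed.

End Lp_operators.

(** The factor [1 / sqrt t] of the gradient bound meets the factor [sqrt (c t)] of the lower bound,
    which leaves a constant free of [t]. The exponent [|x - y|^2 / (4 c t)] belongs to variance
    [2 c t], whence [tau = 2 c]. *)
Lemma green_two_sided (R : realType) (n : nat) (O : set 'rV[R]_n.+1)
    (a : 'rV[R]_n.+1 -> 'M[R]_n.+1) (b : 'rV[R]_n.+1 -> 'rV[R]_n.+1)
    (S : R -> ('rV[R]_n.+1 -> R) -> 'rV[R]_n.+1 -> R)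
    (G : R -> 'rV[R]_n.+1 -> 'rV[R]_n.+1 -> R) :
  open O -> O <> setT -> kernel_hypothesis O a b S G ->
  exists C tau : R, [/\ 0 < C, 0 < tau & forall t, 0 < t -> t <= 1 ->
    {ae lebesgue_rV R n.+1, forall x, O x -> {ae lebesgue_rV R n.+1, forall y, O y ->
      `|G t x y| <= C * (mt O t y * gauss (tau * t) (x - y))}}].
Proof.
move=> oO OT [_ dir green _ [C [c [C0 c0 bd]]]].
pose k : R := 2 `^ (n.+1%:R / 2).
have k0 : 0 < k by exact: powR_gt0.
pose e : R := Num.sqrt c * expR 1.
have e0 : 0 < e by rewrite mulr_gt0 ?sqrtr_gt0 ?expR_gt0.
(* [k] is the cost of passing from variance [c t] to [2 c t]; the summand 1 serves the upper bound
   and [e] the lower one. *)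
exists (C * k * (1 + e)), (2 * c); split.
- by rewrite !mulr_gt0// addr_gt0.
- by rewrite mulr_gt0.
move=> t t0 t1; have ct0 : 0 < c * t by rewrite mulr_gt0.
have st0 : 0 < Num.sqrt t by rewrite sqrtr_gt0.
have [mG rep] := green t t0.
pose q : R := (2 * pi * (c * t)) `^ (- (n.+1%:R / 2)).
have q0 : 0 <= q by exact: powR_ge0.
pose B (y : 'rV[R]_n.+1) := C * (mt O t y / Num.sqrt t) * q.
have B0 y : 0 <= B y <= C * (1 / Num.sqrt t) * q.
  rewrite /B !mulr_ge0 ?mt_ge0 ?invr_ge0 ?sqrtr_ge0 ?(ltW C0)//=.
  by rewrite ler_wpM2r// ler_wpM2l ?(ltW C0)// ler_wpM2r ?invr_ge0 ?sqrtr_ge0// mt_le1.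
have mB : measurable_fun setT B.
  apply: measurable_funM => //; apply: measurable_funM => //; apply: measurable_funM => //.
  exact: measurable_mt.
have H10G f : in_Lp O (fun=> 1) 2 f -> exists v, H10 O (S t f) v.
  by move=> Lf; have [_ /(_ t t0)[v Hv _]] := dir f Lf; exists v.
have dG x y : O x -> O y -> differentiable (G t ^~ y) x.
  by move=> Ox Oy; have [] := bd t x y t0 t1 Ox Oy.
have bG x y : O x -> O y ->
    enorm (grad (G t ^~ y) x) <= B y * expR (- (enorm (x - y) ^+ 2 / (2 * (c * t)))).
  by move=> Ox Oy; have [_ _] := bd t x y t0 t1 Ox Oy; rewrite /gauss mulrA.
have := kernel_lower_bound oO mG rep H10G ct0 B0 mB dG bG.
apply: filterS => x Hx Ox; apply: filterS (Hx Ox) => y Hy Oy.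
have m0 : 0 <= mt O t y by exact: mt_ge0.
have g0 : 0 <= gauss (2 * (c * t)) (x - y) by exact: gauss_ge0.
set E4 := expR (- (enorm (x - y) ^+ 2 / (4 * (c * t)))).
have E41 : E4 <= 1.
  by rewrite /E4 expR_le1 oppr_le0 divr_ge0 ?sqr_ge0// mulr_ge0// ltW.
have gE : gauss (c * t) (x - y) = k * E4 * gauss (2 * (c * t)) (x - y).
  exact: gauss_double.
have qE : q * E4 = k * gauss (2 * (c * t)) (x - y).
  have : q * (E4 * E4) = k * E4 * gauss (2 * (c * t)) (x - y).
    rewrite -gE /gauss -/q /E4 -expRD; congr (_ * expR _); field.
    by rewrite !gt_eqF.
  have E40 : E4 != 0 by rewrite gt_eqF// expR_gt0.
  by move=> h; apply: (mulIf E40); rewrite -mulrA h; ring.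
have sqE : Num.sqrt (c * t) / Num.sqrt t = Num.sqrt c.
  by rewrite sqrtrM ?(ltW c0)// mulfK// gt_eqF.
have [up _ _] := bd t x y t0 t1 Ox Oy.
rewrite -[2 * c * t]mulrA.
move: (gauss (2 * (c * t)) (x - y)) (gauss (c * t) (x - y)) g0 gE qE up => g g' g0 gE qE up.
rewrite ler_norml; apply/andP; split; last first.
  apply: le_trans up _; rewrite gE.
  apply: (@le_trans _ _ (C * k * 1 * (mt O t y * g))).
    rewrite (_ : C * mt O t y * _ = (C * k * mt O t y * g) * E4); last by ring.
    rewrite (_ : C * k * 1 * _ = (C * k * mt O t y * g) * 1); last by ring.
    by rewrite ler_wpM2l// !mulr_ge0// ?(ltW C0) ?(ltW k0).
  by rewrite ler_wpM2r ?(mulr_ge0 m0 g0)// ler_wpM2l ?mulr_ge0 ?(ltW C0) ?(ltW k0)// lerDl ltW.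
rewrite lerNl; apply: (le_trans (Hy Oy)); rewrite -/E4 /B.
rewrite (_ : _ * E4 = C * (Num.sqrt (c * t) / Num.sqrt t * expR 1) * mt O t y * (q * E4)); last by ring.
rewrite sqE qE -/e.
apply: (@le_trans _ _ (C * k * e * (mt O t y * g))).
  by rewrite le_eqVlt; apply/orP; left; apply/eqP; ring.
by rewrite ler_wpM2r ?(mulr_ge0 m0 g0)// ler_wpM2l ?mulr_ge0 ?(ltW C0) ?(ltW k0)// lerDr.
Qed.

(** * Kernels dominated almost everywhere by the Gaussian majorant *)

Section dominated_kernel.
Variables (R : realType) (n : nat) (O : set 'rV[R]_n.+1).
Local Notation E := 'rV[R]_n.+1.
Local Notation mu := (lebesgue_rV R n.+1).
Variables (p t s C D : R) (K : E -> E -> R) (W w : E -> R) (f : E -> R).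
Hypotheses (oO : open O) (p1 : 1 <= p) (C0 : 0 <= C) (D0 : 0 <= D).
Hypothesis mK : measurable_fun (O `*` O) (fun z : E * E => K z.1 z.2).
Hypothesis bK : {ae mu, forall x, O x -> {ae mu, forall y, O y ->
  `|K x y| <= C * (mt O t y * gauss s (x - y))}}.
Hypotheses (mW : measurable_fun setT W) (W0 : forall x, O x -> 0 < W x).
Hypotheses (W00 : forall x, 0 <= W x) (w0 : forall x, 0 <= w x).
Hypothesis Lf : in_Lp O w p f.
Hypothesis HD : (\int[mu]_(x in O) (majorant O t s f x `^ p * (W x)%:E) <=
  D%:E * \int[mu]_(y in O) (`|f y| `^ p * w y)%:E)%E.

Let mO : measurable O. Proof. exact: open_measurable_rV. Qed.
Let mf : measurable_fun O f. Proof. by case: Lf. Qed.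
Let p0 : 0 < p. Proof. exact: lt_le_trans p1. Qed.

Let foo : (\int[mu]_(y in O) (`|f y| `^ p * w y)%:E < +oo)%E.
Proof. by case: Lf => _; apply: lty_poweRy; rewrite invr_neq0// gt_eqF. Qed.

Let mM : measurable_fun O (majorant O t s f).
Proof. exact: measurable_majorant. Qed.

Let mMp : measurable_fun O (fun x => majorant O t s f x `^ p * (W x)%:E)%E.
Proof.
apply: emeasurable_funM; first exact: (measurableT_comp (measurable_poweR p) mM).
by apply/measurable_EFinP; exact: measurable_funTS.
Qed.

Let Moo : (\int[mu]_(x in O) (majorant O t s f x `^ p * (W x)%:E) < +oo)%E.
Proof. by apply: le_lt_trans HD _; rewrite lte_mul_pinfty// lee_fin. Qed.

Let Mp0 x : (0 <= majorant O t s f x `^ p * (W x)%:E)%E.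
Proof. by rewrite mule_ge0 ?poweR_ge0 ?lee_fin. Qed.

Lemma majorant_lty : {ae mu, forall x, O x -> (majorant O t s f x < +oo)%E}.
Proof.
have iM : mu.-integrable O (fun x => majorant O t s f x `^ p * (W x)%:E)%E.
  apply/integrableP; split => //; apply: le_lt_trans Moo.
  by rewrite le_eqVlt; apply/orP; left; apply/eqP; apply: eq_integral => x _; rewrite gee0_abs.
apply: filterS (integrable_ae mO iM) => x /[swap] Ox /(_ Ox).
rewrite ge0_fin_numE// => h; apply: (@lty_poweRy _ _ p); first by rewrite gt_eqF.
rewrite ltNge leye_eq; apply/negP => /eqP MM; move: h.
by rewrite MM gt0_mulye// lte_fin W0.
Qed.

(** The majorant thereby becomes a legitimate argument for an operator acting on the space of weight
    [W], which yields absolute convergence of iterated integrals. *)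
Lemma majorant_in_Lp : in_Lp O W p (fine \o majorant O t s f).
Proof.
have mFM : measurable_fun O (fine \o majorant O t s f).
  by apply: (measurableT_comp _ mM); exact: fine_measurable.
split => //; apply: poweR_lty; apply: le_lt_trans Moo.
apply: ae_ge0_le_integral => //.
- by move=> x _; rewrite lee_fin mulr_ge0 ?powR_ge0.
- by apply: measurable_Lp_integrand => //; exact: measurable_funTS.
apply: filterS majorant_lty => x + Ox => /(_ Ox) h.
have Mf : majorant O t s f x \is a fin_num by rewrite ge0_fin_numE// majorant_ge0.
by rewrite -[in leRHS](fineK Mf) poweR_EFin -EFinM /= ger0_norm// fine_ge0// majorant_ge0.
Qed.

Let sec x : O x -> measurable_fun O (fun y => K x y * f y).
Proof.
move=> Ox; apply: measurable_funM => //.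
have /measurable_EFinP mK' := mK.
by have /measurable_EFinP := measurable_fun_section (g := fun q : E * E => (K q.1 q.2)%:E) mO mO mK' Ox.
Qed.

Lemma integral_kernel_le_majorant :
  {ae mu, forall x, O x -> (\int[mu]_(y in O) `|K x y * f y|%:E <= C%:E * majorant O t s f x)%E}.
Proof.
apply: filterS bK => x Kx Ox; have {}Kx := Kx Ox.
have mg : measurable_fun O (fun y : E => mt O t y * gauss s (x - y) * `|f y|).
  apply: measurable_funM; last exact: measurableT_comp.
  apply: measurable_funTS; apply: measurable_funM; first exact: measurable_mt.
  by under eq_fun do rewrite gaussB; exact: measurable_gaussB.
have g0 y : 0 <= mt O t y * gauss s (x - y) * `|f y|.
  by apply: mulr_ge0 => //; apply: mulr_ge0; [exact: mt_ge0|exact: gauss_ge0].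
rewrite /majorant -ge0_integralZl_real//.
apply: ae_ge0_le_integral => //.
- by apply/measurable_EFinP; apply: measurableT_comp => //; exact: sec.
- by move=> y _; rewrite lee_fin mulr_ge0.
- by apply/measurable_EFinP; exact: measurable_funM.
by apply: filterS Kx => y + Oy => /(_ Oy) h; rewrite lee_fin normrM mulrA ler_wpM2r.
Qed.

Lemma dominated_kernel_defined : {ae mu, forall x, O x -> kernel_defined_at O K f x}.
Proof.
apply: filterS2 majorant_lty integral_kernel_le_majorant => x + + Ox => /(_ Ox) h /(_ Ox) k.
apply/integrableP; split; first by apply/measurable_EFinP; exact: sec.
by apply: le_lt_trans k _; rewrite lte_mul_pinfty// lee_fin.
Qed.

Lemma measurable_dominated_kernel : measurable_fun O (kernel_op O K f).
Proof.
apply: (measurable_Rintegral_section mu mO mO (g := fun q : E * E => K q.1 q.2 * f q.2)).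
apply: measurable_funM => //.
by apply: (measurable_comp mO _ mf) => [_ [q [_ ?] <-]//|]; exact: measurable_funTS.
Qed.

Lemma Lp_norm_dominated_kernel :
  (Lp_norm O W p (kernel_op O K f) <= (C * D `^ p^-1)%:E * Lp_norm O w p f)%E.
Proof.
have If0 : (0 <= \int[mu]_(y in O) (`|f y| `^ p * w y)%:E)%E.
  by apply: integral_ge0 => y _; rewrite lee_fin mulr_ge0 ?powR_ge0.
have CD : (C * D `^ p^-1)%:E = (((C `^ p * D)%:E) `^ p^-1)%E.
  by rewrite poweR_EFin powRM ?powR_ge0// -powRrM mulfV ?gt_eqF// powRr1.
rewrite CD /Lp_norm -poweRM//; last by rewrite lee_fin mulr_ge0 ?powR_ge0.
have LK : (\int[mu]_(x in O) (`|kernel_op O K f x| `^ p * W x)%:E <=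
    (C `^ p * D)%:E * \int[mu]_(y in O) (`|f y| `^ p * w y)%:E)%E.
  rewrite EFinM -muleA; apply: (@le_trans _ _ ((C `^ p)%:E *
      \int[mu]_(x in O) (majorant O t s f x `^ p * (W x)%:E))%E); last first.
    by apply: lee_wpmul2l; rewrite ?lee_fin ?powR_ge0.
  rewrite -ge0_integralZl//; last by rewrite lee_fin powR_ge0.
  apply: ae_ge0_le_integral => //.
  - by move=> x _; rewrite lee_fin mulr_ge0 ?powR_ge0.
  - apply: measurable_Lp_integrand; [exact: measurable_funTS|exact: measurable_dominated_kernel].
  - by move=> x _; rewrite mule_ge0// lee_fin powR_ge0.
  - by apply: emeasurable_funM.
  apply: filterS2 dominated_kernel_defined integral_kernel_le_majorant => x Kd Kb Ox.
  have {}Kd := Kd Ox; have {}Kb := Kb Ox.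
  rewrite muleA EFinM; apply: lee_wpmul2r; first by rewrite lee_fin.
  rewrite -[(C `^ p)%:E]poweR_EFin -[(`|_| `^ p)%:E]poweR_EFin -poweRM ?lee_fin//; last exact: majorant_ge0.
  apply: gt0_ler_poweR; first exact: ltW.
  - by rewrite in_itv/= lee_fin normr_ge0 leey.
  - by rewrite in_itv/= leey andbT mule_ge0 ?lee_fin// majorant_ge0.
  apply: le_trans Kb; have /integrableP[mKx _] := Kd.
  apply: le_trans (le_abse_integral mu mO mKx).
  rewrite /kernel_op /Rintegral.
  by case: (\int[mu]_(y in O) (K x y * f y)%:E)%E => [r| |] //=; rewrite normr0 leey.
apply: gt0_ler_poweR LK; first by rewrite invr_ge0 ltW.
- rewrite in_itv/= leey andbT; apply: integral_ge0 => x _.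
  by rewrite lee_fin mulr_ge0 ?powR_ge0.
- by rewrite in_itv/= leey andbT mule_ge0// lee_fin mulr_ge0 ?powR_ge0.
Qed.

(** The inner absolute integral is at most [C] times the majorant almost everywhere, and [K'] is
    absolutely integrable against the majorant. This is the hypothesis of [kernel_comp]. *)
Lemma iterated_integral_lty (K' : E -> E -> R) :
  measurable_fun (O `*` O) (fun z : E * E => K' z.1 z.2) ->
  {ae mu, forall x, O x -> kernel_defined_at O K' (fine \o majorant O t s f) x} ->
  {ae mu, forall x, O x ->
    (\int[mu]_(z in O) (`|K' x z|%:E * \int[mu]_(y in O) `|K z y * f y|%:E) < +oo)%E}.
Proof.
move=> mK'; apply: filterS => x + Ox => /(_ Ox) /integrableP[mKM].
have mKx : measurable_fun O (K' x).
  have /measurable_EFinP mk := mK'.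
  by have /measurable_EFinP := measurable_fun_section (g := fun q : E * E => (K' q.1 q.2)%:E) mO mO mk Ox.
have mFM : measurable_fun O (fine \o majorant O t s f).
  by apply: (measurableT_comp _ mM); exact: fine_measurable.
move=> fin; apply: (@le_lt_trans _ _
    (C%:E * \int[mu]_(z in O) (`|K' x z * fine (majorant O t s f z)|)%:E)%E).
  have mg : measurable_fun O (fun z => `|K' x z * fine (majorant O t s f z)|).
    by apply: measurableT_comp => //; exact: measurable_funM.
  rewrite -ge0_integralZl_real//; apply: ae_ge0_le_integral => //.
  - by move=> z _; rewrite mule_ge0 ?lee_fin// integral_ge0.
  - apply: emeasurable_funM; first by apply/measurable_EFinP; exact: measurableT_comp.
    apply: (measurable_ge0_integral_section mu mO mO
      (g := fun q : E * E => `|K q.1 q.2 * f q.2|%:E)) => //.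
    apply/measurable_EFinP; apply: measurableT_comp => //; apply: measurable_funM => //.
    by apply: (measurable_comp mO _ mf) => [_ [q [_ ?] <-]//|]; exact: measurable_funTS.
  - by move=> z _; rewrite lee_fin mulr_ge0.
  - by apply/measurable_EFinP; exact: measurable_funM.
  apply: filterS2 majorant_lty integral_kernel_le_majorant => z + + Oz.
  move=> /(_ Oz) h1 /(_ Oz) h2.
  have Mf : majorant O t s f z \is a fin_num by rewrite ge0_fin_numE// majorant_ge0.
  rewrite normrM mulrCA EFinM; apply: lee_wpmul2l; rewrite ?lee_fin//.
  by rewrite ger0_norm ?fine_ge0 ?majorant_ge0// EFinM fineK.
by rewrite lte_mul_pinfty// lee_fin.
Qed.

End dominated_kernel.

(** * Semigroup law for the kernels *)

Section chapman_kolmogorov.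
Variables (R : realType) (n : nat) (O : set 'rV[R]_n.+1).
Local Notation E := 'rV[R]_n.+1.
Local Notation mu := (lebesgue_rV R n.+1).
Variables (S : R -> (E -> R) -> E -> R) (G : R -> E -> E -> R) (s r : R).
Hypotheses (oO : open O) (s0 : 0 < s) (r0 : 0 < r).
Hypotheses (semiS : C0_semigroup_L2 O S) (greenS : green_kernel O S G).

Let mO : measurable O. Proof. exact: open_measurable_rV. Qed.

Let iterated f x :=
  (\int[mu]_(z in O) (`|G s x z|%:E * \int[mu]_(y in O) `|G r z y * f y|%:E) < +oo)%E.

Hypothesis iterated_gauss : forall W, measurable W ->
  {ae mu, forall x, O x -> iterated (gauss_indic W) x}.

Let mG t : 0 < t -> measurable_fun (O `*` O) (fun z : E * E => G t z.1 z.2).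
Proof. by move=> t0; have [] := greenS t0. Qed.

Let sec t x : 0 < t -> O x -> measurable_fun O (G t x).
Proof.
move=> t0 Ox; have /measurable_EFinP mg := mG t0.
by have /measurable_EFinP := measurable_fun_section (g := fun q : E * E => (G t q.1 q.2)%:E) mO mO mg Ox.
Qed.

Let H x y := \int[mu]_(z in O) (G s x z * G r z y).

(** For these L^2 functions the law of [S] is available; each side is rewritten as a kernel
    integral, and the iterated one is merged into a single integral with kernel [H]. *)
Let gauss_identity W : measurable W -> {ae mu, forall x, O x ->
  [/\ mu.-integrable O (fun y => (G (s + r) x y * gauss_indic W y)%:E),
      mu.-integrable O (fun y => (H x y * gauss_indic W y)%:E) &
      \int[mu]_(y in O) (G (s + r) x y * gauss_indic W y) =
      \int[mu]_(y in O) (H x y * gauss_indic W y)]}.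
Proof.
move=> mW; pose g : E -> R := gauss_indic W.
have sr0 : 0 < s + r by rewrite addr_gt0.
have Lg : in_Lp O (fun=> 1) 2 g by exact: gauss_indic_L2.
have mg : measurable_fun O g by case: Lg.
have LSg : in_Lp O (fun=> 1) 2 (S r g).
  by have [B _ _] := C0_bounded semiS (ltW r0); exact: B.
have h1 := C0_add semiS (ltW s0) (ltW r0) Lg.
have h2 := (greenS sr0).2 g Lg.
have h3 := (greenS s0).2 _ LSg.
have h4 := (greenS r0).2 g Lg.
have mKg : measurable_fun O (kernel_op O (G r) g).
  exact: (measurable_dominated_kernel (p := 2) oO (mG r0) Lg).
have h5 x : O x -> kernel_op O (G s) (S r g) x = kernel_op O (G s) (kernel_op O (G r) g) x.
  move=> Ox; congr fine; apply: ae_eq_integral => //.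
  - by apply/measurable_EFinP; apply: measurable_funM; [exact: sec|case: LSg].
  - by apply/measurable_EFinP; apply: measurable_funM; [exact: sec|exact: mKg].
  by apply: filterS h4 => z /[swap] Oz /(_ Oz)[_ e]; rewrite e.
have h6 := iterated_gauss mW.
have h36 : {ae mu, forall x, O x ->
    S s (S r g) x = kernel_op O (G s) (S r g) x /\ iterated g x}.
  by apply: filterS2 h3 h6 => x + + Ox => /(_ Ox)[_ ?] /(_ Ox).
apply: filterS3 h1 h2 h36 => x + + + Ox => /(_ Ox) e1 /(_ Ox)[d2 e2] /(_ Ox)[e3 fin].
have [iH eH] := kernel_comp mO (sec s0 Ox) (mG r0) mg fin.
split => //; rewrite [RHS]eH.
by move: e2; rewrite e1 e3 h5.
Qed.

(** For almost every [x] both kernels have equal integrals against [gauss 1] over every set of a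
    countable generating ring; such integrals determine a function of [y] almost everywhere. *)
Lemma green_chapman_kolmogorov : {ae mu, forall x, O x ->
  {ae mu, forall y, O y -> G (s + r) x y = \int[mu]_(z in O) (G s x z * G r z y)}}.
Proof.
pose W := table_set (@rat_halfspace R n.+1).
have mW p : measurable (W p).
  exact: (measurable_table_set (@measurable_rat_halfspace R n.+1)).
have : {ae mu, forall x, forall p, O x ->
  [/\ mu.-integrable O (fun y => (G (s + r) x y * gauss_indic (W p) y)%:E),
      mu.-integrable O (fun y => (H x y * gauss_indic (W p) y)%:E) &
      \int[mu]_(y in O) (G (s + r) x y * gauss_indic (W p) y) =
      \int[mu]_(y in O) (H x y * gauss_indic (W p) y)]}.
  by apply: ae_forall_countable => p; exact: gauss_identity.
apply: filterS => x Hx Ox.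
pose h y := (G (s + r) x y - H x y) * gauss 1 y.
have hE p y : G (s + r) x y * gauss_indic (W p) y - H x y * gauss_indic (W p) y =
    h y * \1_(W p) y.
  by rewrite /h /gauss_indic; ring.
have ih : mu.-integrable O (EFin \o h).
  have [p _ pT] := table_setT (@rat_halfspace R n.+1).
  have [i1 i2 _] := Hx p Ox.
  apply: eq_integrable (integrableB mO i1 i2) => // y _.
  by rewrite -EFinB hE /W pT indicT mulr1.
have h0 p : (\int[mu]_(y in O `&` W p) (h y)%:E = 0)%E.
  have [i1 i2 e12] := Hx p Ox.
  rewrite integral_mkcondr.
  transitivity (\int[mu]_(y in O) ((G (s + r) x y * gauss_indic (W p) y)%:E -
      (H x y * gauss_indic (W p) y)%:E))%E.
    apply: eq_integral => y _; rewrite -EFinB hE /patch indicE.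
    by case: ifP => _; rewrite ?mulr1 ?mulr0.
  rewrite integralB//; move: e12; rewrite /Rintegral.
  have := integrable_fin_num mO i1; have := integrable_fin_num mO i2.
  case: (\int[mu]_(y in O) (G (s + r) x y * _)%:E)%E => [u| |] //.
  case: (\int[mu]_(y in O) (H x y * _)%:E)%E => [v| |] // _ _ /= ->.
  by rewrite -EFinB subrr.
have sg k : {ae mu, forall y, O y -> k * h y <= 0}.
  apply: (ae_le0_table_set mO (@measurable_rat_halfspace R n.+1)).
    exact: (integrableZl mO k ih).
  move=> p; have iW := integrableS mO (measurableI _ _ mO (mW p)) (@subIsetl _ _ _) ih.
  have := integralZl (measurableI _ _ mO (mW p)) iW k; rewrite /= h0 mule0.
  by move=> e; rewrite (_ : (\int[mu]_(_ in _) _)%E = 0%E).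
apply: filterS2 (sg 1) (sg (-1)) => y h1 h2 Oy.
have : h y = 0.
  by apply/eqP; rewrite eq_le; have := h1 Oy; have := h2 Oy; rewrite mulN1r mul1r oppr_le0 => -> ->.
move=> /eqP; rewrite mulf_eq0 [X in _ || X]gt_eqF ?gauss_gt0// orbF subr_eq0.
by move=> /eqP.
Qed.

(** Once established for the kernels, the law extends to any measurable [f] whose iterated absolute
    integral converges, inside L^2 or not. *)
Lemma green_semigroup f : measurable_fun O f ->
  {ae mu, forall x, O x -> iterated f x} ->
  {ae mu, forall x, O x -> kernel_defined_at O (G (s + r)) f x /\
    kernel_op O (G (s + r)) f x = kernel_op O (G s) (kernel_op O (G r) f) x}.
Proof.
move=> mf fin; have sr0 : 0 < s + r by rewrite addr_gt0.
apply: filterS2 green_chapman_kolmogorov fin => x + + Ox => /(_ Ox) ck /(_ Ox) fx.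
have [iH eH] := kernel_comp mO (sec s0 Ox) (mG r0) mf fx.
have mGf : measurable_fun O (fun y => (G (s + r) x y * f y)%:E).
  by apply/measurable_EFinP; apply: measurable_funM => //; exact: sec.
have mHf := measurable_int _ iH.
have ae : ae_eq mu O (fun y => (G (s + r) x y * f y)%:E) (fun y => (H x y * f y)%:E).
  by apply: filterS ck => y /[swap] Oy /(_ Oy) ->.
split.
  apply/integrableP; split => //; have /integrableP[_] := iH; apply: le_lt_trans.
  rewrite le_eqVlt; apply/orP; left; apply/eqP; apply: ae_eq_integral => //.
  - exact: measurableT_comp.
  - exact: measurableT_comp.
  by apply: filterS ae => y h Oy; rewrite h.
by rewrite {2}/kernel_op -[RHS]eH; congr fine; exact: ae_eq_integral.
Qed.

End chapman_kolmogorov.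

(** A bounded integrable function lies in L^p for every [p >= 1], and the weight is at most 1. *)
Lemma gauss_indic_Lp (R : realType) (n : nat) (O W : set 'rV[R]_n.+1) (p : R)
    (w : 'rV[R]_n.+1 -> R) :
  open O -> measurable W -> 1 <= p -> measurable_fun setT w ->
  (forall x, 0 <= w x) -> (forall x, w x <= 1) -> in_Lp O w p (gauss_indic W).
Proof.
move=> oO mW p1 mw w0 w1.
have mO : measurable O by exact: open_measurable_rV.
have mg : measurable_fun O (gauss_indic W).
  by apply: measurable_funTS; exact: measurable_gauss_indic.
have p0 : 0 < p by exact: lt_le_trans p1.
split => //; apply: poweR_lty.
pose c0 : R := (2 * pi * (1:R)) `^ (- (n.+1%:R / 2)).
have /integrableP[_ ig] := integrable_gauss_indic oO mW.
apply: (@le_lt_trans _ _ ((c0 `^ (p - 1))%:E *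
    \int[lebesgue_rV R n.+1]_(x in O) `|gauss_indic W x|%:E)%E); last first.
  by rewrite lte_mul_pinfty// lee_fin powR_ge0.
have mag : measurable_fun O (fun x => `|gauss_indic W x|) by exact: measurableT_comp.
rewrite -ge0_integralZl_real//; last exact: powR_ge0.
apply: ge0_le_integral => //.
- by move=> x _; rewrite lee_fin mulr_ge0 ?powR_ge0.
- by apply: measurable_Lp_integrand => //; exact: measurable_funTS.
- by apply/measurable_EFinP; exact: measurable_funM.
move=> x _; rewrite lee_fin.
have gc : `|gauss_indic W x| <= c0.
  rewrite ger0_norm ?gauss_indic_ge0// /gauss_indic.
  apply: (@le_trans _ _ (gauss 1 x)).
    by rewrite ler_piMr ?gauss_ge0// indicE; case: (_ \in _).
  by rewrite /gauss ler_piMr ?powR_ge0// expR_le1 oppr_le0 divr_ge0 ?sqr_ge0//.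
rewrite {1}(_ : p = p - 1 + 1); last by rewrite subrK.
rewrite powRD; last by rewrite subrK gt_eqF.
rewrite powRr1// -[leRHS]mulr1; apply: ler_pM => //.
by rewrite ler_wpM2r//; apply: ge0_ler_powR; rewrite ?nnegrE ?subr_ge0 ?powR_ge0.
Qed.

Lemma ler_Lp_norm_weight (R : realType) (d : nat) (O : set 'rV[R]_d) (p : R)
    (w W f : 'rV[R]_d -> R) : measurable O -> 0 < p ->
  measurable_fun O w -> measurable_fun O W -> measurable_fun O f ->
  (forall x, 0 <= w x) -> (forall x, w x <= W x) -> (Lp_norm O w p f <= Lp_norm O W p f)%E.
Proof.
move=> mO p0 mw mW mf w0 wW.
have W0 x : 0 <= W x by exact: le_trans (w0 x) (wW x).
apply: gt0_ler_poweR; first by rewrite invr_ge0 ltW.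
- rewrite in_itv/= leey andbT; apply: integral_ge0 => x _.
  by rewrite lee_fin mulr_ge0 ?powR_ge0.
- rewrite in_itv/= leey andbT; apply: integral_ge0 => x _.
  by rewrite lee_fin mulr_ge0 ?powR_ge0.
apply: ge0_le_integral => //.
- by move=> x _; rewrite lee_fin mulr_ge0 ?powR_ge0.
- exact: measurable_Lp_integrand.
- exact: measurable_Lp_integrand.
by move=> x _; rewrite lee_fin ler_wpM2l ?powR_ge0.
Qed.

Lemma kernel_op_norm_le_trans (R : realType) (d : nat) (O : set 'rV[R]_d) (p : R)
    (w : 'rV[R]_d -> R) (K : 'rV[R]_d -> 'rV[R]_d -> R) (B B' : R) :
  B <= B' -> kernel_op_norm_le O w p K B -> kernel_op_norm_le O w p K B'.
Proof. by move=> BB [? ? KB]; split => //; apply: le_trans KB _; rewrite lee_fin. Qed.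

Theorem theorem5p2 (R : realType) (n : nat) (O : set 'rV[R]_n.+1)
    (a : 'rV[R]_n.+1 -> 'M[R]_n.+1) (mu : 'rV[R]_n.+1 -> 'rV[R]_n.+1)
    (S : R -> ('rV[R]_n.+1 -> R) -> 'rV[R]_n.+1 -> R)
    (G : R -> 'rV[R]_n.+1 -> 'rV[R]_n.+1 -> R)
    (p theta delta : R)
    (hp : 1 <= p) (htheta0 : 0 <= theta) (htheta : theta < 2 * p - 1)
    (hdelta : 0 <= delta)
    (hopen : open O) (hconn : connected O) (hO : O <> [set: 'rV[R]_n.+1])
    (hdom : exists beta : R, [/\ 0 < beta, beta < 1 & C1beta_domain beta O])
    (hline : connected_line_condition O)
    (hker : kernel_hypothesis O a mu S G)
    (M alpha : R) (hM : 0 < M) (halpha : 0 < alpha)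
    (hdecay : forall t : R, 0 < t ->
       kernel_op_norm_le O (wdelta delta) p (G t) (M * expR (- alpha * t))) :
  exists2 C : R, 0 < C &
    forall t : R, 0 < t ->
      kernel_op_norm_le O (wtheta_delta O theta delta) p (G t)
        (C * expR (- alpha * t)).
Proof.
have mO : measurable O by exact: open_measurable_rV.
have p0 : 0 < p by exact: lt_le_trans hp.
have [C [c [C0 c0 bG]]] := green_two_sided hopen hO hker.
have [beta [_ _ dO]] := hdom.
have [gam /andP[g0 g1] thg] := exists_layer_exponent hp htheta.
have [A A0 HA] := gauss_mt_bound hopen hO dO g0 g1 c0.
have [Cw Cw0 HW] := wtheta_gauss O htheta0 hdelta c0.
have [Cd Cd0 HWd] := wdelta_gauss_theta O htheta0 hdelta c0.
set w := wtheta_delta O theta delta; set wd := @wdelta R n.+1 delta.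
have mw : measurable_fun setT w by exact: measurable_wtheta.
have mwd : measurable_fun setT wd by exact: measurable_wdelta.
have w0 x : 0 <= w x by exact: wtheta_ge0.
have wd0 x : 0 < wd x by exact: wdelta_gt0.
have wd0' x : 0 <= wd x by exact: ltW.
have wgt0 x : O x -> 0 < w x by exact: wtheta_gt0.
have wwd x : w x <= wd x by exact: wtheta_le_wdelta.
have mG t : 0 < t -> measurable_fun (O `*` O)
    (fun z : 'rV[R]_n.+1 * 'rV[R]_n.+1 => G t z.1 z.2).
  by move=> t0; have [] := kh_green hker t0.
pose D := A `^ (p - 1) * Cw; pose Dd := A `^ (p - 1) * Cd.
have D0 : 0 <= D by rewrite mulr_ge0 ?powR_ge0 ?(ltW Cw0).
have Dd0 : 0 <= Dd by rewrite mulr_ge0 ?powR_ge0 ?(ltW Cd0).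
pose B := C * D `^ p^-1; pose Bd := C * Dd `^ p^-1.
have B0 : 0 <= B by rewrite mulr_ge0 ?powR_ge0 ?(ltW C0).
have Bd0 : 0 < Bd by rewrite mulr_gt0// !powR_gt0// mulr_gt0// powR_gt0.
(* For [t <= 1] the factor [expR (alpha - alpha * t)] is at least 1; for [t > 1] it is the decay
   over the remaining time [t - 1]. [B] serves the first case, [M * Bd] the second. *)
exists (expR alpha * (B + M * Bd)) => [|t t0].
  by rewrite mulr_gt0 ?expR_gt0// ltr_wpDl// mulr_gt0.
have [t1|t1] := leP t 1.
  apply: (@kernel_op_norm_le_trans _ _ _ _ _ _ B).
    rewrite mulrAC -expRD -[leLHS]mul1r; apply: ler_pM => //.
      by rewrite -expR0 ler_expR mulNr -[X in X - _]mulr1 -mulrBr mulr_ge0 ?subr_ge0 ?(ltW halpha).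
    by rewrite lerDl mulr_ge0 ?(ltW hM) ?(ltW Bd0).
  apply: kernel_op_norm_le_intro => // f Lf; have [mf _] := Lf.
  have HD := schur hopen hO t0 (mulr_gt0 c0 t0) hp thg mw w0 mw w0 (ltW Cw0) mf
    (fun x => HA t x t0 t1) (fun x y => HW t x y t0 t1).
  split.
  - exact: (dominated_kernel_defined hopen hp (ltW C0) D0 (mG t t0) (bG t t0 t1) mw wgt0 w0 Lf HD).
  - exact: (measurable_dominated_kernel hopen (mG t t0) Lf).
  - exact: (Lp_norm_dominated_kernel hopen hp (ltW C0) D0 (mG t t0) (bG t t0 t1) mw wgt0 w0 w0 Lf HD).
have s0 : 0 < t - 1 by rewrite subr_gt0.
have l01 : 0 < 1 :> R by [].
have l11 : 1 <= 1 :> R by [].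
set e := M * expR (- alpha * (t - 1)).
have e0 : 0 < e by rewrite mulr_gt0 ?expR_gt0.
have dec : kernel_op_norm_le O wd p (G (t - 1)) e := hdecay _ s0.
(* The Schur bound at time 1 with left weight [wd] lands in the space where decay is assumed. *)
have HDd f : in_Lp O w p f -> (\int[lebesgue_rV R n.+1]_(x in O)
    (majorant O 1 (c * 1) f x `^ p * (wd x)%:E) <=
    Dd%:E * \int[lebesgue_rV R n.+1]_(y in O) (`|f y| `^ p * w y)%:E)%E.
  by move=> [mf _]; exact: (schur hopen hO l01 (mulr_gt0 c0 l01) hp thg mwd wd0' mw w0 (ltW Cd0) mf
    (fun x => HA 1 x l01 l11) (fun x y => HWd x y)).
have iter f : in_Lp O w p f -> {ae lebesgue_rV R n.+1, forall x, O x ->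
    (\int[lebesgue_rV R n.+1]_(z in O) (`|G (t - 1) x z|%:E *
      \int[lebesgue_rV R n.+1]_(y in O) `|G 1 z y * f y|%:E) < +oo)%E}.
  move=> Lf.
  have LM := majorant_in_Lp hopen hp Dd0 mwd (fun x _ => wd0 x) wd0' Lf (HDd f Lf).
  have [def _ _] := dec.
  exact: (iterated_integral_lty hopen hp (ltW C0) Dd0 (mG 1 l01) (bG 1 l01 l11) mwd
    (fun x _ => wd0 x) wd0' Lf (HDd f Lf) (mG _ s0) (def _ LM)).
apply: (@kernel_op_norm_le_trans _ _ _ _ _ _ (e * Bd)).
  rewrite /e (_ : - alpha * (t - 1) = alpha + - alpha * t); last by ring.
  rewrite expRD (_ : M * _ * Bd = expR alpha * (M * Bd) * expR (- alpha * t)); last by ring.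
  by rewrite ler_wpM2r ?expR_ge0// ler_wpM2l ?expR_ge0// lerDr.
(* The Gaussian test functions also lie in the space of weight [w], which provides the convergence
   behind the kernel identity. *)
have iterg W : measurable W -> _ := fun mW => iter (gauss_indic W)
  (gauss_indic_Lp hopen mW hp mw w0 (fun x => le_trans (wwd x) (wdelta_le1 hdelta x))).
have eB0 : 0 <= e * Bd by rewrite mulr_ge0 ?(ltW e0) ?(ltW Bd0).
apply: (kernel_op_norm_le_intro mO eB0) => f Lf.
have [mf _] := Lf.
have := green_semigroup hopen s0 l01 (kh_semigroup hker) (kh_green hker) iterg mf (iter f Lf).
rewrite subrK => sg.
have mKt : measurable_fun O (kernel_op O (G t) f).
  exact: (measurable_dominated_kernel hopen (mG t t0) Lf).
split => //; first by apply: filterS sg => x + Ox => /(_ Ox)[].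
pose h := kernel_op O (G 1) f.
have mh : measurable_fun O h by exact: (measurable_dominated_kernel hopen (mG 1 l01) Lf).
have hN : (Lp_norm O wd p h <= Bd%:E * Lp_norm O w p f)%E.
  exact: (Lp_norm_dominated_kernel hopen hp (ltW C0) Dd0 (mG 1 l01) (bG 1 l01 l11) mwd
    (fun x _ => wd0 x) wd0' w0 Lf (HDd f Lf)).
have Lh : in_Lp O wd p h.
  split => //; apply: le_lt_trans hN _; rewrite lte_mul_pinfty// ?lee_fin ?(ltW Bd0)//.
  by case: Lf.
have [_ [KLp _ _] _] := dec.
have [mKh _] := KLp _ Lh.
have mwO : measurable_fun O w by exact: measurable_funTS.
have mwdO : measurable_fun O wd by exact: measurable_funTS.
(* The chain: [w] is below [wd]; [G t] applied to [f] is [G (t - 1)] applied to [h] almost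
   everywhere; decay acts on [h], whose norm is at most [Bd] times that of [f]. *)
apply: le_trans (ler_Lp_norm_weight mO p0 mwO mwdO mKt w0 wwd) _.
rewrite (Lp_norm_ae mO p mwdO mKt mKh); last first.
  by apply: filterS sg => x + Ox => /(_ Ox)[].
apply: le_trans (kernel_op_norm_le_elim mO e0 p0 mwdO wd0' dec Lh) _.
have e0E : (0 <= e%:E)%E by rewrite lee_fin ltW.
by have := lee_wpmul2l e0E hN; rewrite muleA -EFinM.
Qed.
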